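(* Let $1\leq i\leq k<n$ be integers. Let $K\subset\mathbb{R}^n$ be a convex body whose centroid is at the origin, and let $E\in G(n,k)$ be a $k$-dimensional linear subspace of $\mathbb{R}^n$. Then $$\widetilde V_i(K\cap E)\ \geq\ \left(\frac{i+1}{n+1}\right)^i \max_{x\in K}\widetilde V_i\big((K-x)\cap E\big),$$ where the dual volumes $\widetilde V_i$ are taken within the $k$-dimensional space $E$. The constant is the best possible: for given integers $1\leq i\leq k<n$, there is no constant $C>\left(\frac{i+1}{n+1}\right)^i$ such that $\widetilde V_i(K\cap E)\geq C\max_{x\in K}\widetilde V_i\big((K-x)\cap E\big)$ holds for every convex body $K\subset\mathbb{R}^n$ with centroid at the origin and every $E\in G(n,k)$.
   Context: A convex body in $\mathbb{R}^n$ is a convex compact subset of $\mathbb{R}^n$ with non-empty interior. The centroid of a convex body $K$ is $g(K)=\frac{1}{\mathrm{vol}_n(K)}\int_K x\,dx$. $G(n,k)$ denotes the set of $k$-dimensional linear subspaces of $\mathbb{R}^n$, and $K-x=\{y-x : y\in K\}$. Let $E$ be a $k$-dimensional linear subspace of $\mathbb{R}^n$ and let $L\subset E$ be a compact set that contains the origin and is star-shaped with respect to the origin. Its radial function is $\rho_L(u)=\max\{a\geq 0 : au\in L\}$ for $u\in S^{n-1}\cap E$. For an integer $1\leq i\leq k$, the $i$th dual volume of $L$ taken within $E$ is $$\widetilde V_i(L)=\frac1k\int_{S^{n-1}\cap E}\rho_L(u)^i\,du=\frac{i}{k}\int_L |y|^{-k+i}\,dy,$$ where $du$ is the $(k-1)$-dimensional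 surface (spherical Lebesgue) measure on the unit sphere $S^{n-1}\cap E$ of $E$ (counting measure if $k=1$) and $dy$ is $k$-dimensional Lebesgue measure on $E$. *)

(* Defs.v *)
From HB Require Import structures.
From mathcomp Require Import all_boot all_order all_algebra.
From mathcomp Require Import all_classical all_reals all_analysis.
From mathcomp Require Import measurable_realfun.

Set Implicit Arguments.
Unset Strict Implicit.
Unset Printing Implicit Defensive.
Import Order.TTheory GRing.Theory Num.Theory.
Import numFieldNormedType.Exports.
Local Open Scope classical_set_scope.
Local Open Scope ring_scope.

Fact measure_rV_display : measure_display.
Proof. exact: default_measure_display. Qed.

(* The product sigma-algebra on R^n, generated by the coordinate functions; as
   R is second countable this is the Borel sigma-algebra of R^n. *)
Section measurable_rV.
Context {R : realType} (n : nat).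

Let coords (j : 'I_n) (x : 'rV[R]_n) : R := x 0 j.

Let rV_set0 : g_sigma_preimage coords set0.
Proof. exact: sigma_algebra0. Qed.

Let rV_setC A : g_sigma_preimage coords A -> g_sigma_preimage coords (~` A).
Proof. exact: sigma_algebraC. Qed.

Let rV_bigcup (F : _^nat) : (forall i, g_sigma_preimage coords (F i)) ->
  g_sigma_preimage coords (\bigcup_i (F i)).
Proof. exact: sigma_algebra_bigcup. Qed.

HB.instance Definition _ := @isMeasurable.Build measure_rV_display
  'rV[R]_n (g_sigma_preimage coords) rV_set0 rV_setC rV_bigcup.

End measurable_rV.

Lemma measurable_coord (R : realType) n (j : 'I_n) :
  measurable_fun [set: 'rV[R]_n] (fun x : 'rV[R]_n => x 0 j).
Proof.
move=> _ Y mY; rewrite setTI; apply: sub_sigma_algebra => /=.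
rewrite -bigcup_seq/=; exists j => /=; first by rewrite mem_index_enum.
by exists Y => //; rewrite setTI.
Qed.

Lemma measurable_fun_rV (R : realType) d (T : measurableType d) n
    (f : T -> 'rV[R]_n) :
  (forall j, measurable_fun setT (fun t => f t 0 j)) ->
  measurable_fun [set: T] f.
Proof.
move=> mf _ Y mY; rewrite setTI.
pose G := [set A : set 'rV[R]_n | measurable (f @^-1` A)].
suff : measurable `<=` G by exact.
apply: smallest_sub.
  split => [|A mA|F mF]; rewrite /G/=.
  - by rewrite preimage_set0.
  - by rewrite setTD -preimage_setC; exact: measurableC.
  - by rewrite preimage_bigcup; apply: bigcupT_measurable.
rewrite -bigcup_seq/= => A [j _ [B mB <-]].
by rewrite /G/= setTI; have := mf j measurableT B mB; rewrite setTI.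
Qed.

Definition rV_cons {R : realType} n (p : measurableTypeR R * 'rV[R]_n) :
  'rV[R]_n.+1 := row_mx (p.1%:M : 'rV[R]_1) p.2 : 'rV[R]_(1 + n).

Lemma rV_cons0 (R : realType) n (p : measurableTypeR R * 'rV[R]_n) :
  rV_cons p 0 ord0 = p.1.
Proof.
rewrite /rV_cons (_ : ord0 = lshift n (0 : 'I_1)); last exact/val_inj.
by rewrite (@row_mxEl R 1 1 n) mxE eqxx.
Qed.

Lemma rV_consS (R : realType) n (p : measurableTypeR R * 'rV[R]_n) (j : 'I_n) :
  rV_cons p 0 (lift ord0 j) = p.2 0 j.
Proof.
rewrite /rV_cons (_ : lift ord0 j = rshift 1 j); last exact/val_inj.
by rewrite (@row_mxEr R 1 1 n).
Qed.

Lemma measurable_rV_cons (R : realType) n :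
  measurable_fun setT (@rV_cons R n).
Proof.
apply: measurable_fun_rV => j; have [j' ->|->] := unliftP ord0 j.
- under eq_fun do rewrite rV_consS.
  exact: (measurableT_comp (measurable_coord j') measurable_snd).
- under eq_fun do rewrite rV_cons0.
  exact: measurable_fst.
Qed.

Lemma sigma_finite_prod d1 d2 (T1 : measurableType d1) (T2 : measurableType d2)
    (R : realType) (m1 : {sigma_finite_measure set T1 -> \bar R})
    (m2 : {sigma_finite_measure set T2 -> \bar R}) :
  sigma_finite setT (m1 \x m2)%E.
Proof.
have /sigma_finiteP[F [TF ndF Foo]] := sigma_finiteT m1.
have /sigma_finiteP[G [TG ndG Goo]] := sigma_finiteT m2.
exists (fun k => F k `*` G k).
  rewrite -setXTT TF TG predeqE => -[x y]; split.
    move=> [/= [k _ Fkx] [l _ Gly]]; exists (maxn k l) => //; split.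
    - by move: x Fkx; exact/subsetPset/ndF/leq_maxl.
    - by move: y Gly; exact/subsetPset/ndG/leq_maxr.
  by move=> [k _ []/= ? ?]; split; exists k.
move=> k; have [? ?] := Foo k; have [? ?] := Goo k.
split; first exact: measurableX.
by rewrite product_measure1E// lte_mul_pinfty// ge0_fin_numE.
Qed.

Section lebesgue_rV_step.
Context {R : realType} {n : nat}.
Variable m : {sigma_finite_measure set 'rV[R]_n -> \bar R}.

Definition lebesgue_rV_step : set 'rV[R]_n.+1 -> \bar R :=
  pushforward (lebesgue_measure \x m)%E (@rV_cons R n).

Let mu : {measure set 'rV[R]_n.+1 -> \bar R} :=
  measure_function_pushforward__canonical__measure_function_Measure
    ((lebesgue_measure \x m)%E : {measure set (measurableTypeR R * 'rV[R]_n) -> \bar R})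
    (@measurable_rV_cons R n).

HB.instance Definition _ := isMeasure.Build _ _ _ lebesgue_rV_step
  (measure0 mu) (measure_ge0 mu) (@measure_semi_sigma_additive _ _ _ mu).

Let sigma_finite_step : sigma_finite setT lebesgue_rV_step.
Proof.
have [F TF Foo] : sigma_finite setT (lebesgue_measure \x m)%E.
  exact: sigma_finite_prod.
pose g (x : 'rV[R]_n.+1) : measurableTypeR R * 'rV[R]_n :=
  (x 0 ord0, \row_j x 0 (lift ord0 j)).
have mg : measurable_fun setT g.
  apply: measurable_fun_pair; first exact: measurable_coord.
  apply: measurable_fun_rV => j.
  under eq_fun do rewrite mxE.
  exact: measurable_coord.
have gK p : g (rV_cons p) = p.
  rewrite /g rV_cons0 [RHS]surjective_pairing; congr pair.
  by apply/rowP => j; rewrite mxE rV_consS.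
exists (fun k => g @^-1` F k); first by rewrite -preimage_bigcup -TF preimage_setT.
move=> k; have [mF Fk] := Foo k; split.
  by have := mg measurableT _ mF; rewrite setTI.
rewrite /lebesgue_rV_step /pushforward -comp_preimage.
by rewrite (_ : g \o _ = id)//; apply/funext => p /=; exact: gK.
Qed.

HB.instance Definition _ := Measure_isSigmaFinite.Build _ _ _
  lebesgue_rV_step sigma_finite_step.

End lebesgue_rV_step.

(* Lebesgue measure on R^n, as the n-fold product of Lebesgue measure on R. *)
Fixpoint lebesgue_rV (R : realType) (n : nat) :
    {sigma_finite_measure set 'rV[R]_n -> \bar R} :=
  match n with
  | 0 => \d_(0 : 'rV[R]_0)
  | n'.+1 => lebesgue_rV_step (lebesgue_rV R n')
  end.
Arguments lebesgue_rV {R} n.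

Lemma lebesgue_rV_box (R : realType) n (A : 'I_n -> set R) :
  (forall j, measurable (A j)) ->
  lebesgue_rV n [set x | forall j, A j (x 0 j)] =
  (\prod_(j < n) lebesgue_measure (A j))%E.
Proof.
elim: n A => [|n IH] A mA.
  rewrite big_ord0 /= diracE mem_set//; by case.
rewrite big_ord_recl -IH; last by move=> j; exact: mA.
have mB : measurable [set x : 'rV[R]_n | forall j, A (lift ord0 j) (x 0 j)].
  rewrite (_ : [set _ | _] = \bigcap_(j in [set: 'I_n])
      ((fun x : 'rV[R]_n => x 0 j) @^-1` A (lift ord0 j))).
    apply: fin_bigcap_measurable => // j _.
    by rewrite -[X in measurable X]setTI; exact: measurable_coord.
  by apply/seteqP; split=> x /=; [move=> H j _; exact: H|move=> H j; exact: H].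
rewrite -(product_measure1E lebesgue_measure (lebesgue_rV n) (mA ord0) mB).
rewrite /= /lebesgue_rV_step /pushforward; congr (_ _).
apply/seteqP; split=> [[a x] /= H|[a x] [/= Aa H] j].
  split; first by have := H ord0; rewrite rV_cons0.
  by move=> j; have := H (lift ord0 j); rewrite rV_consS.
by have [j' ->|->] := unliftP ord0 j; rewrite ?rV_consS ?rV_cons0.
Qed.

Definition enorm {R : realType} n (x : 'rV[R]_n) : R :=
  Num.sqrt (\sum_j x 0 j ^+ 2).

Definition normalize {R : realType} n (x : 'rV[R]_n) : 'rV[R]_n :=
  (enorm x)^-1 *: x.

Lemma enormE (R : realType) n (x : 'rV[R]_n) :
  enorm x = Num.sqrt ((x *m x^T) 0 0).
Proof.
by rewrite /enorm mxE; congr Num.sqrt; apply: eq_bigr => j _; rewrite mxE expr2.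
Qed.

Lemma enorm_eq0 (R : realType) n (x : 'rV[R]_n) : (enorm x == 0) = (x == 0).
Proof.
apply/eqP/eqP => [/eqP|->]; last first.
  by rewrite /enorm big1 ?sqrtr0// => j _; rewrite mxE expr0n.
rewrite sqrtr_eq0 => x0; apply/rowP => j; rewrite mxE; apply/eqP.
rewrite -sqrf_eq0 eq_le sqr_ge0 andbT (le_trans _ x0)//.
by rewrite (bigD1 j)//= lerDl sumr_ge0// => i _; exact: sqr_ge0.
Qed.

Lemma measurable_sqnorm (R : realType) n :
  measurable_fun [set: 'rV[R]_n] (fun x => \sum_j x 0 j ^+ 2).
Proof.
apply: measurable_sum => j.
by apply: measurable_funX; exact: measurable_coord.
Qed.

Lemma measurable_enorm (R : realType) n :
  measurable_fun [set: 'rV[R]_n] (@enorm R n).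
Proof.
rewrite (_ : @enorm R n = fun x => (\sum_j x 0 j ^+ 2) `^ 2^-1).
  exact: (measurableT_comp (@measurable_powR _ _)
    (@measurable_sqnorm R n)).
apply/funext => x; rewrite powR12_sqrt//.
by apply: sumr_ge0 => j _; exact: sqr_ge0.
Qed.

Lemma measurable_normalize (R : realType) n :
  measurable_fun [set: 'rV[R]_n] (@normalize R n).
Proof.
apply: measurable_fun_rV => j.
under eq_fun do rewrite mxE.
apply: measurable_funM; last exact: measurable_coord.
rewrite (_ : (fun _ => _) = (fun x : 'rV[R]_n => enorm x `^ (-1))).
  exact: (measurableT_comp (@measurable_powR _ _)
    (@measurable_enorm R n)).
by apply/funext => x; rewrite powRN powRr1// sqrtr_ge0.
Qed.

Definition orthonormal_frame {R : realType} n (E : {vspace 'rV[R]_n})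
    (B : 'M[R]_(\dim E, n)) : Prop :=
  B *m B^T = 1%:M /\ forall j, row j B \in E.
Arguments orthonormal_frame {R n} E B.

Lemma orthonormal_frame_exists (R : realType) n (E : {vspace 'rV[R]_n}) :
  exists B, orthonormal_frame E B.
Proof.
suff H k (F : {vspace 'rV[R]_n}) : \dim F = k ->
    exists B : 'M[R]_(k, n), B *m B^T = 1%:M /\ forall j, row j B \in F.
  exact: H.
elim: k F => [|k IH] F dF.
  by exists 0; split=> [|[]//]; apply/matrixP => -[].
have v0 : vpick F != 0 by rewrite vpick0 -dimv_eq0 dF.
set v := vpick F in v0; pose u := normalize v.
have uF : u \in F by rewrite memvZ// memv_pick.
have uu : u *m u^T = 1%:M.
  apply/matrixP => i j; rewrite !ord1 /u /normalize linearZ/= -scalemxAl.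
  rewrite -scalemxAr !mxE eqxx/= mulr1n -[X in _ * (_ * X)]/(\sum_j _).
  have nv : enorm v != 0 by rewrite enorm_eq0.
  have -> : \sum_j v 0 j * v^T j 0 = enorm v ^+ 2.
    rewrite sqr_sqrtr; last by apply: sumr_ge0 => a _; exact: sqr_ge0.
    by apply: eq_bigr => a _; rewrite mxE expr2.
  by rewrite expr2 mulKf// mulVf//.
pose f := linfun (mulmxr u^T : 'rV[R]_n -> 'rV[R]_1).
have fE w : f w = w *m u^T by rewrite lfunE.
have df : \dim (f @: F) = 1%N.
  apply/eqP; rewrite eqn_leq; apply/andP; split.
    by rewrite (leq_trans (dimvS (subvf _)))// dimvf /dim/= mul1n.
  rewrite lt0n dimv_eq0; apply/eqP => f0.
  have : f u \in (f @: F)%VS by exact: memv_img.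
  rewrite f0 memv0 fE uu => /eqP/matrixP/(_ 0 0).
  by rewrite !mxE eqxx => /eqP; rewrite oner_eq0.
have [|B [BB BF]] := IH (F :&: lker f)%VS.
  by have := limg_ker_dim f F; rewrite df dF addn1 => -[].
have Bu : B *m u^T = 0.
  apply/row_matrixP => j; rewrite row_mul row0.
  by have := BF j; rewrite memv_cap memv_ker fE => /andP[_ /eqP].
exists (col_mx u B : 'M[R]_(1 + k, n)); split; last first.
  move=> j; rewrite -(@splitK 1 k j); case: (@fintype.split 1 k j) => a /=.
    rewrite (_ : row _ _ = u)//; apply/rowP => b; rewrite mxE.
    by rewrite (@col_mxEu R 1 k) ord1.
  rewrite (_ : row _ _ = row a B); last first.
    by apply/rowP => b; rewrite mxE (@col_mxEd R 1 k) mxE.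
  by have := BF a; rewrite memv_cap => /andP[].
rewrite (@tr_col_mx _ 1 k) (@mul_col_row _ 1 k n 1 k) uu BB Bu.
rewrite -[u *m B^T]trmxK trmx_mul trmxK Bu trmx0.
by rewrite -(@scalar_mx_block _ 1 k).
Qed.

(* Lebesgue measure on E, carried over from R^k with k = \dim E by the linear
   isometry onto E given by an orthonormal frame, and seen as a measure on R^n
   supported by E. It does not depend on the frame. *)
Definition frame {R : realType} n (E : {vspace 'rV[R]_n}) :
  'M[R]_(\dim E, n) := xget 0 [set B | orthonormal_frame E B].

Lemma frameP (R : realType) n (E : {vspace 'rV[R]_n}) :
  orthonormal_frame E (frame E).
Proof.
by have [B EB] := orthonormal_frame_exists E; rewrite /frame; exact: xgetI EB.
Qed.

Lemma measurable_mulmxr (R : realType) k n (B : 'M[R]_(k, n)) :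
  measurable_fun [set: 'rV[R]_k] (fun c : 'rV[R]_k => c *m B).
Proof.
apply: measurable_fun_rV => j; under eq_fun do rewrite mxE.
apply: measurable_sum => a; apply: measurable_funM; first exact: measurable_coord.
exact: measurable_cst.
Qed.

Section subspace_measures.
Context {R : realType} {n : nat}.
Variable E : {vspace 'rV[R]_n}.

Definition lebesgue_sub : set 'rV[R]_n -> \bar R :=
  pushforward (lebesgue_rV (\dim E)) (fun c => c *m frame E).

Let mu : {measure set 'rV[R]_n -> \bar R} :=
  measure_function_pushforward__canonical__measure_function_Measure
    (lebesgue_rV (\dim E)) (measurable_mulmxr (frame E)).

HB.instance Definition _ := isMeasure.Build _ _ _ lebesgue_sub
  (measure0 mu) (measure_ge0 mu) (@measure_semi_sigma_additive _ _ _ mu).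

Definition punctured_ball : set 'rV[R]_n := [set x | 0 < enorm x <= 1].

Lemma measurable_punctured_ball : measurable punctured_ball.
Proof.
rewrite (_ : punctured_ball = @enorm R n @^-1` `]0, 1]%classic); last first.
  by apply/seteqP; split=> x; rewrite /punctured_ball/= in_itv.
rewrite -[X in measurable X]setTI; exact: measurable_enorm.
Qed.

(* The (k-1)-dimensional surface measure on the unit sphere of E, k = \dim E:
   the measure of A is k times the Lebesgue measure of the cone
   { t u | 0 < t <= 1, u in A }. It is the counting measure when k = 1. *)
Definition surface_measure (A : set 'rV[R]_n) : \bar R :=
  ((\dim E)%:R%:E *
   lebesgue_sub ((@normalize R n) @^-1` A `&` punctured_ball))%E.

Let sigma : {measure set 'rV[R]_n -> \bar R} :=
  mscale (\dim E)%:R%:nng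
    (measure_function_pushforward__canonical__measure_function_Measure
      (mrestr lebesgue_sub measurable_punctured_ball)
      (@measurable_normalize R n)).

HB.instance Definition _ := isMeasure.Build _ _ _ surface_measure
  (measure0 sigma) (measure_ge0 sigma)
  (@measure_semi_sigma_additive _ _ _ sigma).

End subspace_measures.

Definition convex_body {R : realType} n (K : set 'rV[R]_n) : Prop :=
  [/\ convex_set K, compact K & K° !=set0].

Definition centroid {R : realType} n (K : set 'rV[R]_n) : 'rV[R]_n :=
  (fine (lebesgue_rV n K))^-1 *:
    \row_j \int[lebesgue_rV n]_(x in K) x 0 j.

(* The supremum is a maximum when L is compact and contains the origin. *)
Definition radial {R : realType} n (L : set 'rV[R]_n) (u : 'rV[R]_n) : R :=
  sup [set a | 0 <= a /\ L (a *: u)].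

Definition unit_sphere {R : realType} n (E : {vspace 'rV[R]_n}) :
  set 'rV[R]_n := [set u | u \in E /\ enorm u = 1].

(* The i-th dual volume of L taken within E, (1/k) times the integral of the
   i-th power of the radial function over the unit sphere of E, k = \dim E. It
   is finite when L is compact. *)
Definition dual_volume {R : realType} n (E : {vspace 'rV[R]_n}) (i : nat)
    (L : set 'rV[R]_n) : \bar R :=
  (((\dim E)%:R^-1)%:E *
   \int[surface_measure E]_(u in unit_sphere E) (radial L u ^+ i)%:E)%E.

Definition is_max_over {R : realType} (T : Type) (D : set T) (f : T -> \bar R)
    (M : \bar R) : Prop :=
  (exists2 x, D x & f x = M) /\ forall x, D x -> (f x <= M)%E.

(* Main.v *)
(* Let B be any i x n matrix and q_B(x) the Lebesgue measure of the e in R^i with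
   x + e B in K. By Brunn-Minkowski h = q_B^(1/i) is concave on K, so its value at
   the centroid is at least its mean over K, by Jensen. For x0 in K and 0 < t < 1,
   comparing h with its values on the homothetic body x0 + t (K - x0), with a Fubini
   argument along the fibres of B, shows that this mean is at least
   (i+1)/(n+1) h(x0). Hence q_B(0) >= ((i+1)/(n+1))^i q_B(x0) for every B.
   When i < k, averaging this over B = G F, with F an orthonormal frame of E and G a
   gaussian i x k matrix, turns q_B(x) into a constant times the dual volume of
   (K - x) cap E; when i = k, B = F suffices. The maximum is attained because the
   radial function is upper semicontinuous in x, with Fatou's lemma.
   For sharpness, K is a simplex whose sections parallel to E are products of an
   i-dimensional simplex scaled by a small e and of a (k-i)-dimensional one. As e
   tends to 0, the dual volume depends, up to a relatively small error, only on the
   size q of the thin factor, through q^i. *)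

Require Import Defs.
From HB Require Import structures.
From mathcomp Require Import all_boot all_order all_algebra.
From mathcomp Require Import fingroup perm.
From mathcomp Require Import all_classical all_reals all_analysis.
From mathcomp Require Import measurable_realfun.
From mathcomp Require Import ring lra zify.
Set Implicit Arguments.
Unset Strict Implicit.
Unset Printing Implicit Defensive.
Import Order.TTheory GRing.Theory Num.Theory.
Import numFieldNormedType.Exports.
Local Open Scope classical_set_scope.
Local Open Scope ring_scope.
Arguments lebesgue_rV {R} n.

(** * Lebesgue measure on R^n *)

(** The mean bound compares pairs of points [x], [x + e B] lying in [K] and in its homothetic copy
    [K']. The weight [h / q_{K'}] is constant along fibres, so exchanging the two sets bounds the
    integral of [h] over [K] below by [t^n] times that of [h(x)^(i+1) / (t h(z))^i] over [z] in [K],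
    with [x = x0 + t (z - x0)]. Concavity and two binomial terms leave [t h(z) + (i+1) (1-t) h(x0)];
    dividing by [1-t] and letting [t] tend to 1 gives [i+1] against [n+1]. Gaussian matrices replace
    a measure on a Grassmannian: [e G] is distributed as [|e|] times a gaussian vector for every
    [e]. The price is the constant [E |c|^(-i)], finite only for [i < k], and degenerate matrices,
    for which [q_B(0)] is infinite so that the bound holds anyway. For sharpness, consider points of
    the simplex with [i+1] barycentric coordinates equal to [q] and the other [n-i] equal to [d], so
    that [(i+1) q + (n-i) d = 1]. The centroid has [q = 1/(n+1)], whereas [q] tends to [1/(i+1)] as
    [d] tends to 0; the quotient of these sizes, to the power [i], is the constant. *)

Section lebesgue_real_line.
Context {R : realType}.
Local Notation mu := (@lebesgue_measure R).
Implicit Types f : measurableTypeR R -> \bar R.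
Local Open Scope ereal_scope.

(** The pushforward by the translation still gives []b, c]] its length, and Lebesgue measure is
    determined by these values; the scaling lemma below follows the same pattern. *)
Lemma ge0_integral_lebesgue_shift (a : R) f : measurable_fun setT f ->
  (forall s, 0 <= f s) -> \int[mu]_s f (s + a)%R = \int[mu]_s f s.
Proof.
move=> mf f0.
have mt : measurable_fun setT
    ((fun s => (s + a)%R) : measurableTypeR R -> measurableTypeR R).
  by apply: measurable_funD => //; exact: measurable_id.
have -> : \int[mu]_s f s = \int[pushforward mu
    ((fun s => (s + a)%R) : measurableTypeR R -> measurableTypeR R)]_s f s.
  apply: eq_measure_integral => A mA _; apply: lebesgue_measure_unique => //.
  move=> /= _ [[b c]] _ <-.
  rewrite [RHS](_ : _ = mu `](b - a)%R, (c - a)%R]%classic); last first.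
    rewrite /= /pushforward; congr (mu _); apply/seteqP; split=> x /=;
      by rewrite !in_itv/= ltrBlDr lerBrDr.
  rewrite !lebesgue_measure_itv/= !lte_fin ltrD2r.
  by case: ifPn => // _; rewrite -!EFinD; congr (_%:E); ring.
by rewrite ge0_integral_pushforward.
Qed.

Lemma ge0_integral_lebesgue_scale (a : R) f : (0 < a)%R ->
  measurable_fun setT f -> (forall s, 0 <= f s) ->
  a%:E * \int[mu]_s f (a * s)%R = \int[mu]_s f s.
Proof.
move=> a0 mf f0.
have mt : measurable_fun setT
    ((fun s => (a * s)%R) : measurableTypeR R -> measurableTypeR R).
  by apply: measurable_funM => //; exact: measurable_id.
pose nu : {measure set (measurableTypeR R) -> \bar R} :=
  measure_function_pushforward__canonical__measure_function_Measure mu mt.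
have -> : \int[mu]_s f s = \int[mscale (NngNum (ltW a0)) nu]_s f s.
  apply: eq_measure_integral => A mA _; apply: lebesgue_measure_unique => //.
  move=> /= _ [[b c]] _ <-.
  rewrite [RHS](_ : _ = a%:E * mu `](a^-1 * b)%R, (a^-1 * c)%R]%classic);
      last first.
    rewrite /= /mscale/= /pushforward; congr (_ * mu _).
    apply/seteqP; split=> x /=;
      by rewrite !in_itv/= ltr_pdivrMl// ler_pdivlMl.
  rewrite !lebesgue_measure_itv/= !lte_fin ltr_pM2l ?invr_gt0//.
  case: ifPn => _; rewrite ?mule0// -!EFinD -EFinM; congr (_%:E).
  by rewrite -mulrBr mulVKf// gt_eqF.
rewrite ge0_integral_mscale//= ge0_integral_pushforward//.
Qed.

Lemma ge0_integral_lebesgue_opp f : measurable_fun setT f ->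
  (forall s, 0 <= f s) -> \int[mu]_s f (- s)%R = \int[mu]_s f s.
Proof.
move=> mf f0.
have -> : \int[mu]_s f s =
    \int[pushforward mu (-%R : _ -> measurableTypeR R)]_s f s.
  by apply: eq_measure_integral => A mA _; exact/esym/lebesgue_measureN.
by rewrite ge0_integral_pushforward.
Qed.

Lemma ge0_integral_lebesgue_affine (a b : R) f : a != 0%R ->
  measurable_fun setT f -> (forall s, 0 <= f s) ->
  `|a|%:E * \int[mu]_s f (a * s + b)%R = \int[mu]_s f s.
Proof.
move=> a0 mf f0.
have mfb : measurable_fun [set: measurableTypeR R] (fun s => f (s + b)%R).
  by apply: measurableT_comp => //; apply: measurable_funD => //;
    exact: measurable_id.
case: (ltgtP a 0%R) a0 => // a0 _.
- rewrite ltr0_norm// -(ge0_integral_lebesgue_opp mf f0).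
  rewrite -[RHS](ge0_integral_lebesgue_shift (- b)); last 2 first.
  + by apply: measurableT_comp => //; exact: oppr_measurable.
  + by move=> s; exact: f0.
  rewrite -[RHS](@ge0_integral_lebesgue_scale (- a)) ?oppr_gt0//.
  + congr (_ * _); apply: eq_integral => s _; congr f.
    by rewrite opprD mulNr !opprK.
  + apply: measurableT_comp => //; apply: measurable_funN => //.
    by apply: measurable_funD => //; exact: measurable_id.
- rewrite gtr0_norm// -(ge0_integral_lebesgue_shift b mf f0).
  by rewrite -[RHS](@ge0_integral_lebesgue_scale a).
Qed.

End lebesgue_real_line.

Section lebesgue_rV_integral.
Context {R : realType}.
Local Open Scope ereal_scope.

Lemma rV_cons_surj n (x : 'rV[R]_n.+1) :
  rV_cons (x ord0 ord0, (\row_j x ord0 (lift ord0 j))%R) = x.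
Proof.
apply/rowP => j; have [j' ->|->] := unliftP ord0 j.
  by rewrite rV_consS mxE.
by rewrite rV_cons0.
Qed.

Lemma measurable_fun_cons n (f : 'rV[R]_n.+1 -> \bar R) :
  measurable_fun setT f ->
  measurable_fun [set: measurableTypeR R * 'rV[R]_n]
    (fun p => f (rV_cons p)).
Proof. by move=> mf; apply: measurableT_comp => //; exact: measurable_rV_cons. Qed.

Lemma integral_rV0 (f : 'rV[R]_0 -> \bar R) : measurable_fun setT f ->
  \int[lebesgue_rV 0]_x f x = f 0%R.
Proof. by move=> mf; rewrite /= integral_dirac// diracT mul1e. Qed.

Lemma ge0_integral_rVS n (f : 'rV[R]_n.+1 -> \bar R) :
  measurable_fun setT f -> (forall x, 0 <= f x) ->
  \int[lebesgue_rV n.+1]_x f x =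
  \int[lebesgue_measure]_s \int[lebesgue_rV n]_x f (rV_cons (s, x)).
Proof.
move=> mf f0.
transitivity (\int[lebesgue_measure \x lebesgue_rV n]_p f (rV_cons p)).
  rewrite [LHS](@ge0_integral_pushforward _ _ _ _ _ _ (@measurable_rV_cons R n))//.
by rewrite fubini_tonelli1//; exact: measurable_fun_cons.
Qed.

Lemma measurable_fun_addrV n (v : 'rV[R]_n) :
  measurable_fun setT (fun x : 'rV[R]_n => (x + v)%R).
Proof.
apply: measurable_fun_rV => j; under eq_fun do rewrite mxE.
by apply: measurable_funD => //; exact: measurable_coord.
Qed.

Lemma measurable_fun_scalerV n (a : R) :
  measurable_fun setT (fun x : 'rV[R]_n => (a *: x)%R).
Proof.
apply: measurable_fun_rV => j; under eq_fun do rewrite mxE.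
by apply: measurable_funM => //; exact: measurable_coord.
Qed.

Lemma measurable_fun_oppV n :
  measurable_fun setT (fun x : 'rV[R]_n => (- x)%R).
Proof.
apply: measurable_fun_rV => j; under eq_fun do rewrite mxE.
by apply: measurable_funN => //; exact: measurable_coord.
Qed.

Lemma rV_consD n s t (x y : 'rV[R]_n) :
  (rV_cons (s, x) + rV_cons (t, y) = rV_cons ((s + t)%R, x + y) :> 'rV_n.+1)%R.
Proof.
apply/rowP => j; rewrite mxE; have [j' ->|->] := unliftP ord0 j.
  by rewrite !rV_consS mxE.
by rewrite !rV_cons0.
Qed.

Lemma rV_consZ n a s (x : 'rV[R]_n) :
  (a *: rV_cons (s, x) = rV_cons ((a * s)%R, a *: x) :> 'rV_n.+1)%R.
Proof.
apply/rowP => j; rewrite mxE; have [j' ->|->] := unliftP ord0 j.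
  by rewrite !rV_consS mxE.
by rewrite !rV_cons0.
Qed.

Lemma measurable_fun_consr n s (f : 'rV[R]_n.+1 -> \bar R) :
  measurable_fun setT f ->
  measurable_fun [set: 'rV[R]_n] (fun x => f (rV_cons (s, x))).
Proof.
move=> mf; apply: (measurableT_comp (measurable_fun_cons mf)).
by apply: measurable_fun_pair.
Qed.

Lemma measurable_fun_integral_cons n (f : 'rV[R]_n.+1 -> \bar R) :
  measurable_fun setT f -> (forall x, 0 <= f x) ->
  measurable_fun [set: measurableTypeR R]
    (fun s => \int[lebesgue_rV n]_x f (rV_cons (s, x))).
Proof.
move=> mf f0; apply: (measurable_fun_fubini_tonelli_F (m2 := lebesgue_rV n)
  (fun p => f (rV_cons p))) => //.
exact: measurable_fun_cons.
Qed.

Lemma ge0_integral_rV_shift n (v : 'rV[R]_n) (f : 'rV[R]_n -> \bar R) :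
  measurable_fun setT f -> (forall x, 0 <= f x) ->
  \int[lebesgue_rV n]_x f (x + v)%R = \int[lebesgue_rV n]_x f x.
Proof.
elim: n v f => [|n IH] v f mf f0.
  by congr integral; apply/funext => x; congr f; apply/rowP => -[].
have mfv : measurable_fun setT (fun x : 'rV[R]_n.+1 => f (x + v)%R).
  exact: (measurableT_comp mf (measurable_fun_addrV v)).
rewrite (ge0_integral_rVS mfv (fun x => f0 _)) (ge0_integral_rVS mf f0).
rewrite -(rV_cons_surj v); set s0 := v ord0 ord0; set v' := (\row_j _)%R.
under eq_integral => s _.
  under eq_integral do rewrite rV_consD.
  rewrite (IH v' (fun x => f (rV_cons ((s + s0)%R, x))))//; last first.
    exact: measurable_fun_consr.
  over.
rewrite (ge0_integral_lebesgue_shift s0 (measurable_fun_integral_cons mf f0))//.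
by move=> s; exact: integral_ge0.
Qed.

Lemma ge0_integral_rV_scale n (a : R) (f : 'rV[R]_n -> \bar R) : (0 < a)%R ->
  measurable_fun setT f -> (forall x, 0 <= f x) ->
  (a ^+ n)%:E * \int[lebesgue_rV n]_x f (a *: x)%R = \int[lebesgue_rV n]_x f x.
Proof.
move=> a0; elim: n f => [|n IH] f mf f0.
  rewrite expr0 mul1e.
  by congr integral; apply/funext => x; congr f; apply/rowP => -[].
have mfv : measurable_fun setT (fun x : 'rV[R]_n.+1 => f (a *: x)%R).
  exact: (measurableT_comp mf (@measurable_fun_scalerV _ a)).
rewrite (ge0_integral_rVS mfv (fun x => f0 _)) (ge0_integral_rVS mf f0).
rewrite -(ge0_integral_lebesgue_scale a0 (measurable_fun_integral_cons mf f0));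
  last by move=> s; exact: integral_ge0.
rewrite exprS EFinM -muleA; congr (_ * _).
rewrite -ge0_integralZl_EFin ?exprn_ge0 ?ltW//; last 2 first.
- by move=> s _; exact: integral_ge0.
- exact: (measurable_fun_integral_cons mfv (fun x => f0 _)).
apply: eq_integral => s _.
under [in LHS]eq_integral do rewrite rV_consZ.
by rewrite (IH (fun x => f (rV_cons ((a * s)%R, x))))//; exact: measurable_fun_consr.
Qed.

End lebesgue_rV_integral.

(** * Topology, Borel sets and finite volumes in R^n *)

Section rV_topology.
Context {R : realType} {n : nat}.
Implicit Types (x y : 'rV[R]_n) (A U : set 'rV[R]_n).

(** Row vectors carry the sup norm, so balls are boxes; this ties the topology to the coordinate
    sigma-algebra and to the product measure. *)
Lemma rV_norm_ltP x (e : R) : 0 < e ->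
  `|x| < e <-> forall j, `|x 0 j| < e.
Proof.
move=> e0.
have -> : (`|x| < e) = (`|0 - x| < e) :> bool by rewrite sub0r normrN.
have -> : (`|0 - x| < e) <-> ball (0 : 'rV[R]_n) e x by rewrite mx_norm_ball.
split=> [[_ H] j|H].
  by have := H 0 j; rewrite mxE /ball/= sub0r normrN.
split=> // i j; rewrite ord1 mxE /ball/= sub0r normrN; exact: H.
Qed.

Lemma rV_coord_le x j : `|x 0 j| <= `|x|.
Proof.
rewrite leNgt; apply/negP => H.
have e0 : 0 < `|x 0 j| by apply: le_lt_trans H.
by have /(rV_norm_ltP x e0)/(_ j) := H; rewrite ltxx.
Qed.

Lemma rV_norm_leP x (e : R) : 0 <= e ->
  `|x| <= e <-> forall j, `|x 0 j| <= e.
Proof.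
move=> e0; split=> [xe j|H]; first exact: le_trans (rV_coord_le x j) xe.
apply/ler_addgt0Pr => d d0; apply/ltW/rV_norm_ltP; first by rewrite ltr_wpDl.
by move=> j; rewrite (le_lt_trans (H j))// ltrDl.
Qed.

Lemma measurable_norm_ball x (e : R) : measurable [set y : 'rV[R]_n | `|y - x| < e].
Proof.
have [e0|e0] := leP e 0.
  rewrite (_ : [set _ | _] = set0)//; apply/seteqP; split=> // y /=.
  by move=> /lt_le_trans/(_ e0); rewrite normr_lt0.
rewrite (_ : [set _ | _] = \bigcap_(j in [set: 'I_n])
    ((fun y : 'rV[R]_n => y 0 j) @^-1` ball (x 0 j) e)); last first.
  apply/seteqP; split=> y /=.
    move=> /(rV_norm_ltP _ e0) H j _; rewrite /ball/= distrC.
    by have := H j; rewrite !mxE.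
  move=> H; apply/(rV_norm_ltP _ e0) => j.
  by have := H j I; rewrite /ball/= distrC !mxE.
apply: fin_bigcap_measurable => // j _.
rewrite -[X in measurable X]setTI; apply: measurable_coord => //.
exact: measurable_ball.
Qed.

(** The sigma-algebra is generated by the coordinates, so an open set has to be cut into countably
    many boxes: those with a rational centre and radius [1/(k+1)] that fit inside [U]. *)
Lemma open_rV_measurable U : open U -> measurable U.
Proof.
move=> oU.
pose q2x (q : 'rV[rat]_n) : 'rV[R]_n := map_mx ratr q.
pose B (p : 'rV[rat]_n * nat) := [set y : 'rV[R]_n | `|y - q2x p.1| < p.2.+1%:R^-1].
pose F p : set 'rV[R]_n := if `[< B p `<=` U >] then B p else set0.
suff -> : U = \bigcup_p F p.
  apply: countable_bigcupT_measurable => [|p]; first exact: countableP.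
  rewrite /F.
  by case: ifP => // _; exact: measurable_norm_ball.
apply/seteqP; split=> [x Ux|x [p _]]; last first.
  by rewrite /F; case: asboolP => // pU; exact: pU.
have /nbhs_ballP[e /= e0 exU] : nbhs x U by exact: open_nbhs_nbhs.
(* Two radii must fit in [e]: one from [x] to the rational centre, one from there to any point of
   the small ball. *)
have [k ke] : exists k : nat, 2 * k.+1%:R^-1 < e.
  have e20 : 0 < e / 2 by rewrite divr_gt0.
  have [k] := ltr_add_invr e20.
  by exists k; rewrite mulrC -ltr_pdivlMr// -[X in X < _]add0r.
have kk : 0 < k.+1%:R^-1 :> R by rewrite invr_gt0.
have Hq j : exists q : rat, `|x 0 j - ratr q| < k.+1%:R^-1.
  have xk : x 0 j - k.+1%:R^-1 < x 0 j + k.+1%:R^-1.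
    by rewrite ltrD2l (lt_trans _ kk)// oppr_lt0.
  have [q] := rat_in_itvoo xk.
  rewrite in_itv/= => /andP[q1 q2]; exists q; rewrite ltr_distl.
  by rewrite ltrBlDr q2 -ltrBlDr q1.
pose q : 'rV[rat]_n := \row_j xchoose (Hq j).
have xq : `|x - q2x q| < k.+1%:R^-1.
  apply/rV_norm_ltP => // j; rewrite !mxE.
  exact: (xchooseP (Hq j)).
suff BU : B (q, k) `<=` U by exists (q, k) => //; rewrite /F asboolT.
move=> y By.
apply: exU; rewrite mx_norm_ball /ball_/=.
rewrite (_ : x - y = x - q2x q - (y - q2x q)); last by rewrite opprB addrA subrK.
rewrite (le_lt_trans (ler_normB _ _))// (lt_trans _ ke)// mulr2n mulrDl mul1r.
exact: ltrD.
Qed.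

Lemma closed_rV_measurable A : closed A -> measurable A.
Proof.
move=> cA; rewrite -[A]setCK; apply: measurableC.
by apply: open_rV_measurable; exact: closed_openC.
Qed.

Lemma compact_rV_measurable A : compact A -> measurable A.
Proof.
move=> cA; apply: closed_rV_measurable.
apply: (compact_closed _ cA); exact: (@norm_hausdorff R 'rV[R]_n).
Qed.

Local Open Scope ereal_scope.

Lemma lebesgue_rV_norm_le (e : R) : (0 <= e)%R ->
  lebesgue_rV n [set x : 'rV[R]_n | `|x| <= e]%R = ((2 * e) ^+ n)%:E.
Proof.
move=> e0.
rewrite (_ : [set _ | _] = [set x : 'rV[R]_n | forall j, `[(- e)%R, e]%classic (x 0%R j)]).
  rewrite [LHS](@lebesgue_rV_box R n (fun=> `[(- e)%R, e]%classic))//.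
  rewrite (eq_bigr (fun => (2 * e)%:E)); last first.
    move=> j _; rewrite lebesgue_measure_itv/= lte_fin.
    case: ifPn => [_|]; first by rewrite -EFinD opprK; congr (_%:E); ring.
    rewrite -leNgt => ee; have -> : e = 0%R by lra.
    by rewrite mulr0.
  by rewrite prodEFin big_const_ord iter_mulr mulr1.
by apply/seteqP; split=> x /= => [/(rV_norm_leP _ e0) H j|H];
  [|apply/(rV_norm_leP _ e0) => j]; have := H j; rewrite /= in_itv/= ler_norml.
Qed.

Lemma lebesgue_rV_bounded_lty A (e : R) : measurable A ->
  (forall x, A x -> `|x| <= e)%R -> lebesgue_rV n A < +oo.
Proof.
move=> mA Ae; apply: (@le_lt_trans _ _ (lebesgue_rV n [set x : 'rV[R]_n | `|x| <= Num.max 0 e]%R)).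
  apply: le_measure; rewrite ?inE//.
    apply: closed_rV_measurable.
    have /preimage_closed : {in (~` (@Num.Def.normr _ 'rV[R]_n) @^-1`
        [set r | r <= Num.max 0 e]%R)%classic, continuous (@Num.Def.normr _ 'rV[R]_n)}.
      by move=> x _; exact: norm_continuous.
    by apply; exact: closed_le.
  by move=> x /Ae xe /=; rewrite le_max xe orbT.
by rewrite lebesgue_rV_norm_le ?ltry// le_max lexx.
Qed.

Lemma compact_rV_lty A : compact A -> lebesgue_rV n A < +oo.
Proof.
move=> cA; have [M [_ HM]] := compact_bounded cA.
apply: (@lebesgue_rV_bounded_lty _ (M + 1)); first exact: compact_rV_measurable.
by move=> x Ax; apply: HM => //; rewrite ltrDl.
Qed.

Lemma measurable_rV_set1 (x : 'rV[R]_n) : measurable [set x].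
Proof.
apply: closed_rV_measurable; apply: accessible_closed_set1.
by apply: hausdorff_accessible; exact: (@norm_hausdorff R 'rV[R]_n).
Qed.

(** A closed box of half-side [e / 2] fits in the ball of radius [e] and has volume [e ^+ n]. *)
Lemma nbhs_lebesgue_rV_gt0 A x : measurable A -> nbhs x A -> 0 < lebesgue_rV n A.
Proof.
move=> mA /nbhs_ballP[e /= e0 exA].
have me : measurable [set y : 'rV[R]_n | forall j,
    `[(x 0%R j - e / 2)%R, (x 0%R j + e / 2)%R]%classic (y 0%R j)].
  rewrite (_ : [set _ | _] = \bigcap_(j in [set: 'I_n])
    ((fun y : 'rV[R]_n => y 0%R j) @^-1` `[(x 0%R j - e / 2)%R, (x 0%R j + e / 2)%R]%classic)).
    apply: fin_bigcap_measurable => // j _.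
    by rewrite -[X in measurable X]setTI; apply: measurable_coord.
  by apply/seteqP; split=> y /= => [H j _|H j]; exact: H.
apply: (@lt_le_trans _ _ (lebesgue_rV n [set y : 'rV[R]_n | forall j,
    `[(x 0%R j - e / 2)%R, (x 0%R j + e / 2)%R]%classic (y 0%R j)])).
  rewrite (@lebesgue_rV_box R n
    (fun j => `[(x 0%R j - e / 2)%R, (x 0%R j + e / 2)%R]%classic))//.
  rewrite (eq_bigr (fun => e%:E)); last first.
    move=> j _; rewrite lebesgue_measure_itv/= lte_fin ifT; last by lra.
    by rewrite -EFinD; congr (_%:E); field.
  by rewrite prodEFin big_const_ord iter_mulr mulr1 lte_fin exprn_gt0.
apply: le_measure; rewrite ?inE// => y /= H; apply: exA; split=> // i j.
rewrite ord1 /ball/= distrC.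
have := H j; rewrite /= in_itv/= => /andP[? ?]; rewrite ltr_norml; apply/andP; split; lra.
Qed.

End rV_topology.

(** * Linear changes of variables *)

Section lebesgue_linear.
Context {R : realType}.
Local Open Scope ereal_scope.

Lemma ge0_integral_rVS_swap n (f : 'rV[R]_n.+1 -> \bar R) :
  measurable_fun setT f -> (forall x, 0 <= f x) ->
  \int[lebesgue_rV n.+1]_x f x =
  \int[lebesgue_rV n]_x \int[lebesgue_measure]_s f (rV_cons (s, x)).
Proof.
move=> mf f0; rewrite ge0_integral_rVS//.
apply: (fubini_tonelli (m1 := lebesgue_measure) (m2 := lebesgue_rV n)
  (fun p => f (rV_cons p))) => //.
exact: measurable_fun_cons.
Qed.

Lemma measurable_fun_consl n (x : 'rV[R]_n) (f : 'rV[R]_n.+1 -> \bar R) :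
  measurable_fun setT f ->
  measurable_fun [set: measurableTypeR R] (fun s => f (rV_cons (s, x))).
Proof.
move=> mf; apply: (measurableT_comp (measurable_fun_cons mf)).
by apply: measurable_fun_pair.
Qed.

Lemma rV_cons_mulmx n (s : R) (x : 'rV[R]_n) (a : 'M[R]_1) (b : 'rV[R]_n)
    (c : 'cV[R]_n) (d : 'M[R]_n) :
  ((rV_cons (s, x) *m (block_mx a b c d : 'M[R]_(1 + n))) =
   rV_cons ((s * a 0 0 + (x *m c) 0 0)%R, s *: b + x *m d)%R)%R.
Proof.
rewrite /rV_cons /= (@mul_row_block _ 1 1 n 1 n); congr (row_mx _ _).
  apply/matrixP => i j; rewrite !ord1 !mxE; congr (_ + _)%R.
  by rewrite big_ord_recl big_ord0 addr0 !mxE.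
by rewrite mul_scalar_mx.
Qed.

(** Gaussian elimination, one coordinate at a time. The factor, in fact an inverse determinant in
    absolute value, is left abstract: each use recovers it by testing on a set whose volume and
    preimage are known. *)
Lemma ge0_integral_rV_linear n (M : 'M[R]_n) : M \in unitmx ->
  exists2 c : R, (0 < c)%R & forall f : 'rV[R]_n -> \bar R,
    measurable_fun setT f -> (forall x, 0 <= f x) ->
    \int[lebesgue_rV n]_x f (x *m M)%R = c%:E * \int[lebesgue_rV n]_x f x.
Proof.
have mM k (N : 'M[R]_k) (f : 'rV[R]_k -> \bar R) : measurable_fun setT f ->
    measurable_fun setT (fun x => f (x *m N)%R).
  by move=> mf; exact: (measurableT_comp mf (measurable_mulmxr N)).
elim: n M => [|n IH] M uM.
  exists 1%R => // f mf f0; rewrite mul1e.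
  by congr integral; apply/funext => x; congr f; apply/rowP => -[].
have pivot (a : 'M[R]_1) b c d : a 0%R 0%R != 0%R ->
    (block_mx a b c d : 'M[R]_(1 + n)) \in unitmx ->
    exists2 r : R, (0 < r)%R & forall f : 'rV[R]_n.+1 -> \bar R,
    measurable_fun setT f -> (forall x, 0 <= f x) ->
    \int[lebesgue_rV n.+1]_x f (x *m (block_mx a b c d : 'M[R]_(1 + n)))%R =
    r%:E * \int[lebesgue_rV n.+1]_x f x.
  move=> a0 ub; set al := a 0%R 0%R in a0.
  have aE : a = al%:M by rewrite [LHS]mx11_scalar.
  (* The Schur complement of the pivot [al], invertible because the block matrix is, hence in the
     scope of the induction hypothesis. *)
  pose d' := (d - (al^-1 *: c) *m b)%R.
  have ud' : d' \in unitmx.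
    have E : block_mx a b c d = (block_mx 1%:M 0%R (al^-1 *: c) 1%:M *m
        block_mx a b 0%R d' : 'M[R]_(1 + n))%R.
      rewrite mulmx_block !mul1mx !mul0mx !addr0; congr block_mx.
        by rewrite aE mul_mx_scalar scalerA mulfV// scale1r.
      by rewrite /d' addrC subrK.
    move: ub; rewrite E unitmx_mul => /andP[_].
    by rewrite unitmxE det_ublock unitrM -unitmxE => /andP[].
  have [r r0 Hr] := IH d' ud'.
  exists (`|al|^-1 * r)%R; first by rewrite mulr_gt0// invr_gt0 normr_gt0.
  move=> f mf f0.
  pose N : 'M[R]_n.+1 := (block_mx a b c d : 'M[R]_(1 + n)).
  rewrite -[block_mx a b c d]/N.
  rewrite (ge0_integral_rVS_swap (mM _ N f mf))//.
  (* The substitution sending [s] to [al s + x c] absorbs the first column; the remaining block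
     triangular matrix is a shear followed by [d']. *)
  pose g (y : 'rV[R]_n.+1) := f (y *m (block_mx 1%:M (al^-1 *: b) 0%R d' : 'M[R]_(1 + n)))%R.
  have mg : measurable_fun setT g by exact: mM.
  transitivity (\int[lebesgue_rV n]_x (`|al|^-1%:E *
      \int[lebesgue_measure]_s g (rV_cons (s, x)))).
    apply: eq_integral => x _.
    rewrite -(ge0_integral_lebesgue_affine (a := al) ((x *m c) 0 0)%R a0
      (measurable_fun_consl x mg) (fun s => f0 _)).
    rewrite muleA -EFinM mulVf ?normr_eq0// mul1e.
    apply: eq_integral => s _; rewrite /g; congr f.
    rewrite /N !rV_cons_mulmx mulmx0 !mxE mulr1 addr0 [(s * _)%R]mulrC.
    congr rV_cons; congr pair.
    rewrite scalerDl scalerA mulrAC mulfV// mul1r -addrA; congr (_ + _)%R.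
    rewrite /d' mulmxBr -scalemxAl -scalemxAr mulmxA.
    rewrite [(x *m c)%R]mx11_scalar mul_scalar_mx scalerA mulrC.
    have -> : (\sum_j x 0 j * c j 0 = (x *m c) 0 0)%R by rewrite mxE.
    by rewrite scalerA addrCA subrr addr0.
  rewrite ge0_integralZl//; last 2 first.
  - apply: (measurable_fun_fubini_tonelli_G (m1 := lebesgue_measure)
      (fun p => g (rV_cons p)));
      by [exact: measurable_fun_cons|move=> p; exact: f0].
  - by move=> x _; apply: integral_ge0 => s _; exact: f0.
  rewrite EFinM -muleA; congr (_ * _).
  rewrite -(ge0_integral_rVS_swap mg (fun x => f0 _)).
  rewrite (ge0_integral_rVS mg (fun x => f0 _)) (ge0_integral_rVS mf f0).
  rewrite -ge0_integralZl//; last 3 first.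
  - exact: measurable_fun_integral_cons.
  - by move=> x _; apply: integral_ge0 => s _; exact: f0.
  - by rewrite lee_fin ltW.
  apply: eq_integral => s _.
  have mfs := measurable_fun_consr s mf.
  rewrite -(ge0_integral_rV_shift (s *: (al^-1 *: b))%R mfs (fun x => f0 _)).
  have mfs' : measurable_fun setT (fun y : 'rV[R]_n =>
      f (rV_cons (s, y + s *: (al^-1 *: b))%R)).
    exact: (measurableT_comp mfs (measurable_fun_addrV _)).
  rewrite -(Hr _ mfs' (fun x => f0 _)).
  apply: eq_integral => x _; rewrite /g; congr f.
  by rewrite rV_cons_mulmx mulmx0 !mxE mulr1 addr0 addrC.
have ME : M = block_mx (ulsubmx (M : 'M[R]_(1 + n))) (ursubmx (M : 'M[R]_(1 + n)))
    (dlsubmx (M : 'M[R]_(1 + n))) (drsubmx (M : 'M[R]_(1 + n))).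
  by rewrite submxK.
set a := ulsubmx _ in ME; set b := ursubmx _ in ME.
set c := dlsubmx _ in ME; set d := drsubmx _ in ME.
have [a0|a0] := eqVneq (a 0%R 0%R) 0%R; last by rewrite ME; apply: pivot => //; rewrite -ME.
(* With a zero corner some entry below it is nonzero, otherwise the first column and the determinant
   vanish. The shear [S] adds that row to the first one, creating a pivot while preserving
   integrals. *)
have [j cj] : exists j, c j 0%R != 0%R.
  apply: contrapT => H; have c0 : c = 0%R.
    apply/matrixP => i k; rewrite ord1 [RHS]mxE; apply: contrapT => /eqP ci.
    by apply: H; exists i.
  have a00 : a = 0%R by apply/matrixP => i k; rewrite !ord1 [RHS]mxE.
  have : (\det (block_mx a b c d : 'M[R]_(1 + n)))%R \is a GRing.unit.
    by rewrite -ME -unitmxE.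
  by rewrite c0 a00 det_ublock det0 mul0r unitr0.
pose S : 'M[R]_(1 + n) := block_mx 1%:M (delta_mx 0%R j) 0%R 1%:M.
have uS : S \in unitmx by rewrite unitmxE det_ublock !det1 mulr1 unitr1.
have SM : (S *m (block_mx a b c d : 'M[R]_(1 + n)) = block_mx (a + delta_mx 0%R j *m c) (b + delta_mx 0%R j *m d) c d)%R.
  by rewrite /S mulmx_block !mul1mx !mul0mx !add0r.
have shear (f : 'rV[R]_n.+1 -> \bar R) : measurable_fun setT f ->
    (forall x, 0 <= f x) ->
    \int[lebesgue_rV n.+1]_x f (x *m (S : 'M[R]_n.+1))%R = \int[lebesgue_rV n.+1]_x f x.
  move=> mf f0; rewrite (ge0_integral_rVS (mM _ (S : 'M[R]_n.+1) _ mf) (fun x => f0 _)).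
  rewrite (ge0_integral_rVS mf f0); apply: eq_integral => s _.
  rewrite -[RHS](ge0_integral_rV_shift (s *: delta_mx 0%R j)%R
    (measurable_fun_consr s mf) (fun x => f0 _)).
  apply: eq_integral => x _; congr f; rewrite /S rV_cons_mulmx mulmx0 mulmx1.
  by rewrite !mxE mulr1 addr0 addrC.
have p0 : (a + delta_mx 0%R j *m c)%R 0%R 0%R != 0%R.
  by rewrite mxE a0 add0r -rowE [X in X != _]mxE.
have u1 : (block_mx (a + delta_mx 0%R j *m c) (b + delta_mx 0%R j *m d) c d
    : 'M[R]_(1 + n))%R \in unitmx.
  by rewrite -SM -ME unitmx_mul uS.
have [r r0 Hr] := pivot _ _ _ _ p0 u1.
exists r => // f mf f0.
rewrite -(Hr f mf f0) -SM -ME -[LHS](shear _ (mM _ M f mf) (fun x => f0 _)).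
by apply: eq_integral => x _; rewrite mulmxA.
Qed.

End lebesgue_linear.

(** * The Brunn-Minkowski inequality *)

Lemma indic_congr (T U : Type) (R : realType) (A : set T) (B : set U) x y :
  (A x <-> B y) -> \1_A x = \1_B y :> R.
Proof.
by move=> AB; rewrite !indicE; congr ((nat_of_bool _)%:R); apply/idP/idP;
  rewrite !inE => /AB.
Qed.

Section layer_cake_measurability.
Context d (T : measurableType d) {R : realType}.

Lemma measurable_lteif (b : bool) (g f : T -> R) : measurable_fun setT g ->
  measurable_fun setT f -> measurable [set x | g x < f x ?<= if b].
Proof.
move=> mg mf; rewrite -[X in measurable X]setTI; case: b => /=.
  exact: measurable_fun_ler.
exact: measurable_fun_ltr.
Qed.

End layer_cake_measurability.

Section layer_cake.
Context d (T : measurableType d) {R : realType}.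
Variable mu : {sigma_finite_measure set T -> \bar R}.
Local Open Scope ereal_scope.

(** Tonelli on the region under the graph. The flag pairs the conventions at both ends: [b = true]
    gives the levels [[0, f x[] and [b = false] the levels []0, f x]], of length [f x] in either
    case. *)
Lemma layer_cake (b : bool) (f : T -> R) : measurable_fun setT f ->
  (forall x, 0 <= f x)%R ->
  \int[mu]_x (f x)%:E =
  \int[lebesgue_measure]_(u in [set` Interval (BSide b 0%R) +oo%O])
    mu [set x | (u < f x ?<= if ~~ b)%R].
Proof.
move=> mf f0.
set S := [set p : measurableTypeR R * T |
  (0 < p.1 ?<= if b)%R && (p.1 < f p.2 ?<= if ~~ b)%R].
have mS : measurable S.
  rewrite (_ : S = [set p | (cst 0 p < p.1 ?<= if b)%R] `&`
      [set p | (p.1 < (f \o snd) p ?<= if ~~ b)%R]); last first.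
    by apply/seteqP; split=> p /andP.
  apply: measurableI; apply: measurable_lteif => //.
  by apply: measurableT_comp => //; exact: measurable_snd.
have mI : measurable_fun setT (fun p : measurableTypeR R * T => (\1_S p)%:E : \bar R).
  by apply/measurable_EFinP; exact: measurable_indic.
transitivity (\int[mu]_x \int[lebesgue_measure]_u (\1_S (u, x))%:E).
  apply: eq_integral => x _.
  rewrite (_ : (fun u => _) =
      (fun u => (\1_([set` Interval (BSide b 0%R) (BSide b (f x))]) u)%:E)).
    rewrite integral_indic//= ?setIT.
    rewrite lebesgue_measure_itv/= lte_fin.
    case: ltP => [_|fx]; first by rewrite sube0.
    by congr (_%:E); apply/eqP; rewrite eq_le f0 fx.
  apply/funext => u; congr (_%:E); apply: indic_congr.
rewrite -(fubini_tonelli (m1 := lebesgue_measure) (m2 := mu)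
  (fun p => (\1_S p)%:E))//.
rewrite [RHS]integral_mkcond; apply: eq_integral => u _.
rewrite patchE; have [u0|u0] := boolP (0 < u ?<= if b)%R.
  rewrite mem_set; last by rewrite /= in_itv/= u0.
  rewrite (_ : (fun x => _) = (fun x => (\1_[set x | u < f x ?<= if ~~ b]%R x)%:E)).
    by rewrite integral_indic//= ?setIT//; apply: (@measurable_lteif _ _ R (~~ b) (cst u)).
  by apply/funext => x; congr (_%:E); apply: indic_congr; rewrite /S/= u0.
rewrite memNset; last by rewrite /= in_itv/= andbT; exact/negP.
apply: integral0_eq => x _; rewrite indicE memNset//=.
by rewrite /S/= (negbTE u0).
Qed.

End layer_cake.

(** * The one-dimensional Prekopa-Leindler inequality *)

Section prekopa_leindler_line.
Context {R : realType}.
Local Notation mu := (@lebesgue_measure R).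

(** Young's inequality for the conjugate exponents [1 / (1 - t)] and [1 / t]. *)
Lemma weighted_AMGM (x y t : R) : 0 <= x -> 0 <= y -> 0 < t -> t < 1 ->
  x `^ (1 - t) * y `^ t <= (1 - t) * x + t * y.
Proof.
move=> x0 y0 t0 t1; have t1' : 0 < 1 - t by rewrite subr_gt0.
have := @conjugate_powR _ (x `^ (1 - t)) (y `^ t) (1 - t)^-1 t^-1
  (powR_ge0 _ _) (powR_ge0 _ _).
rewrite !invr_gt0 !invrK -!powRrM !mulfV ?gt_eqF// !powRr1// mulrC.
move=> /(_ t1' t0); rewrite subrK => /(_ erefl) h.
by rewrite [(1 - t) * _]mulrC [t * _]mulrC.
Qed.

(** The combination of two intervals fills everything strictly between the combined infima and
    suprema. The end points may be missing from [I] and [J], so they are only approached. *)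
Lemma segment_measure_le (I J S : set R) (t M : R) : 0 < t -> t < 1 ->
  measurable I -> measurable J -> measurable S ->
  I !=set0 -> J !=set0 ->
  (forall x, I x -> `|x| <= M) -> (forall x, J x -> `|x| <= M) ->
  (forall x y c, I x -> I y -> 0 <= c -> c <= 1 -> I ((1 - c) * x + c * y)) ->
  (forall x y c, J x -> J y -> 0 <= c -> c <= 1 -> J ((1 - c) * x + c * y)) ->
  (forall x y, I x -> J y -> S ((1 - t) * x + t * y)) ->
  ((1 - t)%:E * mu I + t%:E * mu J <= mu S)%E.
Proof.
move=> t0 t1 mI mJ mS [i Ii] [j Jj] IM JM cI cJ IJS.
have t1' : 0 < 1 - t by rewrite subr_gt0.
have hI : has_sup I /\ has_inf I.
  split; split; [by exists i|exists M => x /IM|by exists i|exists (- M) => x /IM];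
  by rewrite ler_norml => /andP[].
have hJ : has_sup J /\ has_inf J.
  split; split; [by exists j|exists M => x /JM|by exists j|exists (- M) => x /JM];
  by rewrite ler_norml => /andP[].
have muI : (mu I <= (sup I - inf I)%:E)%E.
  apply: (@le_trans _ _ (mu `[inf I, sup I]%classic)).
    apply: le_measure; rewrite ?inE//.
    move=> x Ix /=; rewrite in_itv/=; apply/andP; split.
      by apply: ge_inf => //; case: hI => _ [].
    by apply: ub_le_sup => //; case: hI => -[].
  rewrite lebesgue_measure_itv/= lte_fin; case: ifPn => // _.
  by rewrite lee_fin subr_ge0 (@le_trans _ _ i)//;
    [apply: ge_inf => //; case: hI => _ []|apply: ub_le_sup => //; case: hI => -[]].
have muJ : (mu J <= (sup J - inf J)%:E)%E.
  apply: (@le_trans _ _ (mu `[inf J, sup J]%classic)).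
    apply: le_measure; rewrite ?inE//.
    move=> x Jx /=; rewrite in_itv/=; apply/andP; split.
      by apply: ge_inf => //; case: hJ => _ [].
    by apply: ub_le_sup => //; case: hJ => -[].
  rewrite lebesgue_measure_itv/= lte_fin; case: ifPn => // _.
  by rewrite lee_fin subr_ge0 (@le_trans _ _ j)//;
    [apply: ge_inf => //; case: hJ => _ []|apply: ub_le_sup => //; case: hJ => -[]].
apply: (@le_trans _ _ (((1 - t) * (sup I - inf I) + t * (sup J - inf J))%:E)).
  rewrite [leRHS]EFinD ![in leRHS]EFinM; apply: leeD; apply: lee_wpmul2l => //;
    by rewrite lee_fin ltW.
set a := (1 - t) * inf I + t * inf J; set b := (1 - t) * sup I + t * sup J.
have -> : (1 - t) * (sup I - inf I) + t * (sup J - inf J) = b - a.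
  by rewrite /a /b; ring.
apply: (@le_trans _ _ (mu `]a, b[%classic)).
  rewrite lebesgue_measure_itv/= lte_fin; case: ifPn => // ab.
  by rewrite lee_fin subr_le0 leNgt.
apply: le_measure; rewrite ?inE//.
move=> z /=; rewrite in_itv/= => /andP[az zb].
(* A slack of [e] at both left ends and of [e'] at both right ends yields pairs whose combinations
   satisfy [p < z < q]; a single parameter [c] then moves both points of the pair at once. *)
pose e := z - a.
have e0 : 0 < e by rewrite subr_gt0.
have [x1 Ix1 x1e] := inf_adherent e0 (proj2 hI).
have [y1 Jy1 y1e] := inf_adherent e0 (proj2 hJ).
pose e' := b - z.
have e'0 : 0 < e' by rewrite subr_gt0.
have [x2 Ix2 x2e] := sup_adherent e'0 (proj1 hI).
have [y2 Jy2 y2e] := sup_adherent e'0 (proj1 hJ).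
set p := (1 - t) * x1 + t * y1; set q := (1 - t) * x2 + t * y2.
have pz : p < z.
  have : p < (1 - t) * (inf I + e) + t * (inf J + e).
    by rewrite ltrD// ltr_pM2l.
  have -> : (1 - t) * (inf I + e) + t * (inf J + e) = a + e by rewrite /a; ring.
  by rewrite /e addrC subrK.
have zq : z < q.
  have : (1 - t) * (sup I - e') + t * (sup J - e') < q.
    by rewrite ltrD// ltr_pM2l.
  have -> : (1 - t) * (sup I - e') + t * (sup J - e') = b - e' by rewrite /b; ring.
  by rewrite /e' opprB addrC subrK.
pose c := (z - p) / (q - p).
have qp : 0 < q - p by rewrite subr_gt0 (lt_trans pz).
have c0 : 0 <= c by rewrite divr_ge0 ?ltW// subr_gt0.
have c1 : c <= 1 by rewrite ler_pdivrMr// mul1r lerD2r ltW.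
have -> : z = (1 - t) * ((1 - c) * x1 + c * x2) + t * ((1 - c) * y1 + c * y2).
  have -> : (1 - t) * ((1 - c) * x1 + c * x2) + t * ((1 - c) * y1 + c * y2) =
    p + c * (q - p) by rewrite /p /q; ring.
  by rewrite /c divfK ?gt_eqF// addrC subrK.
by apply: IJS; [exact: cI|exact: cJ].
Qed.

(** Since both suprema equal 1, the superlevel sets of [F] and [G] are nonempty for exactly the same
    levels [u < 1]; they are intervals by quasi-concavity, and the level set of [H] contains their
    combination. Integrating [segment_measure_le] over the levels concludes. *)
Lemma prekopa_leindler_normalized (F G H : R -> R) (t M : R) : 0 < t -> t < 1 ->
  measurable_fun setT F -> measurable_fun setT G -> measurable_fun setT H ->
  (forall x, 0 <= F x <= 1) -> (forall x, 0 <= G x <= 1) -> (forall x, 0 <= H x) ->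
  (forall u, u < 1 -> exists x, u < F x) -> (forall u, u < 1 -> exists x, u < G x) ->
  (forall x, 0 < F x -> `|x| <= M) -> (forall x, 0 < G x -> `|x| <= M) ->
  (forall x y c, 0 <= c -> c <= 1 ->
    Num.min (F x) (F y) <= F ((1 - c) * x + c * y)) ->
  (forall x y c, 0 <= c -> c <= 1 ->
    Num.min (G x) (G y) <= G ((1 - c) * x + c * y)) ->
  (forall x y, F x `^ (1 - t) * G y `^ t <= H ((1 - t) * x + t * y)) ->
  ((1 - t)%:E * \int[mu]_x (F x)%:E + t%:E * \int[mu]_x (G x)%:E <=
   \int[mu]_x (H x)%:E)%E.
Proof.
move=> t0 t1 mF mG mH F01 G01 H0 F1 G1 FM GM qF qG FGH.
have t1' : 0 < 1 - t by rewrite subr_gt0.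
have mlev (f : R -> R) u : measurable_fun setT f ->
    measurable ([set x | u < f x] : set (measurableTypeR R)).
  move=> mf; rewrite -[X in measurable X]setTI.
  by apply: (measurable_fun_ltr (f := cst u)).
have mmeas (f : R -> R) : measurable_fun setT f ->
    measurable_fun setT (fun u : R => mu [set x | u < f x] : \bar R).
  move=> mf.
  pose S := [set p : measurableTypeR R * measurableTypeR R | p.1 < f p.2].
  have mS : measurable S.
    rewrite -[X in measurable X]setTI; apply: measurable_fun_ltr => //.
    by apply: measurableT_comp => //; exact: measurable_snd.
  have := measurable_fun_xsection mu mS.
  apply: eq_measurable_fun => u _ /=; congr (mu _).
  by apply/seteqP; split=> x /=; rewrite /xsection/= inE.
have mmeasD (f : R -> R) : measurable_fun setT f ->
    measurable_fun (`[0, +oo[%classic : set R) (fun u : R => mu [set x | u < f x] : \bar R).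
  by move=> mf; apply: measurable_funS (mmeas f mf).
rewrite !(layer_cake _ true)//=; try by move=> x; case/andP: (F01 x).
  2: by move=> x; case/andP: (G01 x).
rewrite -!ge0_integralZl//=; try (by rewrite lee_fin ltW); try exact: mmeasD.
rewrite -ge0_integralD//=; last 4 first.
- by move=> u _; rewrite mule_ge0// lee_fin ltW.
- by apply: measurable_funeM; exact: mmeasD.
- by move=> u _; rewrite mule_ge0// lee_fin ltW.
- by apply: measurable_funeM; exact: mmeasD.
apply: ge0_le_integral => //=.
- by move=> u _; rewrite adde_ge0// mule_ge0// lee_fin ltW.
- by apply: emeasurable_funD; apply: measurable_funeM; exact: mmeasD.
- exact: mmeasD.
move=> u; rewrite in_itv/= andbT => u0.
have [u1|u1] := ltP u 1; last first.
  have e0 (f : R -> R) : (forall x, 0 <= f x <= 1) -> mu [set x | u < f x] = 0%E.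
    move=> f01; rewrite -[RHS](measure0 mu); congr (mu _).
    apply/seteqP; split=> // x /=; rewrite ltNge => /negP; apply.
    by rewrite (le_trans _ u1)//; case/andP: (f01 x).
  by rewrite (e0 _ F01) (e0 _ G01) !mule0 adde0.
apply: (@segment_measure_le _ _ _ t M) => //; try exact: mlev.
- exact: F1.
- exact: G1.
- by move=> x /= ux; apply: FM; exact: le_lt_trans ux.
- by move=> x /= ux; apply: GM; exact: le_lt_trans ux.
- move=> x y c /= ux uy c0 c1; rewrite (lt_le_trans _ (qF x y c c0 c1))//.
  by rewrite lt_min ux.
- move=> x y c /= ux uy c0 c1; rewrite (lt_le_trans _ (qG x y c c0 c1))//.
  by rewrite lt_min ux.
- move=> x y /= ux uy; rewrite (lt_le_trans _ (FGH x y))//.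
  have [->|un0] := eqVneq u 0.
    by rewrite mulr_gt0// powR_gt0//; apply: le_lt_trans u0 _.
  have up : 0 < u by rewrite lt_neqAle eq_sym un0.
  have -> : u = u `^ (1 - t) * u `^ t.
    by rewrite -powRD ?subrK ?powRr1 ?un0 ?implybT.
  have Fx : 0 < F x by apply: lt_trans ux.
  apply: ltr_pM; rewrite ?powR_ge0//;
    by apply: gt0_ltr_powR => //; rewrite nnegrE ltW//; apply: lt_trans uy.
Qed.

End prekopa_leindler_line.

(** Convexity with an explicit real weight, the form in which points are built throughout;
    [convex_set_segment_closed] links it to the notion used for convex bodies. *)
Definition segment_closed (R : realType) (V : lmodType R) (A : set V) :=
  forall x y (c : R), A x -> A y -> 0 <= c -> c <= 1 -> A ((1 - c) *: x + c *: y).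

(** * Brunn-Minkowski by induction on the dimension *)

Section brunn_minkowski.
Context {R : realType}.
Local Notation mu := (@lebesgue_measure R).

(** Dividing [F] and [G] by their suprema and [H] by the matching geometric mean reduces to the
    normalized case; the arithmetic-geometric inequality then returns to the multiplicative form. A
    function with supremum 0 cannot be normalized, but makes the left side 0. *)
Lemma prekopa_leindler_line (F G H : R -> R) (t M K : R) : 0 < t -> t < 1 ->
  measurable_fun setT F -> measurable_fun setT G -> measurable_fun setT H ->
  (forall x, 0 <= F x <= K) -> (forall x, 0 <= G x <= K) -> (forall x, 0 <= H x) ->
  (forall x, 0 < F x -> `|x| <= M) -> (forall x, 0 < G x -> `|x| <= M) ->
  (forall x y c, 0 <= c -> c <= 1 ->
    Num.min (F x) (F y) <= F ((1 - c) * x + c * y)) ->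
  (forall x y c, 0 <= c -> c <= 1 ->
    Num.min (G x) (G y) <= G ((1 - c) * x + c * y)) ->
  (forall x y, F x `^ (1 - t) * G y `^ t <= H ((1 - t) * x + t * y)) ->
  (\int[mu]_x (F x)%:E < +oo)%E -> (\int[mu]_x (G x)%:E < +oo)%E ->
  ((fine (\int[mu]_x (F x)%:E) `^ (1 - t) * fine (\int[mu]_x (G x)%:E) `^ t)%:E <=
   \int[mu]_x (H x)%:E)%E.
Proof.
move=> t0 t1 mF mG mH FK GK H0 FM GM qF qG FGH iF iG.
have t1' : 0 < 1 - t by rewrite subr_gt0.
have sup_props (f : R -> R) : (forall x, 0 <= f x <= K) ->
    (forall x, f x = 0) \/ (0 < sup (range f) /\ (forall x, f x <= sup (range f)) /\
    forall u, u < 1 -> exists x, u < f x / sup (range f)).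
  move=> fK; have hs : has_sup (range f).
    by split; [exists (f 0), 0|exists K => _ [x _ <-]; case/andP: (fK x)].
  have fs x : f x <= sup (range f) by apply: ub_le_sup; [case: hs|exists x].
  have [s0|s0] := ltP 0 (sup (range f)); [right|left].
    split=> //; split=> // u u1.
    have : 0 < (1 - u) * sup (range f) by rewrite mulr_gt0// subr_gt0.
    move=> /sup_adherent/(_ hs)[_ [x _ <-]]; rewrite mulrBl mul1r subKr => ux.
    by exists x; rewrite ltr_pdivlMr.
  by move=> x; apply/eqP; rewrite eq_le (le_trans (fs x) s0); case/andP: (fK x).
have [F0|[a0 [Fa Fs]]] := sup_props F FK.
  under [in leLHS]eq_integral do rewrite F0.
  rewrite integral0 /= powR0 ?gt_eqF// mul0r.
  by apply: integral_ge0 => x _; rewrite lee_fin.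
have [G0|[b0 [Gb Gs]]] := sup_props G GK.
  under [X in (_ * fine X `^ _)%:E]eq_integral do rewrite G0.
  rewrite integral0 /= powR0 ?gt_eqF// mulr0.
  by apply: integral_ge0 => x _; rewrite lee_fin.
set a := sup _ in a0 Fa Fs; set b := sup _ in b0 Gb Gs.
set c := a `^ (1 - t) * b `^ t.
have c0 : 0 < c by rewrite mulr_gt0// powR_gt0.
have F0 x : 0 <= F x by case/andP: (FK x).
have G0 x : 0 <= G x by case/andP: (GK x).
have scale (f : R -> R) (r : R) : 0 < r -> measurable_fun setT f ->
    (forall x, 0 <= f x) ->
    (\int[mu]_x (f x / r)%:E = (r^-1)%:E * \int[mu]_x (f x)%:E)%E.
  move=> r0 mf f0; rewrite -ge0_integralZl//.
  - by apply: eq_integral => x _; rewrite -EFinM mulrC.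
  - exact/measurable_EFinP.
  - by move=> x _; rewrite lee_fin.
  - by rewrite lee_fin invr_ge0 ltW.
have mdiv (f : R -> R) (r : R) : measurable_fun setT f ->
    measurable_fun setT (fun x => f x / r).
  by move=> mf; apply: measurable_funM.
have div01 (f : R -> R) (r : R) : 0 < r -> (forall x, 0 <= f x) ->
    (forall x, f x <= r) -> forall x, 0 <= f x / r <= 1.
  move=> r0 f0 fr x; rewrite ler_pdivrMr// mul1r fr andbT.
  by apply: divr_ge0 => //; exact: ltW.
have mindiv (x y z r : R) : 0 < r -> Num.min x y <= z ->
    Num.min (x / r) (y / r) <= z / r.
  by move=> r0; rewrite !ge_min !ler_pM2r// ?invr_gt0.
have key := @prekopa_leindler_normalized R (fun x => F x / a) (fun x => G x / b)
  (fun x => H x / c) t M t0 t1 (mdiv F a mF) (mdiv G b mG) (mdiv H c mH)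
  (div01 F a a0 F0 Fa) (div01 G b b0 G0 Gb).
have fX : (\int[mu]_x (F x)%:E)%E \is a fin_num.
  by rewrite ge0_fin_numE//; apply: integral_ge0 => x _; rewrite lee_fin.
have fY : (\int[mu]_x (G x)%:E)%E \is a fin_num.
  by rewrite ge0_fin_numE//; apply: integral_ge0 => x _; rewrite lee_fin.
set X := fine (\int[mu]_x (F x)%:E)%E; set Y := fine (\int[mu]_x (G x)%:E)%E.
have EX : (\int[mu]_x (F x)%:E = X%:E)%E by rewrite /X fineK.
have EY : (\int[mu]_x (G x)%:E = Y%:E)%E by rewrite /Y fineK.
have X0 : 0 <= X by apply/fine_ge0/integral_ge0 => x _; rewrite lee_fin.
have Y0 : 0 <= Y by apply/fine_ge0/integral_ge0 => x _; rewrite lee_fin.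
have {}key : (((1 - t) * (a^-1 * X) + t * (b^-1 * Y))%:E <=
    c^-1%:E * \int[mu]_x (H x)%:E)%E.
  rewrite -scale// EFinD !EFinM -EX -EY -!scale//; apply: key => //.
  - by move=> x; rewrite divr_ge0// ltW.
  - by move=> x xF; apply: FM; move: xF; rewrite pmulr_lgt0// invr_gt0.
  - by move=> x xG; apply: GM; move: xG; rewrite pmulr_lgt0// invr_gt0.
  - by move=> x y r r0 r1; apply: mindiv => //; exact: qF.
  - by move=> x y r r0 r1; apply: mindiv => //; exact: qG.
  - move=> x y; rewrite ler_pdivlMr// mulrC /c mulrACA.
    rewrite -!powRM ?(ltW a0) ?(ltW b0) ?divr_ge0 ?(ltW a0) ?(ltW b0)//.
    by rewrite mulrC [a * _]mulrC [b * _]mulrC !divfK ?gt_eqF// mulrC.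
have -> : X `^ (1 - t) * Y `^ t = c * ((a^-1 * X) `^ (1 - t) * (b^-1 * Y) `^ t).
  rewrite /c mulrACA -!powRM ?mulr_ge0 ?invr_ge0 ?(ltW a0) ?(ltW b0)//.
  by rewrite !mulVKf ?gt_eqF.
apply: (@le_trans _ _ (c * ((1 - t) * (a^-1 * X) + t * (b^-1 * Y)))%:E).
  rewrite lee_fin ler_pM2l// weighted_AMGM// mulr_ge0// invr_ge0 ltW//.
have := @lee_wpmul2l _ c%:E _ _ _ key; rewrite lee_fin (ltW c0) => /(_ erefl).
by rewrite muleA -!EFinM mulfV ?gt_eqF// mul1e.
Qed.

Lemma measurable_cons_section n (A : set 'rV[R]_n.+1) s : measurable A ->
  measurable [set x : 'rV[R]_n | A (rV_cons (s, x))].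
Proof.
move=> mA; have m : measurable_fun setT (fun x : 'rV[R]_n => rV_cons (s, x)).
  apply: (measurableT_comp (@measurable_rV_cons R n)).
  exact: measurable_fun_pair.
by rewrite -[X in measurable X]setTI; exact: m.
Qed.

Lemma integral_indic_cons n (A : set 'rV[R]_n.+1) s : measurable A ->
  (\int[lebesgue_rV n]_x (\1_A (rV_cons (s, x)))%:E =
   lebesgue_rV n [set x | A (rV_cons (s, x))])%E.
Proof.
move=> mA.
under eq_integral => x _ do rewrite (@indic_congr _ _ R A
  [set x : 'rV[R]_n | A (rV_cons (s, x))] (rV_cons (s, x)) x)//.
by rewrite integral_indic ?setIT//; exact: measurable_cons_section.
Qed.

Lemma measurable_lebesgue_section n (A : set 'rV[R]_n.+1) : measurable A ->
  measurable_fun [set: R] (fun s : R => lebesgue_rV n [set x | A (rV_cons (s, x))]).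
Proof.
move=> mA; have mI : measurable_fun setT (fun x : 'rV[R]_n.+1 => (\1_A x)%:E : \bar R).
  by apply/measurable_EFinP; exact: measurable_indic.
have := measurable_fun_integral_cons mI (fun x => ltac:(by rewrite lee_fin)).
by apply: eq_measurable_fun => s _; rewrite integral_indic_cons.
Qed.

Lemma lebesgue_rVS n (A : set 'rV[R]_n.+1) : measurable A ->
  (lebesgue_rV n.+1 A =
   \int[mu]_s lebesgue_rV n [set x | A (rV_cons (s, x))])%E.
Proof.
move=> mA; have mI : measurable_fun setT (fun x : 'rV[R]_n.+1 => (\1_A x)%:E : \bar R).
  by apply/measurable_EFinP; exact: measurable_indic.
transitivity (\int[lebesgue_rV n.+1]_x (\1_A x)%:E)%E.
  by rewrite integral_indic// setIT.
rewrite (ge0_integral_rVS mI); last by move=> x; rewrite lee_fin.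
by apply: eq_integral => s _; rewrite integral_indic_cons.
Qed.

Lemma rV_cons_norm_le n s (x : 'rV[R]_n) (M : R) :
  `|rV_cons (s, x)| <= M -> `|s| <= M /\ `|x| <= M.
Proof.
move=> sM; have M0 : 0 <= M by apply: le_trans sM.
have /(rV_norm_leP _ M0) H := sM; split.
  by have := H ord0; rewrite rV_cons0.
by apply/(rV_norm_leP _ M0) => j; have := H (lift ord0 j); rewrite rV_consS.
Qed.

Lemma closed_norm_le n (e : R) : closed [set x : 'rV[R]_n | `|x| <= e].
Proof.
have /preimage_closed : {in (~` (@Num.Def.normr _ 'rV[R]_n) @^-1`
    [set r | r <= e])%classic, continuous (@Num.Def.normr _ 'rV[R]_n)}.
  by move=> x _; exact: norm_continuous.
by apply; exact: closed_le.
Qed.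

(** Slicing by the first coordinate: the induction hypothesis for the slices is precisely the
    hypothesis of the one-dimensional inequality for the functions [v A], [v B], [v C] giving the
    volumes of the slices. *)
Lemma brunn_minkowski_mul n (A B C : set 'rV[R]_n) (t M : R) : 0 < t -> t < 1 ->
  measurable A -> measurable B -> measurable C ->
  segment_closed A -> segment_closed B ->
  (forall x, A x -> `|x| <= M) -> (forall x, B x -> `|x| <= M) ->
  (forall x, C x -> `|x| <= M) ->
  (forall x y, A x -> B y -> C ((1 - t) *: x + t *: y)) ->
  fine (lebesgue_rV n A) `^ (1 - t) * fine (lebesgue_rV n B) `^ t <=
  fine (lebesgue_rV n C).
Proof.
elim: n t A B C => [|n IH] t A B C t0 t1 mA mB mC cA cB AM BM CM ABC;
  have t1' : 0 < 1 - t by rewrite subr_gt0.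
  have dE (S : set 'rV[R]_0) : lebesgue_rV 0 S = (0 \in S)%:R%:E.
    by rewrite /= diracE.
  rewrite !dE/=.
  have [A0|] := boolP (0 \in A); last by rewrite powR0 ?mul0r// gt_eqF.
  have [B0|] := boolP (0 \in B); last by rewrite powR0 ?mulr0// gt_eqF.
  rewrite !powR1 mulr1 mem_set//.
  by have := ABC 0 0; rewrite !scaler0 addr0 !inE in A0 B0 *; exact.
pose sec (S : set 'rV[R]_n.+1) (s : R) := [set x : 'rV[R]_n | S (rV_cons (s, x))].
pose v (S : set 'rV[R]_n.+1) (s : R) := fine (lebesgue_rV n (sec S s)).
have msec (S : set 'rV[R]_n.+1) s : measurable S -> measurable (sec S s) by exact: measurable_cons_section.
have secM (S : set 'rV[R]_n.+1) s : (forall x, S x -> `|x| <= M) -> forall x, sec S s x -> `|x| <= M.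
  by move=> SM x /SM/rV_cons_norm_le[].
have secfin (S : set 'rV[R]_n.+1) s : measurable S -> (forall x, S x -> `|x| <= M) ->
    lebesgue_rV n (sec S s) \is a fin_num.
  move=> mS SM; rewrite ge0_fin_numE//.
  by apply: (lebesgue_rV_bounded_lty (msec S s mS)) (secM S s SM).
have mv (S : set 'rV[R]_n.+1) : measurable S -> measurable_fun setT (v S).
  move=> mS; apply: measurableT_comp; first exact: fine_measurable.
  exact: measurable_lebesgue_section.
have volE (S : set 'rV[R]_n.+1) : measurable S -> (forall x, S x -> `|x| <= M) ->
    lebesgue_rV n.+1 S = (\int[mu]_s (v S s)%:E)%E.
  move=> mS SM; rewrite lebesgue_rVS//; apply: eq_integral => s _.
  by rewrite /v fineK//; exact: secfin.
have volfin (S : set 'rV[R]_n.+1) : measurable S -> (forall x, S x -> `|x| <= M) ->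
    (lebesgue_rV n.+1 S < +oo)%E.
  by move=> mS SM; exact: lebesgue_rV_bounded_lty SM.
have v0 (S : set 'rV[R]_n.+1) s : 0 <= v S s by exact: fine_ge0.
have csec (S : set 'rV[R]_n.+1) s : segment_closed S -> segment_closed (sec S s).
  move=> cS x y c Sx Sy c0 c1; rewrite /sec/=.
  have := cS _ _ c Sx Sy c0 c1; rewrite !rV_consZ rV_consD.
  by rewrite -mulrDl subrK mul1r.
(* Quasi-concavity of the slice volumes is again the induction hypothesis, now with weight [c] and
   both sets cut from [S]: a geometric mean is at least the minimum. *)
have vmin (S : set 'rV[R]_n.+1) : measurable S -> segment_closed S -> (forall x, S x -> `|x| <= M) ->
    forall x y c, 0 <= c -> c <= 1 ->
    Num.min (v S x) (v S y) <= v S ((1 - c) * x + c * y).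
  move=> mS cS SM x y c; rewrite le_eqVlt => /predU1P[<- _|c0].
    by rewrite subr0 mul1r mul0r addr0 ge_min lexx.
  rewrite le_eqVlt => /predU1P[->|c1].
    by rewrite subrr mul0r mul1r add0r ge_min lexx orbT.
  have c1' : 0 < 1 - c by rewrite subr_gt0.
  have [m0|m0] := leP (Num.min (v S x) (v S y)) 0; first exact: le_trans m0 (v0 _ _).
  set m := Num.min _ _ in m0 *.
  apply: (@le_trans _ _ (v S x `^ (1 - c) * v S y `^ c)).
    rewrite -[leLHS]powRr1 ?(ltW m0)// -[X in _ `^ X](subrK c) powRD; last first.
      by rewrite (gt_eqF m0) implybT.
    apply: ler_pM; rewrite ?powR_ge0//; apply: ge0_ler_powR => //;
      rewrite ?nnegrE ?(ltW m0) ?(ltW c0) ?(ltW c1')// /m ge_min lexx ?orbT//.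
  apply: IH => //; try exact: msec; try exact: csec; try exact: secM.
  move=> x' y' Sx Sy; rewrite /sec/=.
  by have := cS _ _ c Sx Sy (ltW c0) (ltW c1); rewrite !rV_consZ rV_consD.
pose K := `|(2 * Num.max 0 M) ^+ n|.
have vK (S : set 'rV[R]_n.+1) : measurable S -> (forall x, S x -> `|x| <= M) -> forall s, 0 <= v S s <= K.
  move=> mS SM s; rewrite v0/=.
  have h : (lebesgue_rV n (sec S s) <= K%:E)%E.
    rewrite /K ger0_norm ?exprn_ge0 ?mulr_ge0 ?le_max ?lexx//.
    rewrite -lebesgue_rV_norm_le ?le_max ?lexx//; apply: le_measure; rewrite ?inE.
    - exact: msec.
    - by apply: closed_rV_measurable; exact: closed_norm_le.
    - by move=> x /(secM _ _ SM) xM /=; rewrite le_max xM orbT.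
  by rewrite -lee_fin /v fineK//; exact: secfin.
have vM (S : set 'rV[R]_n.+1) : (forall x, S x -> `|x| <= M) -> forall s, 0 < v S s -> `|s| <= M.
  move=> SM s vs; have [[x Sx]|S0] := pselect (sec S s !=set0).
    by have [] := rV_cons_norm_le (SM _ Sx).
  have S0' : sec S s = set0 by apply/seteqP; split=> // x Sx; apply: S0; exists x.
  by move: vs; rewrite /v S0' measure0 ltxx.
rewrite !volE//.
have := @prekopa_leindler_line (v A) (v B) (v C) t M K t0 t1 (mv A mA) (mv B mB)
  (mv C mC) (vK A mA AM) (vK B mB BM) (v0 C) (vM A AM) (vM B BM)
  (vmin A mA cA AM) (vmin B mB cB BM) _ _ _.
rewrite -!volE//.
have fC : lebesgue_rV n.+1 C \is a fin_num.
  by rewrite ge0_fin_numE//; exact: volfin.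
rewrite -(fineK fC) lee_fin; apply; try exact: volfin.
move=> r s; apply: IH => //; try exact: msec; try exact: csec; try exact: secM.
move=> x y Ax By; rewrite /sec/=.
by have := ABC _ _ Ax By; rewrite !rV_consZ rV_consD.
Qed.

End brunn_minkowski.

Section brunn_minkowski_root.
Context {R : realType}.

Lemma measurable_preimage_affine m n (K : set 'rV[R]_n) (v : 'rV[R]_n)
    (B : 'M[R]_(m, n)) : measurable K ->
  measurable [set e : 'rV[R]_m | K (v + e *m B)].
Proof.
move=> mK; have mf : measurable_fun setT (fun e : 'rV[R]_m => v + e *m B).
  under eq_fun do rewrite addrC.
  exact: (measurableT_comp (measurable_fun_addrV v) (measurable_mulmxr B)).
by rewrite -[X in measurable X]setTI; exact: mf.
Qed.

Lemma measurable_preimage_scale n (a : R) (A : set 'rV[R]_n) : measurable A ->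
  measurable [set x : 'rV[R]_n | A (a *: x)].
Proof.
by move=> mA; rewrite -[X in measurable X]setTI; exact: measurable_fun_scalerV.
Qed.

Lemma measurable_preimage_shift n (v : 'rV[R]_n) (A : set 'rV[R]_n) : measurable A ->
  measurable [set x : 'rV[R]_n | A (x + v)].
Proof.
by move=> mA; rewrite -[X in measurable X]setTI; exact: measurable_fun_addrV.
Qed.

Lemma measurable_EFin_indic d (T : measurableType d) (A : set T) : measurable A ->
  measurable_fun setT (fun x : T => (\1_A x : R)%:E).
Proof. by move=> mA; apply/measurable_EFinP; exact: measurable_indic. Qed.

Lemma integral_indic_comp d (T : measurableType d) (U : Type)
    (mu : {measure set T -> \bar R}) (A : set U) (f : T -> U) :
  measurable [set x | A (f x)] ->
  (\int[mu]_x (\1_A (f x))%:E = mu [set x | A (f x)])%E.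
Proof.
move=> mA; under eq_integral => x _ do
  rewrite (@indic_congr _ _ R A [set x | A (f x)] (f x) x)//.
by rewrite integral_indic ?setIT.
Qed.

Lemma lebesgue_rV_scale n (a : R) (A : set 'rV[R]_n) : 0 < a -> measurable A ->
  ((a ^+ n)%:E * lebesgue_rV n [set x | A (a *: x)] = lebesgue_rV n A)%E.
Proof.
move=> a0 mA.
have := ge0_integral_rV_scale a0 (measurable_EFin_indic mA) (fun x => ltac:(by rewrite lee_fin)).
rewrite [X in _ = X]integral_indic// setIT => <-; congr (_ * _)%E.
by rewrite integral_indic_comp//; exact: measurable_preimage_scale.
Qed.

Lemma lebesgue_rV_shift n (v : 'rV[R]_n) (A : set 'rV[R]_n) : measurable A ->
  (lebesgue_rV n [set x | A (x + v)%R] = lebesgue_rV n A)%E.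
Proof.
move=> mA.
have := ge0_integral_rV_shift v (measurable_EFin_indic mA) (fun x => ltac:(by rewrite lee_fin)).
rewrite [X in _ = X]integral_indic// setIT => <-.
by rewrite integral_indic_comp//; exact: measurable_preimage_shift.
Qed.

Lemma powR_invnK n (a : R) : (0 < n)%N -> 0 <= a -> (a `^ n%:R^-1) ^+ n = a.
Proof.
move=> n0 a0; rewrite -powR_mulrn ?powR_ge0// -powRrM mulVf ?pnatr_eq0 -?lt0n//.
by rewrite powRr1.
Qed.

Lemma le_powR_invn n (a b : R) : (0 < n)%N -> 0 <= a -> a ^+ n <= b -> a <= b `^ n%:R^-1.
Proof.
move=> n0 a0 ab; have b0 : 0 <= b by apply: le_trans ab; exact: exprn_ge0.
by rewrite -(@ler_pXn2r _ n)// ?nnegrE ?powR_ge0// powR_invnK.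
Qed.

(** The additive form follows from the multiplicative one by rescaling [A] and [B] to volume 1,
    which turns the left side of the latter into 1. *)
Lemma brunn_minkowski n (A B C : set 'rV[R]_n) (t M : R) : (0 < n)%N ->
  0 <= t -> t <= 1 ->
  measurable A -> measurable B -> measurable C ->
  segment_closed A -> segment_closed B -> A !=set0 -> B !=set0 ->
  (forall x, A x -> `|x| <= M) -> (forall x, B x -> `|x| <= M) ->
  (forall x, C x -> `|x| <= M) ->
  (forall x y, A x -> B y -> C ((1 - t) *: x + t *: y)) ->
  (1 - t) * fine (lebesgue_rV n A) `^ n%:R^-1 +
    t * fine (lebesgue_rV n B) `^ n%:R^-1 <=
  fine (lebesgue_rV n C) `^ n%:R^-1.
Proof.
move=> n0; rewrite le_eqVlt => /predU1P[<- _|t0].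
  move=> mA mB mC cA cB [a0 Aa0] [b0 Bb0] AM BM CM ABC.
  rewrite subr0 mul1r mul0r addr0; apply: ge0_ler_powR; rewrite ?nnegrE ?fine_ge0//.
  apply: fine_le; rewrite ?ge0_fin_numE//; try by apply: lebesgue_rV_bounded_lty; eauto.
  apply: le_measure; rewrite ?inE// => x Ax.
  by have := ABC _ _ Ax Bb0; rewrite subr0 scale1r scale0r addr0.
rewrite le_eqVlt => /predU1P[->|t1].
  move=> mA mB mC cA cB [a0 Aa0] [b0 Bb0] AM BM CM ABC.
  rewrite subrr mul1r mul0r add0r; apply: ge0_ler_powR; rewrite ?nnegrE ?fine_ge0//.
  apply: fine_le; rewrite ?ge0_fin_numE//; try by apply: lebesgue_rV_bounded_lty; eauto.
  apply: le_measure; rewrite ?inE// => x Bx.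
  by have := ABC _ _ Aa0 Bx; rewrite subrr scale1r scale0r add0r.
move=> mA mB mC cA cB [a0 Aa0] [b0 Bb0] AM BM CM ABC.
have t1' : 0 < 1 - t by rewrite subr_gt0.
have vfin S : measurable S -> (forall x : 'rV[R]_n, S x -> `|x| <= M) ->
    lebesgue_rV n S \is a fin_num.
  by move=> mS SM; rewrite ge0_fin_numE//; exact: lebesgue_rV_bounded_lty SM.
set u := fine (lebesgue_rV n A); set v := fine (lebesgue_rV n B).
set w := fine (lebesgue_rV n C).
have u0 : 0 <= u by exact: fine_ge0.
have v0 : 0 <= v by exact: fine_ge0.
have w0 : 0 <= w by exact: fine_ge0.
set al := u `^ _; set be := v `^ _.
have al0 : 0 <= al by exact: powR_ge0.
have be0 : 0 <= be by exact: powR_ge0.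
have alE : al ^+ n = u by exact: powR_invnK.
have beE : be ^+ n = v by exact: powR_invnK.
have one_point (S : set 'rV[R]_n) (s : R) (z : 'rV[R]_n) : 0 < s -> measurable S ->
    (forall x, S x -> `|x| <= M) -> (forall x, S x -> C (s *: x + z)) ->
    s ^+ n * fine (lebesgue_rV n S) <= w.
  move=> s0 mS SM SC; rewrite -lee_fin EFinM fineK ?vfin// /w fineK ?vfin//.
  rewrite -(lebesgue_rV_shift z mC).
  rewrite -(lebesgue_rV_scale s0 (measurable_preimage_shift z mC)).
  apply: lee_wpmul2l; first by rewrite lee_fin exprn_ge0// ltW.
  apply: le_measure; rewrite ?inE//.
  exact: (measurable_preimage_scale s (measurable_preimage_shift z mC)).
(* A set of volume 0 cannot be rescaled to volume 1; [C] then contains a translate of the other set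
   scaled by its weight, and this is enough. *)
have [al00|al1] := eqVneq al 0.
  rewrite al00 mulr0 add0r; apply: le_powR_invn => //; first by rewrite mulr_ge0// ltW.
  rewrite exprMn beE; apply: (one_point _ _ ((1 - t) *: a0)) => // x Bx.
  by rewrite addrC; exact: ABC.
have [be00|be1] := eqVneq be 0.
  rewrite be00 mulr0 addr0; apply: le_powR_invn => //; first by rewrite mulr_ge0// ltW.
  by rewrite exprMn alE; apply: (one_point _ _ (t *: b0)) => // x Bx; exact: ABC.
have {}al1 : 0 < al by rewrite lt_neqAle eq_sym al1.
have {}be1 : 0 < be by rewrite lt_neqAle eq_sym be1.
set D := (1 - t) * al + t * be.
have D0 : 0 < D by rewrite addr_gt0// mulr_gt0.
apply: le_powR_invn => //; first exact: ltW.
(* The weight for which [D ((1 - tau) x + tau y) = (1 - t) al x + t be y], so that [A / al] and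
   [B / be] combine into [C / D]. *)
pose tau := t * be / D.
have tau0 : 0 < tau by rewrite divr_gt0// mulr_gt0.
have tauD : D * tau = t * be by rewrite /tau mulrC divfK// gt_eqF.
have tau1' : D * (1 - tau) = (1 - t) * al by rewrite mulrBr mulr1 tauD /D addrK.
have tau1 : tau < 1.
  by rewrite -subr_gt0 -(pmulr_rgt0 _ D0) tau1' mulr_gt0.
have M0 : 0 <= M by exact: le_trans (AM _ Aa0).
pose M' := M / al + M / be + M / D.
have M1 : 0 <= M / al by rewrite divr_ge0// ltW.
have M2 : 0 <= M / be by rewrite divr_ge0// ltW.
have M3 : 0 <= M / D by rewrite divr_ge0// ltW.
have scaleM (S : set 'rV[R]_n) (r : R) : 0 < r -> (forall x, S x -> `|x| <= M) ->
    M / r <= M' -> forall x, S (r *: x) -> `|x| <= M'.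
  move=> r0 SM rM x /SM; rewrite normrZ gtr0_norm// mulrC -ler_pdivlMr// => h.
  exact: le_trans rM.
have scale_seg (S : set 'rV[R]_n) (r : R) : segment_closed S ->
    segment_closed [set x | S (r *: x)].
  move=> cS x y c /= Sx Sy c0 c1; rewrite scalerDr !scalerA ![r * _]mulrC -!scalerA.
  exact: cS.
have scale_vol (S : set 'rV[R]_n) (r : R) : 0 < r -> measurable S ->
    (forall x, S x -> `|x| <= M) -> M / r <= M' ->
    fine (lebesgue_rV n [set x | S (r *: x)]) = fine (lebesgue_rV n S) / r ^+ n.
  move=> r0 mS SM rM; apply/eqP; rewrite eq_sym -[_ == _](inj_eq (@EFin_inj _)).
  rewrite fineK; last first.
    rewrite ge0_fin_numE//; apply: lebesgue_rV_bounded_lty.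
      exact: measurable_preimage_scale.
    by move=> x; exact: (scaleM S r r0 SM rM).
  rewrite mulrC EFinM fineK ?vfin// -(lebesgue_rV_scale r0 mS) muleA -EFinM.
  by rewrite mulVf ?mul1e// expf_neq0// gt_eqF.
have MA : M / al <= M' by rewrite /M' -addrA lerDl addr_ge0.
have MB : M / be <= M' by rewrite /M' addrAC lerDr addr_ge0.
have MD : M / D <= M' by rewrite /M' lerDr addr_ge0.
rewrite -[leLHS]mul1r -ler_pdivlMr ?exprn_gt0//.
have key := @brunn_minkowski_mul R n [set x | A (al *: x)] [set x | B (be *: x)]
  [set x | C (D *: x)] tau M' tau0 tau1 (measurable_preimage_scale _ mA)
  (measurable_preimage_scale _ mB) (measurable_preimage_scale _ mC)
  (scale_seg A al cA) (scale_seg B be cB) (scaleM A al al1 AM MA)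
  (scaleM B be be1 BM MB) (scaleM C D D0 CM MD).
rewrite (scale_vol A al al1 mA AM MA) (scale_vol B be be1 mB BM MB) in key.
rewrite (scale_vol C D D0 mC CM MD) -/u -/v -/w -alE -beE in key.
rewrite !divff ?expf_neq0 ?gt_eqF// !powR1 mulr1 in key.
apply: key => x y /= Ax By; rewrite scalerDr !scalerA tau1' tauD -!scalerA.
exact: ABC.
Qed.

End brunn_minkowski_root.

(** * Separation and centroids *)

Section sublinear.
Context {R : realType} {V : lmodType R}.

Definition sublinear (p : V -> R) :=
  (forall x y, p (x + y) <= p x + p y) /\ (forall a x, 0 < a -> p (a *: x) = a * p x).

Lemma sublinear0 p : sublinear p -> p 0 = 0.
Proof.
move=> [_ pZ]; have := pZ 2 0 ltac:(by []); rewrite scaler0 => h.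
by lra.
Qed.

Lemma sublinear_opp_ge p x : sublinear p -> - p (- x) <= p x.
Proof.
move=> sp; rewrite -subr_ge0 opprK -(sublinear0 sp) -[in leLHS](subrr x).
exact: (proj1 sp).
Qed.

(* Replacing p by inf_{t >= 0} (p (x + t e) - t p(e)) makes it odd along e; doing
   so along a basis turns p into a linear functional. *)
Lemma sublinear_odd_along p e : sublinear p -> exists q, [/\ sublinear q,
  (forall x, q x <= p x), q e = p e & q (- e) = - p e].
Proof.
move=> sp; have [pD pZ] := sp.
pose S x := [set p (x + t *: e) - t * p e | t in [set t : R | 0 <= t]].
have lbS x : lbound (S x) (- p (- x)).
  move=> _ [t /= t0 <-].
  have : p (t *: e) <= p (x + t *: e) + p (- x).
    by rewrite -[in leLHS](addrK x (t *: e)) [t *: e + x]addrC; exact: pD.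
  have -> : p (t *: e) = t * p e.
    move: t0; rewrite le_eqVlt => /predU1P[<-|t0]; last exact: pZ.
    by rewrite scale0r mul0r sublinear0.
  by lra.
have neS x : S x !=set0 by exists (p (x + 0 *: e) - 0 * p e), 0 => //=.
have infS x : has_inf (S x) by split=> //; exists (- p (- x)).
pose q x := inf (S x).
have qle x t : 0 <= t -> q x <= p (x + t *: e) - t * p e.
  by move=> t0; apply: ge_inf; [case: (infS x)|exists t].
have qD x y : q (x + y) <= q x + q y.
  rewrite -lerBlDl; apply: lb_le_inf => // _ [t /= t0 <-].
  rewrite lerBlDl -lerBlDr; apply: lb_le_inf => // _ [s /= s0 <-].
  rewrite lerBlDr; apply: (le_trans (qle _ (s + t) ltac:(by rewrite addr_ge0))).
  have : p (x + y + (s + t) *: e) <= p (x + s *: e) + p (y + t *: e).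
    by rewrite scalerDl addrACA; exact: pD.
  by lra.
have qZle a x : 0 < a -> q (a *: x) <= a * q x.
  move=> a0; rewrite -ler_pdivrMl//; apply: lb_le_inf => // _ [t /= t0 <-].
  rewrite ler_pdivrMl//; apply: (le_trans (qle _ (a * t) ltac:(by rewrite mulr_ge0// ltW))).
  by rewrite -scalerA -scalerDr pZ// mulrBr mulrA.
have qZ a x : 0 < a -> q (a *: x) = a * q x.
  move=> a0; apply/eqP; rewrite eq_le qZle//=.
  rewrite -ler_pdivlMl//; apply: le_trans (qZle a^-1 (a *: x) ltac:(by rewrite invr_gt0)).
  by rewrite scalerA mulVf ?scale1r// gt_eqF.
have sq : sublinear q by split.
have qp x : q x <= p x by have := qle x 0 (lexx _); rewrite scale0r mul0r addr0 subr0.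
have qN : q (- e) <= - p e.
  by have := qle (- e) 1 ler01; rewrite scale1r mul1r addNr sublinear0// sub0r.
have qe : q e = p e.
  apply/eqP; rewrite eq_le qp/=; apply: le_trans (sublinear_opp_ge e sq).
  by rewrite lerNr.
exists q; split=> //; apply/eqP; rewrite eq_le qN/= -qe.
by have := sublinear_opp_ge (- e) sq; rewrite [- - e]opprK.
Qed.

(** Later replacements keep the oddness already gained: if [r <= q] and [q] is odd at [z], then [- r
    (- z) <= r z <= q z = - q (- z) <= - r (- z)], so all these are equal. *)
Lemma sublinear_odd_seq p (s : seq V) e : sublinear p -> exists q, [/\ sublinear q,
  (forall x, q x <= p x), q e = p e & forall x, x \in e :: s -> q (- x) = - q x].
Proof.
move=> sp; elim: s => [|x s [q [sq qp qe qs]]].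
  have [q [sq qp qe qN]] := sublinear_odd_along e sp; exists q; split=> // x.
  by rewrite inE => /eqP ->; rewrite qe.
have odd_preserved r z : sublinear r -> (forall x, r x <= q x) ->
    q (- z) = - q z -> r z = q z /\ r (- z) = - r z.
  move=> sr rq qz; have h3 := sublinear_opp_ge z sr.
  have h2 := rq z; have h1 := rq (- z); rewrite qz in h1.
  have rz : r z = q z.
    by apply/eqP; rewrite eq_le h2 (le_trans _ h3)// lerNr.
  split=> //; apply/eqP; rewrite eq_le rz h1/=.
  by have := sublinear_opp_ge (- z) sr; rewrite [- - z]opprK rz.
have [r [sr rq rx rNx]] := sublinear_odd_along x sq.
have [re rNe] := odd_preserved r e sr rq (qs e (mem_head _ _)).
exists r; split=> //.
- by move=> y; exact: le_trans (rq y) (qp y).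
- by rewrite re.
move=> y; rewrite !inE => /or3P[/eqP ->//|/eqP ->|ys].
  by rewrite rNx rx.
by have [] := odd_preserved r y sr rq (qs y _); rewrite ?inE ?ys ?orbT.
Qed.

End sublinear.

Section separation.
Context {R : realType} {n : nat}.
Implicit Types (W : set 'rV[R]_n).

(** Hahn-Banach in finite dimension. Once the minorant [q] is odd on the standard basis,
    subadditivity puts it below the linear form with the same values there; applied to [- x], this
    also puts it above. *)
Lemma sublinear_support (p : 'rV[R]_n -> R) (v0 : 'rV[R]_n) : sublinear p ->
  exists l : 'cV[R]_n, (forall x, (x *m l) 0 0 <= p x) /\ (v0 *m l) 0 0 = p v0.
Proof.
move=> sp.
have [q [sq qp qv qN]] := sublinear_odd_seq [seq delta_mx 0 j | j : 'I_n] v0 sp.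
have qNd j : q (- delta_mx 0 j) = - q (delta_mx 0 j).
  by apply: qN; rewrite inE; apply/orP; right; apply/mapP; exists j => //; rewrite mem_enum.
pose l : 'cV[R]_n := \col_j q (delta_mx 0 j).
have [qD qZ] := sq.
have qZd a j : q (a *: delta_mx 0 j) = a * q (delta_mx 0 j).
  have [a0|a0|->] := ltgtP a 0; last by rewrite scale0r mul0r sublinear0.
    rewrite -[a]opprK scaleNr -scalerN qZ ?oppr_gt0// qNd.
    by rewrite [- - a]opprK mulrNN.
  exact: qZ.
have qle x : q x <= (x *m l) 0 0.
  rewrite [in leLHS](row_sum_delta x) mxE.
  elim/big_ind2 : _ => [|a a' b b' ha hb|j _].
  - by rewrite sublinear0.
  - by rewrite (le_trans (qD _ _))// lerD.
  - by rewrite qZd mxE.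
have qE x : q x = (x *m l) 0 0.
  apply/eqP; rewrite eq_le qle/=.
  have := qle (- x); rewrite mulNmx mxE lerNr => h; apply: (le_trans h).
  exact: sublinear_opp_ge.
exists l; split=> [x|]; first by rewrite -qE.
by rewrite -qE qv.
Qed.

(** A linear form below the gauge of [W] about [w0], and equal to it at [z - w0], separates: the
    gauge is at most 1 on [W] and at least 1 at a point that is not interior. *)
Lemma convex_separation W (w0 z : 'rV[R]_n) : segment_closed W -> nbhs w0 W -> ~ nbhs z W ->
  exists l : 'cV[R]_n, l != 0 /\ forall w, W w -> (w *m l) 0 0 <= (z *m l) 0 0.
Proof.
move=> cW /nbhs_ballP[r /= r0 rW] nz.
have W0 : W w0 by apply: rW; exact: ballxx.
(* The infimum of these scalars is the Minkowski gauge of [W - w0]; the ball around [w0] makes the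
   set nonempty for every [v]. *)
pose S (v : 'rV[R]_n) := [set s : R | 0 < s /\ W (w0 + s^-1 *: v)].
have neS v : S v !=set0.
  exists ((`|v| + 1) / r * 1); have v1 : 0 < (`|v| + 1) / r.
    by rewrite divr_gt0// ltr_wpDl.
  rewrite mulr1; split=> //; apply: rW; rewrite mx_norm_ball /ball_/=.
  rewrite opprD addrA subrr sub0r normrN normrZ gtr0_norm ?invr_gt0//.
  rewrite invf_div mulrAC ltr_pdivrMr ?ltr_wpDl// ltr_pM2l//.
  by rewrite ltrDl.
have infS v : has_inf (S v) by split=> //; exists 0 => s [/ltW].
pose p v := inf (S v).
have ple v s : 0 < s -> W (w0 + s^-1 *: v) -> p v <= s.
  by move=> s0 Ws; apply: ge_inf; [case: (infS v)|].
have plt v e : p v < e -> exists2 s, 0 < s < e & W (w0 + s^-1 *: v).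
  move=> ve; have e0 : 0 < e - p v by rewrite subr_gt0.
  have [s [s0 Ws]] := inf_adherent e0 (infS v); rewrite addrC subrK => se.
  by exists s => //; rewrite s0.
have pD x y : p (x + y) <= p x + p y.
  apply/ler_addgt0Pr => e e0.
  have [s /andP[s0 se] Ws] := plt x (p x + e / 2) ltac:(by rewrite ltrDl divr_gt0).
  have [t /andP[t0 te] Wt] := plt y (p y + e / 2) ltac:(by rewrite ltrDl divr_gt0).
  have st : 0 < s + t by rewrite addr_gt0.
  apply: (@le_trans _ _ (s + t)); last first.
    have -> : p x + p y + e = (p x + e / 2) + (p y + e / 2) by field.
    by rewrite lerD// ltW.
  apply: ple => //; pose c := t / (s + t).
  have := cW _ _ c Ws Wt.
  have -> : (1 - c) *: (w0 + s^-1 *: x) + c *: (w0 + t^-1 *: y) =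
      w0 + (s + t)^-1 *: (x + y).
    apply/rowP => j; rewrite !mxE /c; field.
    by rewrite !gt_eqF.
  apply; rewrite /c; first by rewrite divr_ge0// ltW.
  by rewrite ler_pdivrMr// mul1r lerDr ltW.
have pZle a x : 0 < a -> p (a *: x) <= a * p x.
  move=> a0; rewrite -ler_pdivrMl//; apply/ler_addgt0Pr => e e0.
  have [s /andP[s0 se] Ws] := plt x (p x + e) ltac:(by rewrite ltrDl).
  rewrite ler_pdivrMl// (@le_trans _ _ (a * s))//; last first.
    by rewrite ler_pM2l// ltW.
  apply: ple; first by rewrite mulr_gt0.
  have as_inv : (a * s)^-1 * a = s^-1 by field; rewrite !gt_eqF.
  by rewrite scalerA as_inv.
have pZ a x : 0 < a -> p (a *: x) = a * p x.
  move=> a0; apply/eqP; rewrite eq_le pZle//=.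
  rewrite -ler_pdivlMl//; apply: le_trans (pZle a^-1 (a *: x) ltac:(by rewrite invr_gt0)).
  by rewrite scalerA mulVf ?scale1r// gt_eqF.
have [l [lp lz]] := @sublinear_support p (z - w0) (conj pD pZ).
have pw w : W w -> p (w - w0) <= 1.
  by move=> Ww; apply: ple => //; rewrite invr1 scale1r addrC subrK.
(* A gauge below 1 would place [z] strictly between the centre of the ball at [w0] and a point of
   [W]; the ball shrunk by [1 - s] towards that point would be a neighbourhood of [z] inside [W]. *)
have pz : 1 <= p (z - w0).
  rewrite leNgt; apply/negP => /plt[s /andP[s0 s1] Ws]; apply: nz.
  apply/nbhs_ballP; exists ((1 - s) * r) => /=; first by rewrite mulr_gt0// subr_gt0.
  move=> y; rewrite mx_norm_ball /ball_/= => zy.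
  have s1' : 0 < 1 - s by rewrite subr_gt0.
  pose u := w0 + (1 - s)^-1 *: (y - z).
  have Wu : W u.
    apply: rW; rewrite mx_norm_ball /ball_/= /u opprD addrA subrr sub0r normrN.
    by rewrite normrZ gtr0_norm ?invr_gt0// ltr_pdivrMl// distrC.
  have := cW _ _ s Wu Ws.
  have -> : (1 - s) *: u + s *: (w0 + s^-1 *: (z - w0)) = y.
    apply/rowP => j; rewrite /u !mxE; field.
    by rewrite !gt_eqF.
  by apply; exact: ltW.
exists l; split.
  apply: contraTneq pz => l0; rewrite -lz l0 mulmx0 mxE -ltNge; exact: ltr01.
move=> w Ww; have := le_trans (lp (w - w0)) (le_trans (pw w Ww) pz).
by rewrite -lz !mulmxBl !mxE lerD2r.
Qed.

End separation.

Lemma convex_set_segment_closed (R : realType) (V : lmodType R)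
    (A : set (convex_lmodType V)) : convex_set A -> segment_closed (A : set V).
Proof.
move=> cA x y c Ax Ay c0 c1.
have := cA y x (Itv01 c0 c1); rewrite !inE => /(_ Ay Ax).
by rewrite addrC.
Qed.

(** * Jensen's inequality at the centroid *)

Section centroid_jensen.
Context {R : realType} {n : nat}.
Local Notation lam := (@lebesgue_rV R n).
Variable K : set 'rV[R]_n.
Hypothesis cK : compact K.
Hypothesis sK : segment_closed K.
Hypothesis iK : K° !=set0.
Hypothesis gK : centroid K = 0.

Let mK : measurable K. Proof. exact: compact_rV_measurable. Qed.
Let Klty : (lam K < +oo)%E. Proof. exact: compact_rV_lty. Qed.

Lemma convex_body_lebesgue_gt0 : 0 < fine (lam K).
Proof.
by apply: fine_gt0; rewrite Klty andbT; case: iK => x Kx; exact: nbhs_lebesgue_rV_gt0 Kx.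
Qed.

Lemma integrable_on_body (f : 'rV[R]_n -> R) (b : R) : measurable_fun setT f ->
  (forall x, K x -> `|f x| <= b) -> lam.-integrable K (EFin \o f).
Proof.
move=> mf fb; apply: measurable_bounded_integrable => //.
  exact: measurable_funTS.
exists b; split; first exact: num_real.
by move=> c bc x Kx; exact: le_trans (fb x Kx) (ltW bc).
Qed.

Lemma compact_norm_bound : exists2 b : R, 0 <= b & forall x, K x -> `|x| <= b.
Proof.
have [b [_ Hb]] := compact_bounded cK; exists (`|b| + 1) => [|x Kx].
  by rewrite addr_ge0.
by apply: Hb => //; rewrite ltr_pwDr// ler_norm.
Qed.

Lemma measurable_linear_form (l : 'cV[R]_n) :
  measurable_fun setT (fun x : 'rV[R]_n => (x *m l) 0 0).
Proof.
under eq_fun do rewrite mxE.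
apply: measurable_sum => j; apply: measurable_funM => //; exact: measurable_coord.
Qed.

Lemma linear_form_bound (l : 'cV[R]_n) (x : 'rV[R]_n) :
  `|(x *m l) 0 0| <= `|x| * \sum_j `|l j 0|.
Proof.
rewrite mxE mulr_sumr (le_trans (ler_norm_sum _ _ _))//; apply: ler_sum => j _.
by rewrite normrM ler_wpM2r// rV_coord_le.
Qed.

Lemma integrable_linear_form (l : 'cV[R]_n) :
  lam.-integrable K (EFin \o (fun x => (x *m l) 0 0)).
Proof.
have [b b0 Kb] := compact_norm_bound.
apply: (@integrable_on_body _ (b * \sum_j `|l j 0|)).
  exact: measurable_linear_form.
move=> x /Kb xb; rewrite (le_trans (linear_form_bound l x))// ler_wpM2r//.
by apply: sumr_ge0 => j _.
Qed.

Lemma Rintegral_mulmx (l : 'cV[R]_n) :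
  \int[lam]_(x in K) (x *m l) 0 0 = \sum_j (\int[lam]_(x in K) x 0 j) * l j 0.
Proof.
have icoord j : lam.-integrable K (EFin \o (fun x : 'rV[R]_n => x 0 j)).
  have [b b0 Kb] := compact_norm_bound.
  apply: (@integrable_on_body _ b); first exact: measurable_coord.
  by move=> x /Kb; apply: le_trans; exact: rV_coord_le.
have iterm j : lam.-integrable K (EFin \o (fun x : 'rV[R]_n => l j 0 * x 0 j)).
  by apply: eq_integrable (integrableZl _ (l j 0) (icoord j)).
under eq_Rintegral => x _ do rewrite mxE.
rewrite /Rintegral.
under eq_integral => x _ do (under eq_bigr => j _ do rewrite mulrC; rewrite -sumEFin).
rewrite integral_sum// -sum_fine; last by move=> j _; apply: integrable_fin_num => //; exact: iterm.
apply: eq_bigr => j _.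
by have := RintegralZl (l j 0) mK (icoord j); rewrite /Rintegral mulrC.
Qed.

Lemma Rintegral_linear_form (l : 'cV[R]_n) : \int[lam]_(x in K) (x *m l) 0 0 = 0.
Proof.
rewrite Rintegral_mulmx big1// => j _.
have := gK; rewrite /centroid => /rowP/(_ j); rewrite !mxE => /eqP.
rewrite mulf_eq0 invr_eq0 gt_eqF ?convex_body_lebesgue_gt0//= => /eqP ->.
by rewrite mul0r.
Qed.

(** The integral of the form over [K] is 0. From an interior point [w] one can still move inside [K]
    so that the form grows by [d], so it is at most [- d] at [w] and at most [- d / 2] on a small
    ball around [w], which makes the integral negative. *)
Lemma linear_form_sign (l : 'cV[R]_n) : l != 0 ->
  ~ (forall x, K x -> (x *m l) 0 0 <= 0).
Proof.
move=> l0 lneg.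
have [j lj] : exists j, l j 0 != 0.
  apply: contrapT => H; case/negP: l0; apply/eqP/matrixP => j k.
  by rewrite ord1 [RHS]mxE; apply: contrapT => /eqP lj; apply: H; exists j.
have [w Kw] := iK; have /nbhs_ballP[r /= r0 rK] : nbhs w K by exact: Kw.
pose d := r / 2 * `|l j 0|.
have d0 : 0 < d by rewrite !mulr_gt0 ?normr_gt0// invr_gt0.
have wd : (w *m l) 0 0 <= - d.
  pose u : 'rV[R]_n := (r / 2 * Num.sg (l j 0)) *: delta_mx 0 j.
  have Ku : K (w + u).
    apply: rK; split=> // a b; rewrite ord1 /ball/= !mxE eqxx/=.
    rewrite opprD addrA subrr sub0r normrN !normrM normr_sg lj mulr1.
    rewrite (@le_lt_trans _ _ (r / 2))//; last by rewrite ltr_pdivrMr// ltr_pMr// ltr1n.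
    rewrite [`|r|]gtr0_norm// [`|2^-1|]gtr0_norm ?invr_gt0//.
    by case: (b == j); rewrite ?normr1 ?normr0 ?mulr1 ?mulr0// divr_ge0// ltW.
  have := lneg _ Ku; rewrite mulmxDl mxE /u -scalemxAl -rowE !mxE.
  have -> : r / 2 * Num.sg (l j 0) * l j 0 = d.
    by rewrite -mulrA -normrEsg.
  by rewrite -lerBrDr sub0r.
pose L := \sum_k `|l k 0|.
have L0 : 0 < L.
  rewrite /L (bigD1 j)//= ltr_pwDl ?normr_gt0// ?sumr_ge0//.
pose e := Num.min r (d / 2 / L).
have e0 : 0 < e by rewrite lt_min r0/= !divr_gt0.
have mb : measurable [set y : 'rV[R]_n | `|y - w| < e] by exact: measurable_norm_ball.
pose N := [set y : 'rV[R]_n | `|y - w| < e].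
have NK : N `<=` K.
  move=> y /= ye; apply: rK; rewrite mx_norm_ball /ball_/= distrC.
  by rewrite (lt_le_trans ye)// ge_min lexx.
have Nneg y : N y -> (y *m l) 0 0 <= - (d / 2).
  move=> /= ye; have -> : (y *m l) 0 0 = (w *m l) 0 0 + ((y - w) *m l) 0 0.
    by rewrite mulmxBl [X in _ + X]mxE [X in _ + (_ + X)]mxE addrC subrK.
  have h : ((y - w) *m l) 0 0 <= d / 2.
    rewrite (le_trans (ler_norm _))// (le_trans (linear_form_bound _ _))//.
    rewrite -ler_pdivlMr// (le_trans (ltW ye))// ge_min lexx orbT//.
  lra.
have Npos : 0 < fine (lam N).
  apply: fine_gt0; apply/andP; split.
    apply: (@nbhs_lebesgue_rV_gt0 _ _ N w) => //.
    apply/nbhs_ballP; exists e => //= y.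
    by rewrite mx_norm_ball /ball_/= distrC.
  by apply: le_lt_trans Klty; apply: le_measure; rewrite ?inE.
have iN : lam.-integrable K (EFin \o (fun x => - (d / 2) * \1_N x)).
  apply: (@integrable_on_body _ (d / 2)).
    by apply: measurable_funM => //; exact: measurable_indic.
  have d20 : 0 <= d / 2 by rewrite divr_ge0// ltW.
  move=> x _; rewrite normrM normrN (ger0_norm d20); apply: ler_piMr => //.
  by rewrite indicE; case: (x \in N); rewrite ?normr1 ?normr0.
have := @le_Rintegral _ _ _ lam K _ _ mK (integrable_linear_form l) iN _.
rewrite Rintegral_linear_form => H.
have {H} : 0 <= \int[lam]_(x in K) (- (d / 2) * \1_N x).
  apply: H => x Kx; rewrite indicE; have [xN|xN] := boolP (x \in N).
    by rewrite mulr1; apply: Nneg; rewrite inE in xN.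
  by rewrite mulr0; exact: lneg.
rewrite RintegralZl//; last first.
  apply: (@integrable_on_body _ 1); first exact: measurable_indic.
  by move=> x _; rewrite indicE; case: (x \in N); rewrite ?normr1 ?normr0.
rewrite /Rintegral integral_indic// setIidl//.
by rewrite mulNr oppr_ge0 leNgt mulr_gt0// divr_gt0.
Qed.

(** Otherwise a form separating 0 from [K] would be nonpositive on [K]. *)
Lemma centroid_interior : nbhs (0 : 'rV[R]_n) K.
Proof.
apply: contrapT => n0; have [w Kw] := iK.
have [l [l0 Hl]] := @convex_separation _ _ K w 0 sK Kw n0.
apply: (linear_form_sign l0) => x /Hl.
by rewrite mul0mx [X in _ <= X]mxE.
Qed.

(** Separating the hypograph of [h] from a point [eps] above [(h 0, 0)] gives an affine majorant of
    [h]. Its linear part integrates to 0 over [K] because the centroid is 0, and [eps] is chosen to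
    cost [e] after integration. *)
Lemma centroid_jensen (h : 'rV[R]_n -> R) (b : R) : measurable_fun setT h ->
  (forall x, K x -> 0 <= h x <= b) ->
  (forall x y c, K x -> K y -> 0 <= c -> c <= 1 ->
    (1 - c) * h x + c * h y <= h ((1 - c) *: x + c *: y)) ->
  \int[lam]_(x in K) h x <= h 0 * fine (lam K).
Proof.
move=> mh hb hconc.
have K0 : K 0 by apply: nbhs_singleton; exact: centroid_interior.
have ih : lam.-integrable K (EFin \o h).
  apply: (@integrable_on_body _ b) => // x /hb /andP[h0 hb'].
  by rewrite ger0_norm.
have V0 := convex_body_lebesgue_gt0.
apply/ler_addgt0Pr => e e0; pose eps := e / fine (lam K).
have eps0 : 0 < eps by rewrite divr_gt0.
pose W := [set y : 'rV[R]_n.+1 | K (\row_j y 0 (lift ord0 j)) /\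
  y 0 ord0 <= h (\row_j y 0 (lift ord0 j))].
have WE s x : W (rV_cons (s, x)) <-> K x /\ s <= h x.
  rewrite /W/= rV_cons0; have -> : \row_j rV_cons (s, x) 0 (lift ord0 j) = x.
    by apply/rowP => j; rewrite mxE rV_consS.
  by [].
have sW : segment_closed W.
  move=> x y c; rewrite -(rV_cons_surj x) -(rV_cons_surj y) !rV_consZ rV_consD.
  move=> /WE[Kx xh] /WE[Ky yh] c0 c1; apply/WE; split; first exact: sK.
  apply: le_trans (hconc _ _ _ Kx Ky c0 c1).
  by rewrite lerD// ler_wpM2l// subr_ge0.
(* Separation needs an interior point of the hypograph. As [h >= 0] on [K], everything close to
   height [-1] above the centroid lies below the graph. *)
have nW : nbhs (rV_cons (-1, 0) : 'rV[R]_n.+1) W.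
  have /nbhs_ballP[r /= r0 rK] := centroid_interior.
  apply/nbhs_ballP; exists (Num.min r 1) => /=; first by rewrite lt_min r0 ltr01.
  move=> y [_ H]; rewrite -(rV_cons_surj y); apply/WE.
  have Ky : K (\row_j y 0 (lift ord0 j)).
    apply: rK; split=> // a j; have := H 0 (lift ord0 j).
    rewrite rV_consS ord1 !mxE => hb'; apply: lt_le_trans hb' _.
    by rewrite ge_min lexx.
  split=> //; have /andP[h0 _] := hb _ Ky.
  have := H 0 ord0; rewrite rV_cons0 /ball/= => hy.
  have m1 : Num.min r 1 <= 1 by rewrite ge_min lexx orbT.
  apply: le_trans h0; have := lt_le_trans hy m1.
  by rewrite ltr_norml => /andP[]; lra.
have zW : ~ nbhs (rV_cons (h 0 + eps, 0) : 'rV[R]_n.+1) W.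
  by move=> /nbhs_singleton/WE[_]; rewrite gerDl leNgt eps0.
have [l [l0 Hl]] := convex_separation sW nW zW.
pose beta := l ord0 0; pose l' : 'cV[R]_n := \col_j l (lift ord0 j) 0.
have lE s x : (rV_cons (s, x) *m l) 0 0 = s * beta + (x *m l') 0 0.
  rewrite mxE big_ord_recl rV_cons0; congr (_ + _); rewrite mxE.
  by apply: eq_bigr => j _; rewrite rV_consS mxE.
have Hl' s x : K x -> s <= h x -> s * beta + (x *m l') 0 0 <= (h 0 + eps) * beta.
  move=> Kx sx; have := Hl _ ((WE s x).2 (conj Kx sx)).
  by rewrite !lE mul0mx [X in _ <= _ + X]mxE addr0.
have beta0 : 0 <= beta.
  rewrite leNgt; apply/negP => bneg.
  have := Hl' (h 0 - 1) 0 K0 ltac:(by rewrite gerBl).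
  rewrite mul0mx [X in _ + X <= _]mxE addr0.
  have : (h 0 - 1) * beta - (h 0 + eps) * beta = - (1 + eps) * beta by ring.
  have : 0 < - (1 + eps) * beta by rewrite nmulr_lgt0// oppr_lt0 addr_gt0.
  lra.
(* A vertical hyperplane would give a nonzero linear form that is nonpositive on [K], which
   [linear_form_sign] excludes. *)
have {}beta0 : 0 < beta.
  rewrite lt_neqAle eq_sym beta0 andbT; apply/eqP => b0.
  have l'0 : l' != 0.
    apply: contra l0 => /eqP l'0; apply/eqP/matrixP => j k; rewrite ord1 [RHS]mxE.
    have [j' ->|->] := unliftP ord0 j; last exact: b0.
    by have := congr1 (fun M : 'cV[R]_n => M j' 0) l'0; rewrite !mxE.
  apply: (linear_form_sign l'0) => x Kx; have := Hl' (h x) x Kx (lexx _).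
  by rewrite b0 !mulr0 add0r.
have ib : lam.-integrable K (EFin \o (fun x => beta * h x)).
  by apply: eq_integrable (integrableZl mK beta ih) => // x _.
have isum : lam.-integrable K (EFin \o (fun x => beta * h x + (x *m l') 0 0)).
  by apply: eq_integrable (integrableD mK ib (integrable_linear_form l')).
have icst : lam.-integrable K (EFin \o (fun=> (h 0 + eps) * beta)).
  exact: (@integrable_on_body _ `|(h 0 + eps) * beta|).
have := @le_Rintegral _ _ _ lam K _ _ mK isum icst.
rewrite RintegralD//; last exact: integrable_linear_form.
rewrite Rintegral_linear_form addr0 RintegralZl// Rintegral_cst// => key.
have : beta * \int[lam]_(x in K) h x <= (h 0 + eps) * beta * fine (lam K).
  by apply: key => x Kx; rewrite mulrC; exact: Hl'.
rewrite [_ * beta]mulrC -mulrA ler_pM2l// mulrDl /eps divfK// gt_eqF//.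
Qed.

End centroid_jensen.

(** * Sections through a point and the centroid inequality *)

Section reflection.
Context {R : realType} {n : nat}.
Local Open Scope ereal_scope.

(** The factor of the linear change of variables is found on the unit ball, which is symmetric. *)
Lemma ge0_integral_rV_opp (f : 'rV[R]_n -> \bar R) : measurable_fun setT f ->
  (forall x, 0 <= f x) -> \int[lebesgue_rV n]_x f (- x)%R = \int[lebesgue_rV n]_x f x.
Proof.
have uM : (- 1%:M : 'M[R]_n)%R \in unitmx.
  by rewrite -scaleN1r unitmxZ ?unitmx1// unitrN1.
have [c c0 Hc] := ge0_integral_rV_linear uM.
have mulN (x : 'rV[R]_n) : (x *m - 1%:M = - x)%R by rewrite mulmxN mulmx1.
pose A := [set x : 'rV[R]_n | `|x| <= 1]%R.
have mA : measurable A by apply: closed_rV_measurable; exact: closed_norm_le.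
have lA : \int[lebesgue_rV n]_x (\1_A x)%:E = (2 ^+ n)%:E.
  rewrite integral_indic// setIT; transitivity ((2 * 1 : R) ^+ n)%:E.
    exact: lebesgue_rV_norm_le.
  by rewrite mulr1.
have := Hc _ (measurable_EFin_indic mA) (fun x => ltac:(by rewrite lee_fin)).
under eq_integral => x _ do rewrite mulN (@indic_congr _ _ R A A (- x)%R x) ?/A/= ?normrN//.
rewrite lA -EFinM => -[c1].
have {}c1 : c = 1%R.
  by apply: (mulIf (lt0r_neq0 (exprn_gt0 n (ltr0n R 2)))); rewrite mul1r -c1.
move=> mf f0; rewrite -[RHS]mul1e -c1 -Hc//.
by apply: eq_integral => x _; rewrite mulN.
Qed.

End reflection.

Section parallel_sections.
Context {R : realType} {n i : nat}.
Variable B : 'M[R]_(i, n).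
Local Open Scope ereal_scope.

(** Parameters [e] are measured instead of points [x + e B]: a full-rank [B] gives a constant
    multiple of the volume of the parallel section, while a degenerate [B] can give an infinite
    value. *)
Definition section_volume (K : set 'rV[R]_n) (x : 'rV[R]_n) : \bar R :=
  lebesgue_rV i [set e : 'rV[R]_i | K (x + e *m B)%R].

Lemma measurable_translate_along :
  measurable_fun setT (fun p : 'rV[R]_n * 'rV[R]_i => (p.1 + p.2 *m B)%R).
Proof.
apply: measurable_fun_rV => j.
under eq_fun do rewrite mxE.
apply: measurable_funD.
  exact: (measurableT_comp (measurable_coord j) measurable_fst).
apply: (measurableT_comp (f := fun x : 'rV[R]_n => x 0%R j)).
  exact: measurable_coord.
exact: (measurableT_comp (measurable_mulmxr B) measurable_snd).
Qed.

Lemma measurable_section_volume K : measurable K ->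
  measurable_fun setT (section_volume K).
Proof.
move=> mK.
have mP : measurable [set p : 'rV[R]_n * 'rV[R]_i | K (p.1 + p.2 *m B)%R].
  by rewrite -[X in measurable X]setTI; exact: measurable_translate_along.
apply: eq_measurable_fun (measurable_fun_xsection (lebesgue_rV i) mP) => x _.
rewrite /section_volume/=; congr (lebesgue_rV i _).
by apply/seteqP; split=> e; rewrite /xsection/= inE.
Qed.

Lemma section_volume_shift K x e : measurable K ->
  section_volume K (x + e *m B)%R = section_volume K x.
Proof.
move=> mK; rewrite /section_volume -[RHS](lebesgue_rV_shift e); last first.
  exact: measurable_preimage_affine.
congr (lebesgue_rV i _); apply/seteqP; split=> e' /=;
  by rewrite mulmxDl -addrA [(e *m B + _)%R]addrC.
Qed.

(** Both sides measure, with weight [psi], the pairs formed by a point of [K1] and a point of [K2]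
    on a common fibre. Tonelli, the translation of [x] by [e B] and the reflection of [e] exchange
    the roles, and [psi] is the same at both points of a pair. *)
Lemma section_volume_swap (K1 K2 : set 'rV[R]_n) (psi : 'rV[R]_n -> \bar R) :
  measurable K1 -> measurable K2 -> measurable_fun setT psi ->
  (forall x, 0 <= psi x) -> (forall x e, psi (x + e *m B)%R = psi x) ->
  \int[lebesgue_rV n]_x ((\1_K1 x)%:E * psi x * section_volume K2 x) =
  \int[lebesgue_rV n]_x ((\1_K2 x)%:E * psi x * section_volume K1 x).
Proof.
move=> mK1 mK2 mpsi psi0 psiB.
have mI (A : set 'rV[R]_n) : measurable A ->
    measurable_fun setT (fun x => (\1_A x)%:E * psi x).
  by move=> mA; apply: emeasurable_funM => //; exact: measurable_EFin_indic.
have I0 (A : set 'rV[R]_n) x : 0 <= (\1_A x)%:E * psi x.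
  by rewrite mule_ge0// lee_fin.
have sectE (A : set 'rV[R]_n) x : measurable A ->
    section_volume A x = \int[lebesgue_rV i]_e (\1_A (x + e *m B)%R)%:E.
  move=> mA; rewrite integral_indic_comp//; exact: measurable_preimage_affine.
have maff (A : set 'rV[R]_n) x : measurable A ->
    measurable_fun setT (fun e : 'rV[R]_i => (\1_A (x + e *m B)%R : R)%:E).
  move=> mA; have m : measurable_fun setT (fun e : 'rV[R]_i => (x + e *m B)%R).
    under eq_fun do rewrite addrC.
    exact: (measurableT_comp (measurable_fun_addrV x) (measurable_mulmxr B)).
  exact: (measurableT_comp (measurable_EFin_indic mA) m).
have sectNE (A : set 'rV[R]_n) x : measurable A ->
    section_volume A x = \int[lebesgue_rV i]_e (\1_A (x - e *m B)%R)%:E.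
  move=> mA; rewrite sectE// -(ge0_integral_rV_opp (maff A x mA)); last first.
    by move=> e; rewrite lee_fin.
  by apply: eq_integral => e _; rewrite mulNmx.
have msub : measurable_fun setT (fun p : 'rV[R]_n * 'rV[R]_i => (p.1 - p.2 *m B)%R).
  have mo : measurable_fun setT (fun p : 'rV[R]_n * 'rV[R]_i => (p.1, (- p.2)%R)).
    apply: measurable_fun_pair => //.
    by apply: (measurableT_comp (@measurable_fun_oppV R i)); exact: measurable_snd.
  have := measurableT_comp measurable_translate_along mo.
  by apply: eq_measurable_fun => p _ /=; rewrite mulNmx.
have mprod (A A' : set 'rV[R]_n) (s : 'rV[R]_n * 'rV[R]_i -> 'rV[R]_n) :
    measurable A -> measurable A' -> measurable_fun setT s ->
    measurable_fun setT (fun p : 'rV[R]_n * 'rV[R]_i =>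
      (\1_A p.1)%:E * psi p.1 * (\1_A' (s p))%:E).
  move=> mA mA' ms; apply: emeasurable_funM.
    exact: (measurableT_comp (mI A mA) measurable_fst).
  exact: (measurableT_comp (measurable_EFin_indic mA') ms).
transitivity (\int[lebesgue_rV n]_x \int[lebesgue_rV i]_e
    ((\1_K1 x)%:E * psi x * (\1_K2 (x + e *m B)%R)%:E)).
  by apply: eq_integral => x _; rewrite sectE// ge0_integralZl//; exact: maff.
rewrite (fubini_tonelli (m1 := lebesgue_rV n) (m2 := lebesgue_rV i)
  (fun p => (\1_K1 p.1)%:E * psi p.1 * (\1_K2 (p.1 + p.2 *m B)%R)%:E)); last 2 first.
- by apply: mprod => //; exact: measurable_translate_along.
- by move=> p; rewrite mule_ge0 ?I0// lee_fin.
transitivity (\int[lebesgue_rV i]_e \int[lebesgue_rV n]_x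
    ((\1_K2 x)%:E * psi x * (\1_K1 (x - e *m B)%R)%:E)).
  apply: eq_integral => e _ /=.
  rewrite -[LHS](ge0_integral_rV_shift (- (e *m B))%R); last 2 first.
  - have mc : measurable_fun setT (fun x : 'rV[R]_n => (x, e)) by exact: measurable_fun_pair.
    exact: (measurableT_comp (mprod K1 K2 _ mK1 mK2 measurable_translate_along) mc).
  - by move=> x; rewrite mule_ge0 ?I0// lee_fin.
  apply: eq_integral => x _; rewrite subrK -mulNmx psiB mulNmx.
  by rewrite muleC [X in _ * X = _]muleC muleA.
rewrite -(fubini_tonelli (m1 := lebesgue_rV n) (m2 := lebesgue_rV i)
  (fun p => (\1_K2 p.1)%:E * psi p.1 * (\1_K1 (p.1 - p.2 *m B)%R)%:E)); last 2 first.
- by apply: mprod.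
- by move=> p; rewrite mule_ge0 ?I0// lee_fin.
apply: eq_integral => x _ /=; rewrite sectNE// ge0_integralZl//.
have mc : measurable_fun setT (fun e : 'rV[R]_i => (x, e)) by exact: measurable_fun_pair.
exact: (measurableT_comp (measurable_EFin_indic mK1) (measurableT_comp msub mc)).
Qed.

End parallel_sections.

Section sections_of_convex_sets.
Context {R : realType} {n i : nat}.
Variables (B : 'M[R]_(i, n)) (K : set 'rV[R]_n).
Hypothesis i0 : (0 < i)%N.
Hypothesis fB : row_free B.
Hypothesis cK : compact K.
Hypothesis sK : segment_closed K.

Let mK : measurable K. Proof. exact: compact_rV_measurable. Qed.

Lemma mulmx_norm_le m p (x : 'rV[R]_m) (P : 'M[R]_(m, p)) :
  `|x *m P| <= `|x| * \sum_j \sum_k `|P k j|.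
Proof.
apply/rV_norm_leP.
  by rewrite mulr_ge0// sumr_ge0// => j _; rewrite sumr_ge0.
move=> j; rewrite mxE (le_trans (ler_norm_sum _ _ _))//.
rewrite (bigD1 j)//= mulrDr ler_wpDr//.
  by rewrite mulr_ge0// sumr_ge0// => a _; rewrite sumr_ge0.
rewrite mulr_sumr; apply: ler_sum => k _.
by rewrite normrM ler_wpM2r// rV_coord_le.
Qed.

Lemma section_bounded : exists M : R, forall x e, K x -> K (x + e *m B) -> `|e| <= M.
Proof.
have [b b0 Kb] := compact_norm_bound cK.
exists (2 * b * \sum_j \sum_k `|pinvmx B k j|) => x e Kx Kxe.
rewrite -[e](mulmxKp fB) (le_trans (mulmx_norm_le _ _))// ler_wpM2r//.
  by rewrite sumr_ge0// => j _; rewrite sumr_ge0.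
have -> : e *m B = (x + e *m B) - x by rewrite addrC addKr.
by rewrite (le_trans (ler_normB _ _))// mulr2n mulrDl mul1r lerD// Kb.
Qed.

Lemma section_volume_fin x : section_volume B K x \is a fin_num.
Proof.
have [M HM] := section_bounded.
rewrite ge0_fin_numE//.
have mS y : measurable [set e : 'rV[R]_i | K (y + e *m B)].
  exact: measurable_preimage_affine.
(* The point [x] may lie outside [K]; a nonempty fibre is first recentred at one of its points in
   [K], where the bound applies. *)
have [[e0 Ke0]|H] := pselect (exists e, K (x + e *m B)).
  rewrite -(section_volume_shift B x e0 mK).
  apply: (@lebesgue_rV_bounded_lty _ _ _ M); first exact: mS.
  by move=> e /= Ke; exact: HM Ke.
rewrite /section_volume (_ : [set _ | _] = set0) ?measure0//.
by apply/seteqP; split=> // e Ke; apply: H; exists e.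
Qed.

Definition section_radius (x : 'rV[R]_n) : R :=
  fine (section_volume B K x) `^ i%:R^-1.

Lemma section_radius_ge0 x : 0 <= section_radius x.
Proof. exact: powR_ge0. Qed.

Lemma section_radiusX x : section_radius x ^+ i = fine (section_volume B K x).
Proof. by rewrite powR_invnK// fine_ge0// measure_ge0. Qed.

Lemma measurable_section_radius : measurable_fun setT section_radius.
Proof.
apply: (measurableT_comp (@measurable_powR R _)).
apply: (measurableT_comp (@fine_measurable R setT measurableT)).
exact: measurable_section_volume.
Qed.

(** Brunn's principle: by convexity, the fibre over a combination contains the same combination of
    the two fibres, and Brunn-Minkowski in R^i applies. *)
Lemma section_radius_concave x y c : K x -> K y -> 0 <= c -> c <= 1 ->
  (1 - c) * section_radius x + c * section_radius y <=
  section_radius ((1 - c) *: x + c *: y).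
Proof.
move=> Kx Ky c0 c1; have [M HM] := section_bounded.
have Kz : K ((1 - c) *: x + c *: y) by exact: sK.
have mS z : measurable [set e : 'rV[R]_i | K (z + e *m B)].
  exact: measurable_preimage_affine.
have sS z : segment_closed [set e : 'rV[R]_i | K (z + e *m B)].
  move=> e e' a /= Ke Ke' a0 a1; have := sK Ke Ke' a0 a1.
  by rewrite !scalerDr addrACA -scalerDl subrK scale1r mulmxDl -!scalemxAl.
apply: (@brunn_minkowski _ _ _ _ _ _ M) => //.
- by exists 0; rewrite /= mul0mx addr0.
- by exists 0; rewrite /= mul0mx addr0.
- by move=> e /= Ke; exact: HM Ke.
- by move=> e /= Ke; exact: HM Ke.
- by move=> e /= Ke; exact: HM Ke.
move=> e e' /= Ke Ke'; have := sK Ke Ke' c0 c1.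
by rewrite !scalerDr addrACA mulmxDl -!scalemxAl.
Qed.

Lemma section_radius_bounded : exists b : R, forall x, K x -> 0 <= section_radius x <= b.
Proof.
have [M HM] := section_bounded.
pose v := fine (lebesgue_rV i [set e : 'rV[R]_i | `|e| <= Num.max 0 M]).
exists (v `^ i%:R^-1) => x Kx; rewrite section_radius_ge0/=.
have mN : measurable [set e : 'rV[R]_i | `|e| <= Num.max 0 M].
  by apply: closed_rV_measurable; exact: closed_norm_le.
have Nfin : lebesgue_rV i [set e : 'rV[R]_i | `|e| <= Num.max 0 M] \is a fin_num.
  by rewrite lebesgue_rV_norm_le// le_max lexx.
apply: ge0_ler_powR; rewrite ?nnegrE ?fine_ge0 ?measure_ge0//.
apply: fine_le => //; first exact: section_volume_fin.
apply: le_measure; rewrite ?inE//.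
  exact: measurable_preimage_affine.
by move=> e /= Ke; rewrite le_max (HM _ _ Kx Ke) orbT.
Qed.

End sections_of_convex_sets.

Section homothety.
Context {R : realType} {n : nat}.

Lemma measurable_homothety (x0 : 'rV[R]_n) (t : R) :
  measurable_fun setT (fun x : 'rV[R]_n => x0 + t *: (x - x0)).
Proof.
under eq_fun do rewrite addrC.
apply: (measurableT_comp (measurable_fun_addrV x0)).
exact: (measurableT_comp (@measurable_fun_scalerV R n t) (measurable_fun_addrV (- x0))).
Qed.

Lemma ge0_integral_homothety (x0 : 'rV[R]_n) (t : R) (f : 'rV[R]_n -> \bar R) : 0 < t ->
  measurable_fun setT f -> (forall x, 0 <= f x)%E ->
  ((t ^+ n)%:E * \int[lebesgue_rV n]_x f (x0 + t *: (x - x0))%R =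
   \int[lebesgue_rV n]_x f x)%E.
Proof.
move=> t0 mf f0.
have mf1 : measurable_fun setT (fun x : 'rV[R]_n => f (x + x0)).
  exact: (measurableT_comp mf (measurable_fun_addrV x0)).
have mf2 : measurable_fun setT (fun x : 'rV[R]_n => f (t *: x + x0)).
  exact: (measurableT_comp mf1 (@measurable_fun_scalerV R n t)).
rewrite -(ge0_integral_rV_shift x0 mf f0).
rewrite -(ge0_integral_rV_scale t0 mf1 (fun x => f0 _)); congr (_ * _)%E.
rewrite -(ge0_integral_rV_shift (- x0) mf2 (fun x => f0 _)).
by apply: eq_integral => x _; rewrite addrC.
Qed.

Lemma lebesgue_rV_homothety (x0 : 'rV[R]_n) (t : R) (A : set 'rV[R]_n) : 0 < t -> measurable A ->
  (lebesgue_rV n [set x | A (x0 + t^-1 *: (x - x0))%R] = (t ^+ n)%:E * lebesgue_rV n A)%E.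
Proof.
move=> t0 mA; have mA' : measurable [set x | A (x0 + t^-1 *: (x - x0))%R].
  by rewrite -[X in measurable X]setTI; exact: (measurable_homothety x0 t^-1).
have := ge0_integral_homothety x0 t0 (measurable_EFin_indic mA')
  (fun x => ltac:(by rewrite lee_fin)).
rewrite [X in _ = X]integral_indic// setIT => <-; congr (_ * _)%E.
transitivity (\int[lebesgue_rV n]_x (\1_A x)%:E)%E; last by rewrite integral_indic// setIT.
apply: eq_integral => x _.
congr (_%:E); apply: indic_congr; rewrite /=.
by rewrite [x0 + t *: _]addrC addrK scalerA mulVf ?gt_eqF// scale1r addrC subrK.
Qed.

End homothety.

(** The second term, with its coefficient [k.+1], is where the [i+1] of the final constant comes
    from. *)
Lemma binomial_lower_bound (R : realType) (a b : R) k : 0 <= a -> 0 <= b ->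
  a ^+ k.+1 + k.+1%:R * a ^+ k * b <= (a + b) ^+ k.+1.
Proof.
move=> a0 b0; elim: k => [|k IH]; first by rewrite !expr1 expr0 mulr1 mul1r.
rewrite [leRHS]exprS; apply: le_trans (ler_wpM2l (addr_ge0 a0 b0) IH).
have -> : (a + b) * (a ^+ k.+1 + k.+1%:R * a ^+ k * b) =
    a ^+ k.+2 + k.+2%:R * a ^+ k.+1 * b + k.+1%:R * a ^+ k * b ^+ 2.
  by rewrite -[k.+2%:R]natr1 !exprS; ring.
by rewrite lerDl !mulr_ge0 ?exprn_ge0.
Qed.

(** * The mean of the section radius over the body *)

Section section_inequality.
Context {R : realType} {n i : nat}.
Variables (B : 'M[R]_(i, n)) (K : set 'rV[R]_n).
Hypothesis i0 : (0 < i)%N.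
Hypothesis fB : row_free B.
Hypothesis cK : compact K.
Hypothesis sK : segment_closed K.
Local Notation lam := (@lebesgue_rV R n).
Local Notation h := (section_radius B K).
Local Notation vol := (fun x => fine (section_volume B K x)).

Let mK : measurable K. Proof. exact: compact_rV_measurable. Qed.
Let h0 x : 0 <= h x. Proof. exact: section_radius_ge0. Qed.
Let mh : measurable_fun setT h. Proof. exact: measurable_section_radius. Qed.

Let I := (\int[lam]_(x in K) (h x)%:E)%E.

Let IE : I = (\int[lam]_x (\1_K x * h x)%:E)%E.
Proof.
rewrite /I integral_mkcond; apply: eq_integral => x _.
by rewrite patchE indicE; case: (x \in K); rewrite ?mul1r ?mul0r.
Qed.

Let Ifin : I \is a fin_num.
Proof.
have [b Hb] := section_radius_bounded fB cK.
apply: integrable_fin_num => //.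
apply: (@integrable_on_body _ _ _ cK _ b) => // x /Hb/andP[? ?].
by rewrite ger0_norm.
Qed.

(** The exchange lemma for [K] and [K' = x0 + t (K - x0)], with a weight that brings one side below
    [I]; on the other side, pulled back to [K] by the homothety, concavity compares [h] at [x] and
    at its preimage [z]. *)
Lemma section_radius_dilation_ext t x0 : 0 < t -> t < 1 -> K x0 ->
  ((t ^+ n)%:E * (t%:E * I +
    (i.+1%:R * (1 - t) * h x0)%:E * lam (K `&` [set x | (0 < h x)%R])) <= I)%E.
Proof.
move=> t0 t1 Kx0; set M := h x0; pose P := [set x | 0 < h x].
have ti0 : 0 < t ^+ i by rewrite exprn_gt0.
have t1' : 0 <= 1 - t by rewrite subr_ge0 ltW.
have mP : measurable P.
  rewrite -[X in measurable X]setTI; exact: (measurable_fun_ltr (f := cst 0)).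
pose zz (x : 'rV[R]_n) := x0 + t^-1 *: (x - x0).
have zzD x e : zz (x + e *m B) = zz x + (t^-1 *: e) *m B.
  by rewrite /zz addrAC scalerDr addrA scalemxAl.
pose K' := [set x | K (zz x)].
have mzz : measurable_fun setT zz by exact: measurable_homothety.
have mK' : measurable K' by rewrite -[X in measurable X]setTI; exact: mzz.
have mvol : measurable_fun setT vol.
  apply: (measurableT_comp (@fine_measurable R setT measurableT)).
  exact: measurable_section_volume.
have vol0 x : 0 <= vol x by apply: fine_ge0; exact: measure_ge0.
have volE x : section_volume B K x = (vol x)%:E.
  by rewrite fineK//; exact: section_volume_fin.
have vol'E x : section_volume B K' x = (t ^+ i * vol (zz x))%:E.
  rewrite EFinM -volE.
  have ti : 0 < t^-1 by rewrite invr_gt0.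
  rewrite [in RHS]/section_volume -(lebesgue_rV_scale ti); last exact: measurable_preimage_affine.
  rewrite muleA -EFinM -exprMn mulfV ?gt_eqF// expr1n mul1e.
  rewrite /section_volume; congr (lebesgue_rV i _).
  by apply/funext => e; rewrite /K'/= zzD.
(* The section volume of [K'] at [x] is [t ^+ i * vol (zz x)], so [psi] times it is [h x], or 0
   where it vanishes, by the convention on division; in both cases it is at most [h x]. *)
pose psi x := (h x / (t ^+ i * vol (zz x)))%:E.
have mpsi : measurable_fun setT psi.
  apply/measurable_EFinP; apply: measurable_funM => //.
  rewrite (_ : (fun x => _) = (fun x => (t ^+ i * vol (zz x)) `^ (-1))); last first.
    by apply/funext => x; rewrite powR_inv1// mulr_ge0// ltW.
  apply: (measurableT_comp (@measurable_powR R _)).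
  by apply: measurable_funM => //; exact: (measurableT_comp mvol mzz).
have psi0 x : (0 <= psi x)%E.
  by rewrite lee_fin divr_ge0// mulr_ge0// ltW.
have psiB x e : psi (x + e *m B) = psi x.
  rewrite /psi /section_radius section_volume_shift//.
  by rewrite zzD section_volume_shift.
have swap := section_volume_swap mK' mK mpsi psi0 psiB.
apply: (@le_trans _ _ (\int[lam]_x ((\1_K x)%:E * psi x * section_volume B K' x))%E); last first.
  rewrite IE; apply: ge0_le_integral => //.
  - by move=> x _; rewrite !mule_ge0// ?lee_fin// measure_ge0.
  - apply: emeasurable_funM; last exact: measurable_section_volume.
    by apply: emeasurable_funM => //; exact: measurable_EFin_indic.
  - by apply/measurable_EFinP; apply: measurable_funM => //; exact: measurable_indic.
  - move=> x _; rewrite vol'E /psi -!EFinM lee_fin -mulrA ler_wpM2l//.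
    have [->|u0] := eqVneq (t ^+ i * vol (zz x)) 0; first by rewrite mulr0.
    by rewrite divfK.
rewrite -swap.
pose G x := (\1_K' x * (h x / (t ^+ i * vol (zz x))) * vol x)%:E.
have mG : measurable_fun setT G.
  apply/measurable_EFinP; apply: measurable_funM => //; apply: measurable_funM.
    exact: measurable_indic.
  by apply/measurable_EFinP.
have G0 x : (0 <= G x)%E.
  by rewrite lee_fin mulr_ge0// mulr_ge0// divr_ge0// mulr_ge0// ltW.
rewrite (_ : (\int[lam]_x _)%E = (\int[lam]_x G x)%E); last first.
  by apply: eq_integral => x _; rewrite volE -!EFinM.
rewrite -(ge0_integral_homothety x0 t0 mG G0).
apply: lee_wpmul2l; first by rewrite lee_fin exprn_ge0// ltW.
have mIh : measurable_fun setT (fun x => (\1_K x * h x)%:E : \bar R).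
  by apply/measurable_EFinP; apply: measurable_funM => //; exact: measurable_indic.
have mKP : measurable (K `&` P) by exact: measurableI.
rewrite IE -ge0_integralZl//; last 2 first.
- by move=> x _; rewrite lee_fin mulr_ge0.
- by rewrite lee_fin ltW.
have cM : 0 <= i.+1%:R * (1 - t) * M by rewrite mulr_ge0 ?h0// mulr_ge0.
rewrite -[X in (_ + _ * lam X)%E]setIT -integral_indic// -ge0_integralZl//; last exact: measurable_EFin_indic.
rewrite -ge0_integralD//; last 4 first.
- by move=> x _; rewrite mule_ge0// lee_fin ?mulr_ge0// ltW.
- exact: measurable_funeM.
- by move=> x _; rewrite mule_ge0// lee_fin.
- by apply: measurable_funeM; exact: measurable_EFin_indic.
apply: ge0_le_integral => //.
- move=> x _; rewrite adde_ge0// mule_ge0// lee_fin ?mulr_ge0// ltW//.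
- apply: emeasurable_funD; apply: measurable_funeM => //; exact: measurable_EFin_indic.
- exact: (measurableT_comp mG (measurable_homothety x0 t)).
move=> z _; rewrite /G -!EFinM -EFinD lee_fin; set x := x0 + t *: (z - x0).
have zx : zz x = z.
  rewrite /zz /x [x0 + t *: _]addrC addrK scalerA mulVf ?gt_eqF// scale1r.
  by rewrite addrC subrK.
rewrite (@indic_congr _ _ R K' K x z) /K'/= ?zx//.
rewrite indicE; have [zK|zK] := boolP (z \in K); last first.
  rewrite mul0r mulr0 add0r indicE.
  rewrite (_ : (z \in K `&` P) = false) ?mulr0 ?mul0r//.
  by apply/negbTE; rewrite notin_setE => -[Kz]; rewrite notin_setE in zK.
rewrite !mul1r.
have Kz : K z by rewrite inE in zK.
have hx : t * h z + (1 - t) * M <= h x.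
  have := section_radius_concave i0 fB cK sK Kx0 Kz (ltW t0) (ltW t1).
  have -> : (1 - t) *: x0 + t *: z = x by rewrite /x scalerBr scalerBl scale1r addrAC addrA.
  by rewrite addrC.
have volX y : vol y = h y ^+ i by rewrite section_radiusX.
(* Here the quotient is 0 by convention, which is why the extra term is only claimed on the part of
   [K] where [h] is positive. *)
have [hz0|hz0] := eqVneq (h z) 0.
  rewrite hz0 mulr0 add0r indicE (_ : (z \in K `&` P) = false); last first.
    by apply/negbTE; rewrite notin_setE => -[_]; rewrite /P/= hz0 ltxx.
  by rewrite mulr0 mulr_ge0// divr_ge0// mulr_ge0// ltW.
have hzp : 0 < h z by rewrite lt_neqAle eq_sym hz0 h0.
rewrite indicE mem_set; last by split.
rewrite mulr1 !volX ?zx [leRHS]mulrAC -exprS -exprMn.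
have thz : 0 < (t * h z) ^+ i by rewrite exprn_gt0// mulr_gt0.
rewrite ler_pdivlMr//.
have -> : (t * h z + i.+1%:R * (1 - t) * M) * (t * h z) ^+ i =
    (t * h z) ^+ i.+1 + i.+1%:R * (t * h z) ^+ i * ((1 - t) * M).
  by rewrite exprS; ring.
have th0 : 0 <= t * h z by rewrite mulr_ge0// ltW.
have tM0 : 0 <= (1 - t) * M by rewrite mulr_ge0// h0.
apply: (le_trans (binomial_lower_bound i th0 tM0)).
by apply: lerXn2r hx; rewrite nnegrE ?h0// addr_ge0.
Qed.

(** The homothetic copy of [K] about [x0] lies in that part, since concavity gives
    [h >= (1 - t) h x0] on it. *)
Lemma section_radius_support t x0 : 0 < t -> t < 1 -> K x0 -> 0 < h x0 ->
  ((t ^+ n)%:E * lam K <= lam (K `&` [set x | (0 < h x)%R]))%E.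
Proof.
move=> t0 t1 Kx0 hx0; rewrite -(lebesgue_rV_homothety x0 t0 mK).
apply: le_measure; rewrite ?inE.
- by rewrite -[X in measurable X]setTI; exact: (measurable_homothety x0 t^-1).
- apply: measurableI => //; rewrite -[X in measurable X]setTI.
  exact: (measurable_fun_ltr (f := cst 0)).
move=> x /=; set z := x0 + _ => Kz.
have xE : x = (1 - t) *: x0 + t *: z.
  rewrite /z scalerDr scalerA mulfV ?gt_eqF// scale1r addrA -scalerDl subrK scale1r.
  by rewrite addrC subrK.
split; first by rewrite xE; apply: sK => //; exact: ltW.
rewrite xE; apply: lt_le_trans (section_radius_concave i0 fB cK sK Kx0 Kz (ltW t0) (ltW t1)).
by rewrite ltr_pwDl ?mulr_ge0 ?(ltW t0)// mulr_gt0// subr_gt0.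
Qed.

(** The limit of the dilation inequality as [t] tends to 1: [1 - t^(n+1) <= (n+1) (1 - t)] produces
    the factor [n+1]. *)
Lemma section_radius_mean x0 : K x0 -> (0 < fine (lam K)) ->
  i.+1%:R * h x0 * fine (lam K) <= n.+1%:R * \int[lam]_(x in K) h x.
Proof.
move=> Kx0 V0; set V := fine (lam K); set M := h x0.
have [hx0|hx0] := leP (h x0) 0.
  have -> : M = 0 by apply/eqP; rewrite eq_le hx0 h0.
  by rewrite mulr0 mul0r mulr_ge0// Rintegral_ge0// => x _.
have Kfin : lam K \is a fin_num by rewrite ge0_fin_numE//; exact: compact_rV_lty.
have mP : measurable (K `&` [set x | (0 < h x)%R]).
  apply: measurableI => //; rewrite -[X in measurable X]setTI.
  exact: (measurable_fun_ltr (f := cst 0)).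
set J := \int[lam]_(x in K) h x.
have JE : I = J%:E by rewrite /J /Rintegral fineK.
(* One factor [t ^+ n] is the Jacobian of the homothety, the other the volume lost to [h = 0]. *)
have key t : 0 < t -> t < 1 ->
    i.+1%:R * M * V * (t ^+ n * t ^+ n) <= n.+1%:R * J.
  move=> t0 t1.
  have := section_radius_dilation_ext t0 t1 Kx0; rewrite JE.
  have Pfin : lam (K `&` [set x | (0 < h x)%R]) \is a fin_num.
    rewrite ge0_fin_numE//; apply: le_lt_trans (compact_rV_lty cK).
    by apply: le_measure; rewrite ?inE// => x [].
  have := section_radius_support t0 t1 Kx0 hx0.
  rewrite -(fineK Pfin) -(fineK Kfin) -/V -EFinM lee_fin.
  set U := fine (lam (K `&` _)) => UV.
  rewrite -!EFinM lee_fin => dil.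
  have t1' : 0 < 1 - t by rewrite subr_gt0.
  have J0 : 0 <= J by apply: Rintegral_ge0 => x _.
  have bern m : 1 - t ^+ m <= m%:R * (1 - t).
    elim: m => [|m IH]; first by rewrite expr0 subrr mul0r.
    rewrite exprS -natr1 mulrDl mul1r.
    have tm1 : t ^+ m <= 1 by rewrite exprn_ile1// ltW.
    have -> : 1 - t * t ^+ m = (1 - t ^+ m) + t ^+ m * (1 - t) by ring.
    by rewrite lerD// ler_piMl// ltW.
  rewrite -(ler_pM2r t1').
  have e1 : i.+1%:R * M * V * (t ^+ n * t ^+ n) * (1 - t) =
    t ^+ n * (i.+1%:R * (1 - t) * M * (t ^+ n * V)) by ring.
  have e2 : t ^+ n * (i.+1%:R * (1 - t) * M * (t ^+ n * V)) <=
    t ^+ n * (i.+1%:R * (1 - t) * M * U).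
    rewrite ler_wpM2l ?exprn_ge0 ?(ltW t0)// ler_wpM2l// mulr_ge0 ?h0//.
    by rewrite mulr_ge0 ?(ltW t1').
  have e3 : t ^+ n * (i.+1%:R * (1 - t) * M * U) <= (1 - t ^+ n.+1) * J.
    move: dil; rewrite mulrDr exprSr => dil.
    have -> : (1 - t ^+ n * t) * J = J - t ^+ n * (t * J) by ring.
    by rewrite lerBrDl.
  rewrite e1; apply: (le_trans e2); apply: (le_trans e3).
  by rewrite [leRHS]mulrAC ler_wpM2r// bern.
set Y := i.+1%:R * M * V; set X := n.+1%:R * J.
have Y0 : 0 <= Y by rewrite !mulr_ge0// ltW.
apply/ler_addgt0Pr => e e0.
(* With [t = 1 - d], Bernoulli bounds the loss by [2 n d Y]; the added 1 in [N] and in [Y + 1] keeps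
   the denominators positive. *)
pose N := (2 * n)%:R + 1 : R.
have N0 : 0 < N by rewrite /N ltr_wpDl.
pose d := Num.min (2^-1) (e / (N * (Y + 1))).
have Y1 : 0 < Y + 1 by rewrite ltr_wpDl.
have NY : 0 < N * (Y + 1) by rewrite mulr_gt0.
have d0 : 0 < d by rewrite lt_min invr_gt0 ltr0n divr_gt0.
have d1 : d <= 2^-1 by rewrite ge_min lexx.
have tt : 0 < 1 - d by rewrite subr_gt0 (le_lt_trans d1)// invf_lt1// ltr1n.
have t1 : 1 - d < 1 by rewrite gtrBl.
have := key (1 - d) tt t1; rewrite -/Y -/X -exprD.
have bern m : 1 - m%:R * d <= (1 - d) ^+ m.
  elim: m => [|m IH]; first by rewrite mul0r subr0 expr0.
  rewrite exprS; apply: le_trans (ler_wpM2l (ltW tt) IH).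
  have -> : (1 - d) * (1 - m%:R * d) = 1 - m.+1%:R * d + m%:R * d ^+ 2.
    by rewrite -natr1; ring.
  by rewrite lerDl mulr_ge0// sqr_ge0.
have b2 := bern (n + n)%N.
have : Y * (1 - (n + n)%:R * d) <= Y * (1 - d) ^+ (n + n) by rewrite ler_wpM2l.
have : Y * ((n + n)%:R * d) <= e.
  have dle : d <= e / (N * (Y + 1)) by rewrite ge_min lexx orbT.
  have : N * (Y + 1) * d <= e by rewrite mulrC -ler_pdivlMr// mulr_gt0.
  apply: le_trans; rewrite mulrA ler_wpM2r ?(ltW d0)//.
  rewrite mulrC ler_pM// ?lerDl//; rewrite /N addnn mul2n lerDl//.
by rewrite mulrBr mulr1; lra.
Qed.

End section_inequality.

Section central_section.
Context {R : realType} {n i : nat}.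
Variables (B : 'M[R]_(i, n)) (K : set 'rV[R]_n).
Hypothesis i0 : (0 < i)%N.
Hypothesis cK : compact K.
Hypothesis sK : segment_closed K.

Let mK : measurable K. Proof. exact: compact_rV_measurable. Qed.

(** The parameter set is invariant under translation by a kernel vector [u] of [B]. Cut into slabs
    along a coordinate where [u] equals 1, it contains arbitrarily many translates of one slab of
    positive measure. *)
Lemma section_volume_degenerate : nbhs (0 : 'rV[R]_n) K -> ~~ row_free B ->
  section_volume B K 0%R = +oo%E.
Proof.
move=> K0 nfB.
have [u [j [uB uj]]] : exists u : 'rV[R]_i, exists j, u *m B = 0 /\ u 0 j = 1.
  pose e := nz_row (kermx B).
  have e0 : e != 0 by rewrite nz_row_eq0 kermx_eq0.
  have eB : e *m B = 0 by apply/sub_kermxP; exact: nz_row_sub.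
  have [j ej] : exists j, e 0 j != 0.
    apply: contrapT => H; case/negP: e0; apply/eqP/rowP => j.
    by rewrite mxE; apply: contrapT => /eqP ej; apply: H; exists j.
  exists ((e 0 j)^-1 *: e), j; rewrite -scalemxAl eB scaler0; split=> //.
  by rewrite mxE mulVf.
pose S := [set e : 'rV[R]_i | K (0 + e *m B)].
have mS : measurable S by exact: measurable_preimage_affine.
pose D (a b : R) := S `&` [set e : 'rV[R]_i | a <= e 0 j < b].
have mD a b : measurable (D a b).
  apply: measurableI => //; rewrite -[X in measurable X]setTI.
  rewrite (_ : [set e : 'rV[R]_i | a <= e 0 j < b] =
    (fun e : 'rV[R]_i => e 0 j) @^-1` `[a, b[%classic); last first.
    by apply/seteqP; split=> e /=; rewrite in_itv.
  by apply: measurable_coord => //; exact: measurable_itv.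
have Dshift (a b c : R) : lebesgue_rV i (D (a + c) (b + c)) = lebesgue_rV i (D a b).
  rewrite -(lebesgue_rV_shift (- c *: u) (mD a b)); congr (lebesgue_rV i _).
  apply/seteqP; split=> e; rewrite /D /S/= mulmxDl -scalemxAl uB scaler0 addr0;
    by rewrite !mxE uj mulr1 lerBrDr ltrBlDr.
have DN (N : nat) : lebesgue_rV i (D 0 N%:R) = (N%:R%:E * lebesgue_rV i (D 0%R 1%R))%E.
  elim: N => [|N IH].
    rewrite mul0e (_ : D 0 0 = set0) ?measure0//.
    by apply/seteqP; split=> // e [_ /= /andP[a /(le_lt_trans a)]]; rewrite ltxx.
  have -> : D 0 N.+1%:R = D 0 N%:R `|` D (0 + N%:R) (1 + N%:R).
    apply/seteqP; split=> e; rewrite /D/= add0r.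
      move=> [Se /andP[a b]]; have [eN|eN] := ltP (e 0 j) N%:R; [left|right].
        by split=> //=; rewrite a.
      by split=> //=; rewrite ?add0r ?eN addrC natr1.
    move=> [[Se /andP[a b]]|[Se /andP[a b]]]; split=> //; apply/andP; split=> //.
    - by rewrite (lt_trans b)// ltr_nat.
    - by rewrite (le_trans _ a).
    - by rewrite -natr1 addrC.
  transitivity (lebesgue_rV i (D 0%R N%:R) +
      lebesgue_rV i (D (0 + N%:R)%R (1 + N%:R)%R))%E.
    apply: measureU => //; apply/seteqP; split=> // e [[_ /= /andP[_ b]]].
    by move=> [_ /= /andP[]]; rewrite add0r leNgt b.
  by rewrite Dshift IH -natr1 EFinD ge0_muleDl// mul1e.
have [r /= r0 rK] := (nbhs_ballP _ _).1 K0.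
have [C [C0 HC]] : exists C : R, 0 < C /\ forall e : 'rV[R]_i, `|e *m B| <= `|e| * C.
  exists (\sum_l \sum_k `|B k l| + 1); split.
    by rewrite ltr_wpDl// sumr_ge0// => l _; rewrite sumr_ge0.
  move=> e; apply: (le_trans (mulmx_norm_le e B)).
  by rewrite ler_wpM2l// lerDl.
have D1 : (0 < lebesgue_rV i (D 0%R 1%R))%E.
  apply: (@nbhs_lebesgue_rV_gt0 _ _ _ (2^-1 *: u)) => //.
  apply/nbhs_ballP; exists (Num.min 2^-1 (r / C)) => /=.
    by rewrite lt_min invr_gt0 ltr0n divr_gt0.
  move=> e; rewrite mx_norm_ball /ball_/= distrC lt_min => /andP[e1 e2]; split.
    rewrite /S/= add0r; apply: rK; rewrite mx_norm_ball /ball_/= sub0r normrN.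
    have -> : e *m B = (e - 2^-1 *: u) *m B by rewrite mulmxBl -scalemxAl uB scaler0 subr0.
    by rewrite (le_lt_trans (HC _))// -ltr_pdivlMr.
  have := le_lt_trans (rV_coord_le _ j) e1; rewrite !mxE uj mulr1.
  by rewrite ltr_norml /= => /andP[a b]; apply/andP; split; lra.
apply/eqP; rewrite eq_le leey/=.
have SD (N : nat) : (N%:R%:E * lebesgue_rV i (D 0%R 1%R) <= lebesgue_rV i S)%E.
  rewrite -DN; apply: le_measure; rewrite ?inE//; last by move=> e [].
have [d d0 dD] : exists2 d : R, 0 < d & (d%:E <= lebesgue_rV i (D 0%R 1%R))%E.
  case: (lebesgue_rV i (D 0%R 1%R)) D1 => [d| |]//.
    by rewrite lte_fin => d0; exists d.
  by exists 1 => //; rewrite leey.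
rewrite /section_volume -/S leNgt; apply/negP => Slty.
have Sfin : lebesgue_rV i S \is a fin_num by rewrite ge0_fin_numE.
pose N := (Num.truncn (fine (lebesgue_rV i S) / d)).+1.
have := SD N; rewrite -(fineK Sfin).
move=> h; have : ((N%:R * d)%:E <= (fine (lebesgue_rV i S))%:E)%E.
  by apply: le_trans h; rewrite EFinM; apply: lee_wpmul2l => //; rewrite lee_fin.
rewrite lee_fin leNgt => /negP; apply.
by rewrite -ltr_pdivrMr//; exact: truncnS_gt.
Qed.

(** [section_radius_mean] and [centroid_jensen] share the integral of [h]. A matrix of deficient
    rank makes the right side infinite, so every value of a random matrix is covered. *)
Lemma section_volume_ge x0 : K° !=set0 -> centroid K = 0 -> K x0 ->
  (((i.+1%:R / n.+1%:R) ^+ i)%:E * section_volume B K x0 <= section_volume B K 0%R)%E.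
Proof.
move=> iK gK Kx0; have K0 := centroid_interior cK sK iK gK.
have [fB|nfB] := boolP (row_free B); last by rewrite section_volume_degenerate// leey.
have V0 := convex_body_lebesgue_gt0 cK iK.
have [b Hb] := section_radius_bounded fB cK.
have J := centroid_jensen cK sK iK gK (measurable_section_radius B cK) Hb
  (section_radius_concave i0 fB cK sK).
have D := section_radius_mean i0 fB cK sK Kx0 V0.
rewrite -(fineK (section_volume_fin fB cK x0)) -(fineK (section_volume_fin fB cK 0)).
rewrite -!section_radiusX// -EFinM lee_fin -exprMn.
apply: lerXn2r; rewrite ?nnegrE ?mulr_ge0 ?divr_ge0 ?section_radius_ge0//.
rewrite mulrAC ler_pdivrMr ?ltr0n// -(ler_pM2r V0); apply: (le_trans D).
by rewrite [leRHS]mulrAC [leRHS]mulrC ler_wpM2l.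
Qed.

End central_section.

(** * Gaussian matrices *)

Section gaussian_line.
Context {R : realType}.
Local Notation mu := (@lebesgue_measure R).

(** The centred normal density of variance 1/2. *)
Definition gauss_density (s : R) : R := gauss_fun s / Num.sqrt pi.

Lemma sqrt_pi_gt0 : 0 < Num.sqrt (pi : R).
Proof. by rewrite sqrtr_gt0 pi_gt0. Qed.

Lemma gauss_density_ge0 s : 0 <= gauss_density s.
Proof. by apply: divr_ge0; [exact: gauss_fun_ge0|exact: sqrtr_ge0]. Qed.

Lemma gauss_densityN s : gauss_density (- s) = gauss_density s.
Proof. by rewrite /gauss_density /gauss_fun sqrrN. Qed.

Lemma measurable_gauss_density : measurable_fun setT gauss_density.
Proof. by apply: measurable_funM => //; exact: measurable_gauss_fun. Qed.

Lemma measurable_gauss_density_EFin :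
  measurable_fun setT (fun s => (gauss_density s)%:E : \bar R).
Proof. by apply/measurable_EFinP; exact: measurable_gauss_density. Qed.

Lemma integral_gauss_density : (\int[mu]_s (gauss_density s)%:E = 1)%E.
Proof.
under eq_integral do rewrite /gauss_density mulrC EFinM.
rewrite ge0_integralZl//; last 2 first.
- by apply/measurable_EFinP; exact: measurable_gauss_fun.
- by move=> s _; rewrite lee_fin gauss_fun_ge0.
by rewrite integralT_gauss -EFinM mulVf// gt_eqF// sqrt_pi_gt0.
Qed.

Lemma gauss_densityM (x y u v : R) : x ^+ 2 + y ^+ 2 = u ^+ 2 + v ^+ 2 ->
  gauss_density x * gauss_density y = gauss_density u * gauss_density v.
Proof.
move=> h; rewrite /gauss_density !mulf_div; congr (_ / _).
rewrite /gauss_fun -!expRD -!opprD. by rewrite h.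
Qed.

(** For independent gaussians, [a X + b Y] has the law of [r X]. The substitution [r u = a x + b y]
    replaces [y]; then [x^2 + y^2 = u^2 + v^2] with [v = (r x - a u) / b], and integrating out [v]
    gives 1. *)
Lemma gauss_density_rotation (a b r : R) (f : R -> \bar R) :
  measurable_fun setT f -> (forall s, 0 <= f s)%E -> 0 <= r ->
  a ^+ 2 + b ^+ 2 = r ^+ 2 ->
  (\int[mu]_x ((gauss_density x)%:E *
     \int[mu]_y ((gauss_density y)%:E * f (a * x + b * y)%R)) =
   \int[mu]_u ((gauss_density u)%:E * f (r * u)%R))%E.
Proof.
move=> mf f0 r0 abr.
have mw := measurable_gauss_density_EFin.
have w0 s : (0 <= (gauss_density s)%:E)%E by rewrite lee_fin gauss_density_ge0.
have mlin (c d : R) : measurable_fun setT (fun s : R => c * s + d).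
  by apply: measurable_funD => //; apply: measurable_funM.
have mflin (c d : R) : measurable_fun setT (fun s : R => f (c * s + d)).
  exact: (measurableT_comp mf (mlin c d)).
(* Solving for [y] divides by [b]. If [b = 0], then [r] is [a] or [- a], and the density is even. *)
have [b0|b0] := eqVneq b 0.
  have -> : (\int[mu]_x ((gauss_density x)%:E *
      \int[mu]_y ((gauss_density y)%:E * f (a * x + b * y)%R)) =
      \int[mu]_x ((gauss_density x)%:E * f (a * x)%R))%E.
    apply: eq_integral => x _; congr (_ * _)%E.
    transitivity (\int[mu]_y ((gauss_density y)%:E * f (a * x)%R))%E.
      by apply: eq_integral => y _; rewrite b0 mul0r addr0.
    by rewrite ge0_integralZr//; rewrite integral_gauss_density mul1e.
  have [a0|a0] := leP 0 a.
    have -> : r = a by apply/eqP; rewrite -(@eqrXn2 _ 2)// -abr b0 expr0n/= addr0.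
    by [].
  have ra : r = - a.
    by apply/eqP; rewrite -(@eqrXn2 _ 2)// ?oppr_ge0 ?ltW// -abr b0 expr0n/= addr0 sqrrN.
  have mg : measurable_fun setT (fun u : R => ((gauss_density u)%:E * f (r * u)%R)%E).
    apply: emeasurable_funM => //; have := mflin r 0.
    by under eq_fun do rewrite addr0.
  rewrite -(ge0_integral_lebesgue_opp mg); last by move=> s; rewrite mule_ge0.
  by apply: eq_integral => x _; rewrite gauss_densityN ra mulrNN.
have r1 : 0 < r.
  rewrite lt_neqAle r0 andbT; apply/eqP => r00.
  have : 0 < a ^+ 2 + b ^+ 2 by rewrite ltr_wpDl ?sqr_ge0// exprn_even_gt0.
  by rewrite abr -r00 expr0n ltxx.
have rb : r / b != 0 by rewrite mulf_neq0 ?invr_neq0// gt_eqF.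
have mF : measurable_fun setT (fun p : R * R =>
    ((gauss_density p.1 * gauss_density ((r * p.2 - a * p.1) / b))%:E * f (r * p.2)%R)%E).
  apply: emeasurable_funM.
    apply/measurable_EFinP; apply: measurable_funM.
      exact: (measurableT_comp measurable_gauss_density measurable_fst).
    apply: (measurableT_comp measurable_gauss_density).
    apply: measurable_funM => //; apply: measurable_funB;
      by apply: measurable_funM.
  by apply: (measurableT_comp mf); apply: measurable_funM.
have F0 p : (0 <= (gauss_density p.1 * gauss_density ((r * p.2 - a * p.1) / b))%:E *
    f (r * p.2)%R)%E.
  by rewrite mule_ge0// lee_fin mulr_ge0// gauss_density_ge0.
transitivity (\int[mu]_x \int[mu]_u (`|r / b|%:E *
   ((gauss_density x * gauss_density ((r * u - a * x) / b))%:E * f (r * u)%R)))%E.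
  apply: eq_integral => x _.
  have mg : measurable_fun setT (fun y : R => ((gauss_density y)%:E * f (a * x + b * y)%R)%E).
    by apply: emeasurable_funM => //; have := mflin b (a * x); under eq_fun do rewrite addrC.
  rewrite -(ge0_integral_lebesgue_affine (- (a * x) / b) rb mg); last first.
    by move=> s; rewrite mule_ge0.
  rewrite -ge0_integralZl//; last 2 first.
  - exact: (measurableT_comp mg (mlin _ _)).
  - by move=> y _; rewrite mule_ge0.
  rewrite -ge0_integralZl//; last 2 first.
  - apply: measurable_funeM; exact: (measurableT_comp mg (mlin _ _)).
  - by move=> y _; rewrite !mule_ge0.
  apply: eq_integral => u _; rewrite muleCA; congr (_ * _)%E.
  have -> : r / b * u + - (a * x) / b = (r * u - a * x) / b by field.
  have -> : a * x + b * ((r * u - a * x) / b) = r * u by field.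
  by rewrite EFinM muleA.
transitivity (\int[mu]_u \int[mu]_x (`|r / b|%:E *
   ((gauss_density x * gauss_density ((r * u - a * x) / b))%:E * f (r * u)%R)))%E.
  apply: (fubini_tonelli (m1 := mu) (m2 := mu) (fun p => `|r / b|%:E *
    ((gauss_density p.1 * gauss_density ((r * p.2 - a * p.1) / b))%:E * f (r * p.2)%R))%E).
    exact: measurable_funeM.
  by move=> p; rewrite mule_ge0.
apply: eq_integral => u _.
have mq : measurable_fun setT (fun x : R => (gauss_density (r / b * x + - (a * u) / b))%:E).
  exact: (measurableT_comp mw (mlin _ _)).
transitivity (\int[mu]_x (((gauss_density u)%:E * f (r * u)%R) *
    (`|r / b|%:E * (gauss_density (r / b * x + - (a * u) / b))%:E)))%E.
  apply: eq_integral => x _.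
  have -> : gauss_density x * gauss_density ((r * u - a * x) / b) =
      gauss_density u * gauss_density (r / b * x + - (a * u) / b).
    apply: gauss_densityM.
    have e1 : ((r * u - a * x) / b) ^+ 2 - (r / b * x + - (a * u) / b) ^+ 2 =
        (r ^+ 2 - a ^+ 2) / b ^+ 2 * (u ^+ 2 - x ^+ 2) by field.
    have e2 : (r ^+ 2 - a ^+ 2) / b ^+ 2 = 1.
      by rewrite -abr addrAC subrr add0r mulfV// expf_neq0.
    by move: e1; rewrite e2 mul1r => /eqP; rewrite subr_eq => /eqP ->; ring.
  by rewrite EFinM [RHS]muleCA; congr (_ * _)%E; rewrite muleAC.
rewrite ge0_integralZl//; last 3 first.
- exact: measurable_funeM.
- by move=> x _; rewrite mule_ge0.
- by rewrite mule_ge0.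
rewrite ge0_integralZl//.
rewrite (ge0_integral_lebesgue_affine _ rb mw w0) integral_gauss_density mule1//.
Qed.

End gaussian_line.

Section gaussian_space.
Context {R : realType}.
Local Notation mu := (@lebesgue_measure R).
Local Notation w := (@gauss_density R).

Definition gauss_rV n (x : 'rV[R]_n) : R := \prod_j w (x 0 j).

Lemma gauss_rV_ge0 n (x : 'rV[R]_n) : 0 <= gauss_rV x.
Proof. by apply: prodr_ge0 => j _; exact: gauss_density_ge0. Qed.

Lemma gauss_rV_cons n s (x : 'rV[R]_n) : gauss_rV (rV_cons (s, x)) = w s * gauss_rV x.
Proof.
rewrite /gauss_rV big_ord_recl rV_cons0; congr (_ * _).
by apply: eq_bigr => j _; rewrite rV_consS.
Qed.

Lemma measurable_gauss_rV n : measurable_fun setT (@gauss_rV n).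
Proof.
apply: measurable_prod => j _.
by apply: (measurableT_comp (@measurable_gauss_density R)); exact: measurable_coord.
Qed.

Lemma measurable_gauss_rV_EFin n :
  measurable_fun setT (fun x : 'rV[R]_n => (gauss_rV x)%:E).
Proof. by apply/measurable_EFinP; exact: measurable_gauss_rV. Qed.

Lemma enorm_cons n s (x : 'rV[R]_n) :
  enorm (rV_cons (s, x)) = Num.sqrt (s ^+ 2 + enorm x ^+ 2).
Proof.
rewrite {1}/enorm big_ord_recl rV_cons0 sqr_sqrtr; last first.
  by apply: sumr_ge0 => j _; exact: sqr_ge0.
by congr (Num.sqrt (_ + _)); apply: eq_bigr => j _; rewrite rV_consS.
Qed.

Lemma enorm_ge0 n (x : 'rV[R]_n) : 0 <= enorm x.
Proof. exact: sqrtr_ge0. Qed.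

Lemma rV_cons_dot n s t (x y : 'rV[R]_n) :
  (rV_cons (s, x) *m (rV_cons (t, y))^T) 0 0 = s * t + (x *m y^T) 0 0.
Proof.
have trE m (z : 'rV[R]_m) j : z^T j 0 = z 0 j by rewrite mxE.
rewrite [LHS]mxE [X in _ = _ + X]mxE big_ord_recl trE !rV_cons0; congr (_ + _).
by apply: eq_bigr => j _; rewrite !trE !rV_consS.
Qed.

Lemma measurable_dot n (e : 'rV[R]_n) :
  measurable_fun setT (fun x : 'rV[R]_n => (e *m x^T) 0 0).
Proof.
under eq_fun do rewrite mxE.
apply: measurable_sum => j; apply: measurable_funM => //.
by under eq_fun do rewrite mxE; exact: measurable_coord.
Qed.

(** Each new coordinate merges with the previous ones by a planar rotation, the norms adding in
    quadrature. *)
Lemma gauss_rV_dot n (e : 'rV[R]_n) (f : R -> \bar R) :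
  measurable_fun setT f -> (forall s, 0 <= f s)%E ->
  (\int[lebesgue_rV n]_x ((gauss_rV x)%:E * f ((e *m x^T) 0%R 0%R)) =
   \int[mu]_u ((w u)%:E * f (enorm e * u)%R))%E.
Proof.
have mw := @measurable_gauss_density_EFin R.
have w0 s : (0 <= (w s)%:E)%E by rewrite lee_fin gauss_density_ge0.
elim: n e f => [|n IH] e f mf f0.
  rewrite integral_rV0; last first.
    apply: emeasurable_funM; first exact: measurable_gauss_rV_EFin.
    exact: (measurableT_comp mf (measurable_dot e)).
  rewrite /gauss_rV big_ord0 mul1e /enorm big_ord0 sqrtr0 mxE big_ord0.
  transitivity (\int[mu]_u ((w u)%:E * f 0%R))%E.
    by rewrite ge0_integralZr//; rewrite integral_gauss_density mul1e.
  by apply: eq_integral => u _; rewrite mul0r.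
have mWf : measurable_fun setT (fun x : 'rV[R]_n.+1 =>
    ((gauss_rV x)%:E * f ((e *m x^T) 0%R 0%R))%E).
  apply: emeasurable_funM; first exact: measurable_gauss_rV_EFin.
  exact: (measurableT_comp mf (measurable_dot e)).
rewrite ge0_integral_rVS//; last first.
  by move=> x; rewrite mule_ge0// lee_fin gauss_rV_ge0.
rewrite -(rV_cons_surj e); set a := e ord0 ord0; set e' := (\row_j _)%R.
have mfs (s : R) : measurable_fun setT (fun v : R => f (a * s + v)).
  by apply: (measurableT_comp mf); apply: measurable_funD.
rewrite -(gauss_density_rotation (a := a) (b := enorm e') mf f0); last 2 first.
- exact: enorm_ge0.
- by rewrite enorm_cons [RHS]sqr_sqrtr// addr_ge0 ?sqr_ge0.
apply: eq_integral => s _.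
rewrite -(IH e' _ (mfs s) (fun v => f0 _)).
rewrite -ge0_integralZl//; last 2 first.
- apply: emeasurable_funM; first exact: measurable_gauss_rV_EFin.
  exact: (measurableT_comp (mfs s) (measurable_dot e')).
- by move=> x _; rewrite mule_ge0// lee_fin gauss_rV_ge0.
by apply: eq_integral => x _; rewrite gauss_rV_cons rV_cons_dot EFinM muleA.
Qed.

Lemma row_mx_cons n m s (x : 'rV[R]_n) (y : 'rV[R]_m) :
  row_mx (rV_cons (s, x)) y = rV_cons (s, row_mx x y) :> 'rV[R]_(n.+1 + m).
Proof.
apply/rowP => j; case: (@split_ordP n.+1 m j) => k ->.
  rewrite row_mxEl; have [k' ->|->] := unliftP ord0 k.
    rewrite rV_consS (_ : lshift m (lift ord0 k') = lift ord0 (lshift m k')); last exact/val_inj.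
    by rewrite rV_consS row_mxEl.
  rewrite rV_cons0 (_ : lshift m ord0 = ord0); last exact/val_inj.
  by rewrite rV_cons0.
rewrite row_mxEr (_ : rshift n.+1 k = lift ord0 (rshift n k)); last exact/val_inj.
by rewrite rV_consS row_mxEr.
Qed.

Lemma measurable_row_mx n m : measurable_fun setT
  (fun p : 'rV[R]_n * 'rV[R]_m => row_mx p.1 p.2).
Proof.
apply: measurable_fun_rV => j; case: (@split_ordP n m j) => k ->.
  under eq_fun do rewrite row_mxEl.
  exact: (measurableT_comp (measurable_coord k) measurable_fst).
under eq_fun do rewrite row_mxEr.
exact: (measurableT_comp (measurable_coord k) measurable_snd).
Qed.

Lemma ge0_integral_row_mx n m (f : 'rV[R]_(n + m) -> \bar R) :
  measurable_fun setT f -> (forall x, 0 <= f x)%E ->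
  (\int[lebesgue_rV (n + m)]_z f z =
   \int[lebesgue_rV n]_x \int[lebesgue_rV m]_y f (row_mx x y))%E.
Proof.
elim: n f => [|n IH] f mf f0.
  have mfr : measurable_fun setT (fun x : 'rV[R]_0 => \int[lebesgue_rV m]_y f (row_mx x y))%E.
    apply: (measurable_fun_fubini_tonelli_F (m2 := lebesgue_rV m)
      (fun p : 'rV[R]_0 * 'rV[R]_m => f (row_mx p.1 p.2))) => //.
    exact: (measurableT_comp mf (@measurable_row_mx 0 m)).
  rewrite [RHS]integral_rV0//; apply: eq_integral => y _; congr f.
  by apply/rowP => j; rewrite -[j in RHS](_ : rshift 0 j = j) ?row_mxEr//; exact/val_inj.
have mfr : measurable_fun setT (fun x : 'rV[R]_n.+1 => \int[lebesgue_rV m]_y f (row_mx x y))%E.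
  apply: (measurable_fun_fubini_tonelli_F (m2 := lebesgue_rV m)
    (fun p : 'rV[R]_n.+1 * 'rV[R]_m => f (row_mx p.1 p.2))) => //.
  exact: (measurableT_comp mf (@measurable_row_mx n.+1 m)).
rewrite (ge0_integral_rVS mfr); last by move=> x; exact: integral_ge0.
rewrite (@ge0_integral_rVS R (n + m) f mf f0); apply: eq_integral => s _.
rewrite (IH (fun z => f (rV_cons (s, z))) (measurable_fun_consr s mf) (fun z => f0 _)).
by apply: eq_integral => x _; apply: eq_integral => y _; rewrite row_mx_cons.
Qed.

(* Each G z maps R^i to R^k; under the weight om, the law of e *m G z is that of
   |e| times a standard gaussian vector. *)
Lemma gaussian_matrix i k : exists N (G : 'rV[R]_N -> 'M[R]_(i, k)) (om : 'rV[R]_N -> R),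
  [/\ forall z, 0 <= om z, measurable_fun setT om,
    (forall a b, measurable_fun setT (fun z => G z a b)) &
    forall (e : 'rV[R]_i) (f : 'rV[R]_k -> \bar R), measurable_fun setT f ->
    (forall x, 0 <= f x)%E ->
    (\int[lebesgue_rV N]_z ((om z)%:E * f (e *m G z)%R) =
     \int[lebesgue_rV k]_c ((gauss_rV c)%:E * f (enorm e *: c)%R))%E].
Proof.
elim: k => [|k [N [G [om [om0 mom mG HG]]]]].
  exists 0%N, (fun=> 0), (fun=> 1); split=> // e f mf f0.
  apply: eq_integral => z _; rewrite /gauss_rV big_ord0; congr (_ * f _)%E.
  by apply/rowP => -[].
(* The induction adds a column made of [i] fresh gaussian coordinates; its product with [e] is a
   single real, of the law given by [gauss_rV_dot]. *)
pose G' (z : 'rV[R]_(i + N)) : 'M[R]_(i, 1 + k) := row_mx (lsubmx z)^T (G (rsubmx z)).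
pose om' (z : 'rV[R]_(i + N)) := gauss_rV (lsubmx z) * om (rsubmx z).
have ml : measurable_fun setT (fun z : 'rV[R]_(i + N) => lsubmx z).
  by apply: measurable_fun_rV => j; under eq_fun do rewrite mxE; exact: measurable_coord.
have mr : measurable_fun setT (fun z : 'rV[R]_(i + N) => rsubmx z).
  by apply: measurable_fun_rV => j; under eq_fun do rewrite mxE; exact: measurable_coord.
have mom' : measurable_fun setT om'.
  apply: measurable_funM; first exact: (measurableT_comp (@measurable_gauss_rV i) ml).
  exact: (measurableT_comp mom mr).
have mG' a b : measurable_fun setT (fun z => G' z a b).
  case: (@split_ordP 1 k b) => j ->; rewrite /G'.
    have := measurableT_comp (measurable_coord a) ml.
    by apply: eq_measurable_fun => z _ /=; rewrite row_mxEl [RHS]mxE (ord1 j).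
  under eq_fun do rewrite row_mxEr.
  exact: (measurableT_comp (mG a j) mr).
have om'0 z : 0 <= om' z by rewrite mulr_ge0// gauss_rV_ge0.
exists (i + N)%N, G', om'; split=> // e f mf f0.
have meG m (H : 'rV[R]_m -> 'M[R]_(i, k.+1)) :
    (forall a b, measurable_fun setT (fun z => H z a b)) ->
    measurable_fun setT (fun z => f (e *m H z)).
  move=> mH; apply: (measurableT_comp mf); apply: measurable_fun_rV => j.
  under eq_fun do rewrite mxE.
  by apply: measurable_sum => a; apply: measurable_funM.
have EG (x : 'rV[R]_i) (y : 'rV[R]_N) :
    e *m G' (row_mx x y) = rV_cons ((e *m x^T) 0 0, e *m G y).
  rewrite /G' row_mxKl row_mxKr (@mul_mx_row _ _ _ 1 k); congr row_mx.
  exact: mx11_scalar.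
have mw := @measurable_gauss_rV_EFin.
have w0 m (x : 'rV[R]_m) : (0 <= (gauss_rV x)%:E)%E by rewrite lee_fin gauss_rV_ge0.
transitivity (\int[lebesgue_rV i]_x ((gauss_rV x)%:E *
    \int[lebesgue_rV N]_y ((om y)%:E * f (rV_cons ((e *m x^T) 0%R 0%R, e *m G y)%R))))%E.
  rewrite ge0_integral_row_mx; last 2 first.
  - by apply: emeasurable_funM; [exact/measurable_EFinP|exact: meG].
  - by move=> z; rewrite mule_ge0// lee_fin.
  apply: eq_integral => x _; rewrite -ge0_integralZl//; last 2 first.
  - apply: emeasurable_funM; first exact/measurable_EFinP.
    apply: (measurableT_comp (measurable_fun_consr _ mf)); apply: measurable_fun_rV => j.
    by under eq_fun do rewrite mxE; apply: measurable_sum => a; apply: measurable_funM.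
  - by move=> y _; rewrite mule_ge0// lee_fin.
  by apply: eq_integral => y _; rewrite EG /om' row_mxKl row_mxKr EFinM muleA.
transitivity (\int[lebesgue_rV i]_x ((gauss_rV x)%:E * \int[lebesgue_rV k]_c
    ((gauss_rV c)%:E * f (rV_cons ((e *m x^T) 0%R 0%R, enorm e *: c)%R))))%E.
  apply: eq_integral => x _; congr (_ * _)%E.
  by rewrite (HG e (fun c => f (rV_cons ((e *m x^T) 0%R 0%R, c))))//; exact: measurable_fun_consr.
have mcs s : measurable_fun setT (fun c : 'rV[R]_k => f (rV_cons (s, enorm e *: c))).
  exact: (measurableT_comp (measurable_fun_consr s mf) (@measurable_fun_scalerV R k _)).
have mprod : measurable_fun [set: measurableTypeR R * 'rV[R]_k]
    (fun p => f (rV_cons (p.1, enorm e *: p.2))).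
  have mpair : measurable_fun [set: measurableTypeR R * 'rV[R]_k]
      (fun p => (p.1, enorm e *: p.2)).
    apply: measurable_fun_pair => //.
    by apply: (measurableT_comp (@measurable_fun_scalerV R k _)); exact: measurable_snd.
  exact: (measurableT_comp (measurable_fun_cons mf) mpair).
(* Exchanging the integrals freezes [c], so that the integrand depends on the new column only
   through its product with [e]. *)
transitivity (\int[lebesgue_rV k]_c ((gauss_rV c)%:E * \int[lebesgue_rV i]_x
    ((gauss_rV x)%:E * f (rV_cons ((e *m x^T) 0%R 0%R, enorm e *: c)%R))))%E.
  transitivity (\int[lebesgue_rV i]_x \int[lebesgue_rV k]_c ((gauss_rV x)%:E *
      ((gauss_rV c)%:E * f (rV_cons ((e *m x^T) 0%R 0%R, enorm e *: c)%R))))%E.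
    apply: eq_integral => x _; rewrite ge0_integralZl//.
    - by apply: emeasurable_funM; [exact: mw|exact: mcs].
    - by move=> c _; rewrite mule_ge0.
  rewrite (fubini_tonelli (m1 := lebesgue_rV i) (m2 := lebesgue_rV k) (fun p =>
    ((gauss_rV p.1)%:E * ((gauss_rV p.2)%:E *
      f (rV_cons ((e *m p.1^T) 0%R 0%R, enorm e *: p.2)%R)))%E)); last 2 first.
  - apply: emeasurable_funM; first exact: (measurableT_comp (@mw i) measurable_fst).
    apply: emeasurable_funM; first exact: (measurableT_comp (@mw k) measurable_snd).
    have mpair : measurable_fun setT (fun p : 'rV[R]_i * 'rV[R]_k =>
        (((e *m p.1^T) 0 0 : measurableTypeR R), p.2)).
      apply: measurable_fun_pair; last exact: measurable_snd.
      exact: (measurableT_comp (measurable_dot e) measurable_fst).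
    exact: (measurableT_comp mprod mpair).
  - by move=> p; rewrite !mule_ge0.
  apply: eq_integral => c _; rewrite -ge0_integralZl//; last 2 first.
  - apply: emeasurable_funM; first exact: mw.
    exact: (measurableT_comp (measurable_fun_consl (enorm e *: c) mf) (measurable_dot e)).
  - by move=> x _; rewrite mule_ge0.
  by apply: eq_integral => x _; rewrite muleCA.
transitivity (\int[lebesgue_rV k]_c \int[mu]_u ((gauss_rV c)%:E *
    ((w u)%:E * f (rV_cons (enorm e * u, enorm e *: c)%R))))%E.
  apply: eq_integral => c _.
  rewrite (gauss_rV_dot e (measurable_fun_consl (enorm e *: c) mf))// -ge0_integralZl//.
  - apply: emeasurable_funM; first exact: measurable_gauss_density_EFin.
    by apply: (measurableT_comp (measurable_fun_consl (enorm e *: c) mf)); apply: measurable_funM.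
  - by move=> u _; rewrite mule_ge0// lee_fin gauss_density_ge0.
have mWf : measurable_fun setT (fun c : 'rV[R]_k.+1 =>
    ((gauss_rV c)%:E * f (enorm e *: c)%R)%E).
  apply: emeasurable_funM; first exact: mw.
  exact: (measurableT_comp mf (@measurable_fun_scalerV R k.+1 _)).
rewrite (ge0_integral_rVS_swap mWf); last by move=> c; rewrite mule_ge0.
apply: eq_integral => c _; apply: eq_integral => u _.
by rewrite gauss_rV_cons rV_consZ [(w u * _)%:E]EFinM -[RHS]muleA muleCA.
Qed.

End gaussian_space.

(** * Radial functions, polar coordinates and dual volumes *)

Section radial_function.
Context {R : realType} {k : nat}.
Variable L : set 'rV[R]_k.
Hypothesis cL : compact L.
Hypothesis L0 : L 0.
Hypothesis starL : forall x t, L x -> 0 <= t -> t <= 1 -> L (t *: x).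

Let radial_set u := [set a : R | 0 <= a /\ L (a *: u)].

Lemma closed_ray u : closed [set a : R | L (a *: u)].
Proof.
have clL : closed L by apply: (compact_closed _ cL); exact: (@norm_hausdorff R 'rV[R]_k).
have /preimage_closed : {in (~` (fun a : R => a *: u) @^-1` L)%classic,
    continuous (fun a : R => a *: u)}.
  move=> a _; apply: cvgZr_tmp => //; exact: cvg_id.
by apply.
Qed.

Lemma radial_has_sup u : u != 0 -> has_sup (radial_set u).
Proof.
move=> u0; split; first by exists 0; split=> //; rewrite scale0r.
have [b [_ Hb]] := compact_bounded cL.
exists ((`|b| + 1) / `|u|) => a [a0 La].
rewrite ler_pdivlMr ?normr_gt0// -[X in X * _](ger0_norm a0) -normrZ.
by apply: Hb => //; rewrite ltr_pwDr// ler_norm.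
Qed.

(** Closedness along the ray makes the supremum a maximum, and the star shape fills the segment
    below it. *)
Lemma radial_leP u a : u != 0 -> 0 <= a -> L (a *: u) <-> a <= radial L u.
Proof.
move=> u0 a0; have hs := radial_has_sup u0; split=> [La|ar].
  by apply: ub_le_sup; [case: hs|split].
suff Lr : L (radial L u *: u).
  have [r0|r0] := leP (radial L u) 0.
    by have -> : a = 0; [apply/eqP; rewrite eq_le a0 (le_trans ar r0)|rewrite scale0r].
  have -> : a *: u = (a / radial L u) *: (radial L u *: u).
    by rewrite scalerA divfK// gt_eqF.
  by apply: starL => //; [rewrite divr_ge0// ltW|rewrite ler_pdivrMr// mul1r].
apply: contrapT => nL; have := @closed_openC _ _ (@closed_ray u).
rewrite openE => /(_ _ nL)/nbhs_ballP[e /= e0 He].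
have [b [b0 Lb] be] := sup_adherent e0 hs.
have bs : b <= radial L u by apply: ub_le_sup; [case: hs|split].
apply: (He b) => //; rewrite /ball/= ger0_norm ?subr_ge0//.
by rewrite ltrBlDl -ltrBlDr.
Qed.

Lemma radial_ge0 u : 0 <= radial L u.
Proof.
(* At [u = 0] every scalar is admissible, and [sup] of an unbounded set is 0 by default. *)
have [->|u0] := eqVneq u 0.
  rewrite /radial sup_out// => -[_ [b Hb]].
  have : `|b| + 1 <= b.
    by apply: Hb; split; [rewrite addr_ge0|rewrite scaler0].
  have := ler_norm b; lra.
by apply/(radial_leP u0) => //; rewrite scale0r.
Qed.

End radial_function.

Lemma measurable_fun_geP d (T : measurableType d) (R : realType) (D : set T) (f : T -> R) :
  measurable D -> (forall a, measurable (D `&` [set x | a <= f x])) ->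
  measurable_fun D f.
Proof.
move=> mD H; apply: (measurability _ (RGenCInfty.measurableE R)) => //.
move=> _ [_ [a ->] <-]; have := H a; congr (measurable (_ `&` _)).
by apply/seteqP; split=> x /=; rewrite in_itv/= andbT.
Qed.

Section direction_radius.
Context {R : realType} {k : nat}.
Variable L : set 'rV[R]_k.
Hypothesis cL : compact L.
Hypothesis L0 : L 0.
Hypothesis starL : forall x t, L x -> 0 <= t -> t <= 1 -> L (t *: x).

(** The radial function extended to be constant along open rays, so that integrals over the sphere
    become integrals over the punctured ball. *)
Definition direction_radius (c : 'rV[R]_k) : R := radial L (normalize c).

Lemma enorm_gt0 (c : 'rV[R]_k) : (0 < enorm c) = (c != 0).
Proof. by rewrite lt_neqAle eq_sym enorm_eq0 sqrtr_ge0 andbT. Qed.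

Lemma enormZ (a : R) (c : 'rV[R]_k) : 0 <= a -> enorm (a *: c) = a * enorm c.
Proof.
move=> a0; rewrite /enorm -[X in X * _](ger0_norm a0) -sqrtr_sqr -sqrtrM ?sqr_ge0//.
by congr Num.sqrt; rewrite mulr_sumr; apply: eq_bigr => j _; rewrite mxE exprMn.
Qed.

Lemma normalize_neq0 (c : 'rV[R]_k) : c != 0 -> normalize c != 0.
Proof.
by move=> c0; rewrite /normalize scaler_eq0 negb_or c0 invr_eq0 enorm_eq0 c0.
Qed.

Lemma enorm_normalize (c : 'rV[R]_k) : c != 0 -> enorm (normalize c) = 1.
Proof.
by move=> c0; rewrite enormZ ?invr_ge0 ?sqrtr_ge0// mulVf// enorm_eq0.
Qed.

Lemma normalizeZ (a : R) (c : 'rV[R]_k) : 0 < a -> normalize (a *: c) = normalize c.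
Proof.
move=> a0; rewrite /normalize enormZ ?(ltW a0)// scalerA invfM mulrAC mulVf ?mul1r//.
by rewrite gt_eqF.
Qed.

Lemma direction_radiusZ (a : R) (c : 'rV[R]_k) : 0 < a ->
  direction_radius (a *: c) = direction_radius c.
Proof. by move=> a0; rewrite /direction_radius normalizeZ. Qed.

Lemma direction_radius_ge0 c : 0 <= direction_radius c.
Proof. exact: radial_ge0. Qed.

Lemma direction_radiusP (c : 'rV[R]_k) (a : R) : c != 0 -> 0 <= a ->
  L (a *: c) <-> a * enorm c <= direction_radius c.
Proof.
move=> c0 a0; have n0 : 0 < enorm c by rewrite enorm_gt0.
rewrite -(radial_leP cL L0 starL (normalize_neq0 c0)) ?mulr_ge0 ?(ltW n0)//.
by rewrite /normalize scalerA mulfK// gt_eqF.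
Qed.

Lemma measurable_direction_radius : measurable_fun setT direction_radius.
Proof.
apply: measurable_fun_geP => // a; rewrite setTI.
have [a0|a0] := leP a 0.
  rewrite (_ : [set _ | _] = setT)//; apply/seteqP; split=> // c _ /=.
  exact: le_trans a0 (direction_radius_ge0 _).
have m1 : measurable [set c : 'rV[R]_k | L (a *: normalize c)].
  have mL := compact_rV_measurable cL.
  rewrite -[X in measurable X]setTI.
  exact: (measurableT_comp (@measurable_fun_scalerV R k a) (@measurable_normalize R k)).
have m0 : measurable [set (0 : 'rV[R]_k)].
  exact: measurable_rV_set1.
(* The origin has to be removed: it satisfies the condition on the right, while its radius is the
   default 0, below [a]. *)
have -> : [set c | a <= direction_radius c] =
    [set c | L (a *: normalize c)] `\` [set 0].
  apply/seteqP; split=> c /=; rewrite /direction_radius.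
    have [->|c0] := eqVneq c 0.
      rewrite /normalize scaler0 /radial sup_out ?leNgt ?a0// => -[_ [b Hb]].
      have : `|b| + 1 <= b.
        by apply: Hb; split; [rewrite addr_ge0|rewrite scaler0].
      by have := ler_norm b; lra.
    by move=> /(radial_leP cL L0 starL (normalize_neq0 c0) (ltW a0)) La; split=> // /eqP; exact/negP.
  move=> [La /eqP c0].
  exact/(radial_leP cL L0 starL (normalize_neq0 c0) (ltW a0)).
exact: measurableD.
Qed.

Lemma direction_radius_bounded : exists2 M : R, 0 <= M &
  forall c, direction_radius c <= M.
Proof.
have [b [_ Hb]] := compact_bounded cL.
exists (k%:R * (`|b| + 1)) => [|c]; first by rewrite mulr_ge0// addr_ge0.
have [->|c0] := eqVneq c 0.
  rewrite /direction_radius /normalize scaler0 /radial sup_out ?mulr_ge0 ?addr_ge0//.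
  move=> -[_ [b' Hb']]; have : `|b'| + 1 <= b'.
    by apply: Hb'; split; [rewrite addr_ge0|rewrite scaler0].
  by have := ler_norm b'; lra.
have La : L (direction_radius c *: normalize c).
  by apply/(radial_leP cL L0 starL (normalize_neq0 c0)) => //; exact: direction_radius_ge0.
have Lb : `|direction_radius c *: normalize c| <= `|b| + 1.
  by apply: Hb => //; rewrite ltr_pwDr// ler_norm.
have : enorm (direction_radius c *: normalize c) <= k%:R * (`|b| + 1).
  apply: (@le_trans _ _ (Num.sqrt ((k%:R * (`|b| + 1)) ^+ 2))); last first.
    by rewrite sqrtr_sqr ger0_norm// mulr_ge0// addr_ge0.
  rewrite ler_wsqrtr// (@le_trans _ _ (\sum_(j < k) (`|b| + 1) ^+ 2))//.
    apply: ler_sum => j _; rewrite -real_normK ?num_real//.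
    by apply: lerXn2r; rewrite ?nnegrE ?addr_ge0// (le_trans (rV_coord_le _ j)).
  rewrite sumr_const card_ord -[X in X <= _]mulr_natl exprMn ler_wpM2r ?sqr_ge0//.
  rewrite -natrX ler_nat; case: (k) => // m; by rewrite expnS leq_pmulr// expn_gt0.
by rewrite enormZ ?direction_radius_ge0// enorm_normalize// mulr1.
Qed.

End direction_radius.

Lemma measurable_funV_ge0 d (T : measurableType d) (R : realType) (f : T -> R) :
  measurable_fun setT f -> (forall x, 0 <= f x) ->
  measurable_fun setT (fun x => (f x)^-1).
Proof.
move=> mf f0; rewrite (_ : (fun _ => _) = (fun x => f x `^ (-1))).
  exact: (measurableT_comp (@measurable_powR _ _) mf).
by apply/funext => x; rewrite powRN powRr1.
Qed.

Section ball_integrals.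
Context {R : realType} {k : nat}.
Local Open Scope ereal_scope.
Local Notation D := (@punctured_ball R k).

Lemma measurable_enorm_itv (I : interval R) :
  measurable [set c : 'rV[R]_k | enorm c \in I].
Proof.
rewrite -[X in measurable X]setTI.
exact: (@measurable_enorm R k _ _ (measurable_itv I)).
Qed.

Lemma ge0_integral_enorm_scale (r : R) (I J : interval R) (f : 'rV[R]_k -> \bar R) :
  (0 < r)%R -> measurable_fun setT f -> (forall c, 0 <= f c) ->
  (forall a : R, ((r * a)%R \in J) = (a \in I)) ->
  \int[lebesgue_rV k]_(c in [set c | enorm c \in J]) f c =
  (r ^+ k)%:E * \int[lebesgue_rV k]_(c in [set c | enorm c \in I]) f (r *: c)%R.
Proof.
move=> r0 mf f0 IJ; rewrite integral_mkcond.
have mJ := measurable_enorm_itv J.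
rewrite -(ge0_integral_rV_scale r0); last 2 first.
- by apply/(measurable_restrictT _ mJ); exact: measurable_funTS.
- by move=> c; apply: erestrict_ge0.
congr (_ * _); rewrite [RHS]integral_mkcond; apply: eq_integral => c _.
rewrite !patchE; congr (if _ then _ else _).
by apply/idP/idP; rewrite !inE/= enormZ ?(ltW r0)// IJ.
Qed.

Lemma punctured_ballE : D = [set c | enorm c \in `]0%R, 1%R]].
Proof. by apply/seteqP; split => c /=; rewrite in_itv. Qed.

Lemma integral_ball_scale (r : R) (f : 'rV[R]_k -> \bar R) : (0 < r)%R ->
  measurable_fun setT f -> (forall c, 0 <= f c) ->
  (forall c, f (r *: c)%R = f c) ->
  \int[lebesgue_rV k]_(c in [set c | enorm c \in `]0%R, r]]) f c =
  (r ^+ k)%:E * \int[lebesgue_rV k]_(c in D) f c.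
Proof.
move=> r0 mf f0 fr; rewrite (@ge0_integral_enorm_scale r `]0%R, 1%R])//; last first.
  move=> a; rewrite !in_itv/= pmulr_rgt0//; congr (_ && _).
  by rewrite -[X in (_ <= X)%R]mulr1 ler_pM2l.
by rewrite punctured_ballE; congr (_ * _); apply: eq_integral => c _.
Qed.

Lemma enorm_coord_le (c : 'rV[R]_k) j : (`|c 0 j| <= enorm c)%R.
Proof.
rewrite -sqrtr_sqr ler_wsqrtr// (bigD1 j)//= lerDl.
by apply: sumr_ge0 => l _; exact: sqr_ge0.
Qed.

Lemma enorm_le_sum (c : 'rV[R]_k) : (enorm c <= \sum_j `|c 0 j|)%R.
Proof.
have s0 : (0 <= \sum_j `|c 0 j|)%R by apply: sumr_ge0.
rewrite -[leRHS](ger0_norm s0) -sqrtr_sqr ler_wsqrtr// expr2 mulr_suml.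
apply: ler_sum => j _; rewrite -real_normK ?num_real// expr2 ler_wpM2l//.
by rewrite (bigD1 j)//= lerDl sumr_ge0.
Qed.

Lemma lebesgue_punctured_ball_lty : lebesgue_rV k D < +oo.
Proof.
apply: (@le_lt_trans _ _ (lebesgue_rV k [set x | (`|x| <= 1)%R])).
  apply: le_measure; rewrite ?inE; [exact: measurable_punctured_ball| |].
    by apply: closed_rV_measurable; exact: closed_norm_le.
  move=> c /andP[_ c1]/=; apply/rV_norm_leP => // j.
  exact: le_trans (enorm_coord_le c j) c1.
by rewrite lebesgue_rV_norm_le// ltry.
Qed.

Lemma lebesgue_punctured_ball_gt0 : (0 < k)%N -> 0 < lebesgue_rV k D.
Proof.
move=> k0; pose e : R := ((2 * k%:R)^-1)%R.
have e0 : (0 < e)%R by rewrite invr_gt0 mulr_gt0// ltr0n.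
apply: (@nbhs_lebesgue_rV_gt0 _ _ _ (const_mx e)); first exact: measurable_punctured_ball.
apply/nbhs_ballP; exists e => // c; rewrite -ball_normE/= => /(rV_norm_ltP _ e0) He.
have ce j : (0 < c 0 j < 2 * e)%R.
  have := He j; rewrite !mxE ltr_norml ltrBrDr => /andP[]; lra.
have c0 : c != 0%R.
  apply/eqP => c0; have := ce (Ordinal k0); rewrite c0 mxE ltxx//.
rewrite /punctured_ball/= enorm_gt0 c0/= (le_trans (enorm_le_sum c))//.
apply: (@le_trans _ _ (\sum_(j < k) 2 * e)%R).
  by apply: ler_sum => j _; have /andP[x0 x1] := ce j; rewrite ger0_norm ltW.
have kn : (k%:R != 0 :> R)%R by rewrite pnatr_eq0 -lt0n.
rewrite sumr_const card_ord -[leLHS]mulr_natr /e (_ : _ * _ = 1)%R//.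
by field.
Qed.

Lemma lebesgue_ball_scale (r : R) : (0 < r)%R ->
  lebesgue_rV k [set c | enorm c \in `]0%R, r]] = (r ^+ k)%:E * lebesgue_rV k D.
Proof.
move=> r0; have := @integral_ball_scale r (cst 1) r0 (measurable_cst _).
rewrite !integral_cst//; [|exact: measurable_punctured_ball|exact: measurable_enorm_itv].
by rewrite !mul1e; apply.
Qed.

End ball_integrals.

(** * Polar coordinates *)

Section polar_coordinates.
Context {R : realType} {k : nat}.
Hypothesis k0 : (0 < k)%N.
Local Open Scope ereal_scope.
Local Notation D := (@punctured_ball R k).
Local Notation lam := (lebesgue_rV k).

Lemma lebesgue_rV_set1_0 : lam [set (0%R : 'rV[R]_k)] = 0.
Proof.
have -> : [set (0%R : 'rV[R]_k)] = [set x | (`|x| <= 0)%R].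
  by apply/seteqP; split=> x /=; [move=> ->; rewrite normr0|rewrite normr_le0 => /eqP].
by rewrite lebesgue_rV_norm_le// mulr0 expr0n gtn_eqF.
Qed.

Section reduction.
Variable H : measurableTypeR R * 'rV[R]_k -> \bar R.
Hypothesis mH : measurable_fun setT H.
Hypothesis H0 : forall p, 0 <= H p.
Hypothesis Hz : forall c, H (0%R, c) = 0.
Hypothesis HZ : forall (a t : R) c, (0 < a)%R -> H (t, a *: c)%R = H (t, c).

Let Psi (c : 'rV[R]_k) := \int[lam]_e H (enorm e, c).

Let mHc : measurable_fun setT (fun p : 'rV[R]_k * 'rV[R]_k => H (enorm p.2, p.1)).
Proof.
apply: (measurableT_comp mH); apply: measurable_fun_pair => //.
exact: (measurableT_comp (@measurable_enorm R k) measurable_snd).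
Qed.

Lemma measurable_polar_section : measurable_fun setT Psi.
Proof.
exact: (measurable_fun_fubini_tonelli_F (m2 := lam)
  (fun p : 'rV[R]_k * 'rV[R]_k => H (enorm p.2, p.1))).
Qed.

(** Writing [lam D] as [|c|^(-k)] times the volume of the ball of radius [|c|] introduces a second
    variable [e]; Tonelli and two rescalings then let [e] carry the norm and [c] only the
    direction. *)
Lemma polar_reduction :
  lam D * \int[lam]_c H (enorm c, c) =
  \int[lam]_(c in [set c | (1 <= enorm c)%R]) (((enorm c ^+ k)^-1 ^+ 2)%:E * Psi c).
Proof.
have menorm := @measurable_enorm R k.
have mH1 : measurable_fun setT (fun c : 'rV[R]_k => H (enorm c, c)).
  by apply: (measurableT_comp mH); exact: measurable_fun_pair.
have mE : measurable_fun setT (fun p : 'rV[R]_k * 'rV[R]_k => enorm p.1).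
  exact: (measurableT_comp menorm measurable_fst).
have mE2 : measurable_fun setT (fun p : 'rV[R]_k * 'rV[R]_k => enorm p.2).
  exact: (measurableT_comp menorm measurable_snd).
have mi (f : 'rV[R]_k * 'rV[R]_k -> R) : measurable_fun setT f ->
    (forall p, 0 <= f p)%R -> measurable_fun setT (fun p => ((f p ^+ k)^-1)%R).
  move=> mf f0; apply: measurable_funV_ge0; first exact: measurable_funX.
  by move=> p; rewrite exprn_ge0.
pose S := [set q : 'rV[R]_k * 'rV[R]_k | (0 < enorm q.2)%R] `&`
  [set q | (enorm q.2 <= enorm q.1)%R].
have mS : measurable S.
  apply: measurableI; rewrite -[X in measurable X]setTI.
    exact: measurable_fun_ltr.
  exact: measurable_fun_ler.
(* Integrating out [e] restores [lam D], by the volume of the ball [0 < |e| <= |c|]. *)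
pose F (p : 'rV[R]_k * 'rV[R]_k) := H (enorm p.1, p.1) *
  ((enorm p.1 ^+ k)^-1 * \1_S p)%R%:E.
have mF : measurable_fun setT F.
  apply: emeasurable_funM.
    apply: (measurableT_comp mH).
    apply: measurable_fun_pair; [exact: mE|exact: measurable_fst].
  apply/measurable_EFinP; apply: measurable_funM.
    by apply: mi => // p; exact: enorm_ge0.
  exact: measurable_indic.
have F0 p : 0 <= F p.
  by rewrite mule_ge0// lee_fin mulr_ge0// invr_ge0 exprn_ge0// enorm_ge0.
pose A := [set p : 'rV[R]_k | (1 <= enorm p)%R].
have mA : measurable A.
  by rewrite -[X in measurable X]setTI; exact: measurable_fun_ler.
(* What [F] becomes under the substitution of [|e| c] for [c]: the condition [|e| <= |c|] turns into
   [1 <= |c|], and the direction of [c] is unchanged. *)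
pose G (p : 'rV[R]_k * 'rV[R]_k) := H ((enorm p.2 * enorm p.1)%R, p.1) *
  ((enorm p.1 ^+ k)^-1 * \1_A p.1)%R%:E.
have mG : measurable_fun setT G.
  apply: emeasurable_funM.
    apply: (measurableT_comp mH); apply: measurable_fun_pair.
      exact: (measurable_funM mE2 mE).
    exact: measurable_fst.
  apply/measurable_EFinP; apply: measurable_funM.
    by apply: mi => // p; exact: enorm_ge0.
  apply: (@measurableT_comp _ _ _ _ _ _ (\1_A : _ -> R)); last exact: measurable_fst.
  exact: measurable_indic.
have G0 p : 0 <= G p.
  by rewrite mule_ge0// lee_fin mulr_ge0// invr_ge0 exprn_ge0// enorm_ge0.
have D0 : 0 <= lam D by exact: measure_ge0.
transitivity (\int[lam]_c \int[lam]_e F (c, e)).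
  rewrite -ge0_integralZl//; apply: eq_integral => c _.
  have [->|c0] := eqVneq c 0%R.
    have e0 : enorm (0%R : 'rV[R]_k) = 0%R by apply/eqP; rewrite enorm_eq0.
    rewrite e0 Hz mule0 integral0_eq// => e _.
    by rewrite /F/= e0 Hz mul0e.
  have ec : (0 < enorm c)%R by rewrite enorm_gt0.
  have me := measurable_enorm_itv (k := k) `]0%R, enorm c].
  have mI : measurable_fun setT (fun e : 'rV[R]_k =>
      (\1_[set e : 'rV[R]_k | enorm e \in `]0%R, enorm c]] e)%:E : \bar R).
    by apply/measurable_EFinP; exact: measurable_indic.
  have -> : (fun e => F (c, e)) = (fun e : 'rV[R]_k =>
      (H (enorm c, c) * ((enorm c ^+ k)^-1)%R%:E) *
      (\1_[set e : 'rV[R]_k | enorm e \in `]0%R, enorm c]] e)%:E).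
    apply/funext => e; rewrite /F/= EFinM muleA; congr (_ * _%:E); apply: indic_congr.
    by rewrite /S/= in_itv/=; split=> [[-> ->]|/andP].
  have cV : 0 <= ((enorm c ^+ k)^-1)%R%:E.
    by rewrite lee_fin invr_ge0 exprn_ge0// enorm_ge0.
  rewrite (ge0_integralZl _ measurableT mI)//; last exact: mule_ge0.
  rewrite integral_indic// setIT [X in _ = _ * X]lebesgue_ball_scale// muleC.
  by rewrite -muleA; congr (_ * _); rewrite muleA -EFinM mulVf ?mul1e// gt_eqF// exprn_gt0.
transitivity (\int[lam]_e \int[lam]_c F (c, e)).
  exact: (fubini_tonelli (m1 := lam) (m2 := lam)).
transitivity (\int[lam]_e \int[lam]_c G (c, e)).
  apply: eq_integral => e _.
  have [->|e0] := eqVneq e 0%R.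
    have e0 : enorm (0%R : 'rV[R]_k) = 0%R by apply/eqP; rewrite enorm_eq0.
    apply: eq_integral => c _; rewrite /F /G/= e0 mul0r Hz mul0e.
    by rewrite indicE memNset ?mulr0 ?mule0// /S/= e0 ltxx => -[].
  have ee : (0 < enorm e)%R by rewrite enorm_gt0.
  have mFe : measurable_fun setT (fun c => F (c, e)).
    by apply: (measurableT_comp mF); exact: measurable_fun_pair.
  rewrite -(ge0_integral_rV_scale ee)// -ge0_integralZl//; last 2 first.
  - exact: (measurableT_comp mFe (@measurable_fun_scalerV R k (enorm e))).
  - by rewrite lee_fin exprn_ge0// ltW.
  apply: eq_integral => c _; rewrite /F /G/= enormZ ?(ltW ee)// HZ// muleCA.
  congr (_ * _); rewrite -EFinM mulrA exprMn invfM mulrA mulfV ?mul1r; last first.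
    by rewrite gt_eqF// exprn_gt0.
  congr (_ * _)%:E; apply: indic_congr; rewrite /S/A/= ee enormZ ?(ltW ee)//.
  by rewrite -[X in (X <= _)%R]mulr1 ler_pM2l//; split=> [[]|].
transitivity (\int[lam]_c \int[lam]_e G (c, e)).
  exact/esym/(fubini_tonelli (m1 := lam) (m2 := lam)).
rewrite [RHS]integral_mkcond; apply: eq_integral => c _; rewrite patchE.
have [/set_mem Ac|nA] := boolP (c \in A); last first.
  by apply: integral0_eq => e _; rewrite /G/= indicE (negbTE nA) mulr0 mule0.
have ec : (0 < enorm c)%R by exact: lt_le_trans Ac.
have mP : measurable_fun setT (fun e : 'rV[R]_k => H (enorm e, c)).
  exact: (measurableT_comp mHc (pair1_measurable c)).
have mP' : measurable_fun setT (fun e : 'rV[R]_k => H (enorm (enorm c *: e)%R, c)).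
  exact: (measurableT_comp mP (@measurable_fun_scalerV R k (enorm c))).
rewrite /Psi -(ge0_integral_rV_scale ec mP)// muleA -EFinM expr2 -mulrA.
rewrite mulVf ?mulr1; last by rewrite gt_eqF// exprn_gt0.
rewrite -ge0_integralZl//; last by rewrite lee_fin invr_ge0 exprn_ge0// ltW.
apply: eq_integral => e _; rewrite /G/= indicE mem_set// mulr1 muleC.
by rewrite enormZ ?(ltW ec)// mulrC.
Qed.

End reduction.

(* Applying the reduction to both sides makes the direction-only constants cancel. *)
Lemma polar_coordinates (H : measurableTypeR R * 'rV[R]_k -> \bar R) :
  measurable_fun setT H -> (forall p, 0 <= H p) -> (forall c, H (0%R, c) = 0) ->
  (forall (a t : R) c, (0 < a)%R -> H (t, a *: c)%R = H (t, c)) ->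
  lam D * \int[lam]_c H (enorm c, c) =
  \int[lam]_(c in D) \int[lam]_e H (enorm e, c).
Proof.
move=> mH H0 Hz HZ; rewrite polar_reduction//.
pose Psi (c : 'rV[R]_k) := \int[lam]_e H (enorm e, c).
have mPsi : measurable_fun setT Psi by exact: measurable_polar_section.
have Psi0 c : 0 <= Psi c by exact: integral_ge0.
(* For this function the inner integral over [e] is [lam D * Psi c], so its reduction contains the
   same integral [X] as that of [H]; the finite positive [lam D] cancels. *)
pose H' (p : measurableTypeR R * 'rV[R]_k) := (\1_(`]0%R, 1%R]%classic) p.1)%:E * Psi p.2.
have m01 : measurable_fun setT (fun t : measurableTypeR R => (\1_(`]0%R, 1%R]%classic) t)%:E : \bar R).
  by apply/measurable_EFinP; exact: measurable_indic.
have mH' : measurable_fun setT H'.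
  apply: emeasurable_funM.
    exact: (measurableT_comp m01 measurable_fst).
  exact: (measurableT_comp mPsi measurable_snd).
have HD c e : H' (enorm e, c) = (\1_D e)%:E * Psi c.
  by rewrite /H'/=; congr (_%:E * _); apply: indic_congr; rewrite /= in_itv.
have ID : \int[lam]_c H' (enorm c, c) = \int[lam]_(c in D) Psi c.
  rewrite [RHS]integral_mkcond; apply: eq_integral => c _; rewrite HD patchE indicE.
  by case: ifPn; rewrite ?mul1e ?mul0e.
have LD : lam D \is a fin_num.
  by rewrite ge0_fin_numE ?measure_ge0// lebesgue_punctured_ball_lty.
have LD0 : fine (lam D) != 0%R.
  by rewrite gt_eqF// fine_gt0// lebesgue_punctured_ball_lty lebesgue_punctured_ball_gt0.
set X := LHS.
have X0 : 0 <= X.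
  apply: integral_ge0 => c _; apply: mule_ge0; last exact: Psi0.
  by rewrite lee_fin exprn_ge0// invr_ge0 exprn_ge0// enorm_ge0.
suff E : lam D * \int[lam]_(c in D) Psi c = lam D * X.
  rewrite -(fineK LD) in E.
  rewrite -[RHS]mul1e -[X]mul1e -(mulVf LD0) EFinM -!muleA.
  by rewrite E.
have mA : measurable [set c : 'rV[R]_k | (1 <= enorm c)%R].
  by rewrite -[X in measurable X]setTI; apply: measurable_fun_ler => //; exact: measurable_enorm.
have mW : measurable_fun [set c : 'rV[R]_k | (1 <= enorm c)%R]
    (fun c => ((enorm c ^+ k)^-1 ^+ 2)%R%:E * Psi c).
  apply: measurable_funTS; apply: emeasurable_funM => //.
  apply/measurable_EFinP; apply: measurable_funX; apply: measurable_funV_ge0.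
    by apply: measurable_funX; exact: measurable_enorm.
  by move=> c; rewrite exprn_ge0// enorm_ge0.
rewrite -ID polar_reduction//.
- rewrite /X -ge0_integralZl//; last first.
    move=> c _; apply: mule_ge0; last exact: Psi0.
    by rewrite lee_fin exprn_ge0// invr_ge0 exprn_ge0// enorm_ge0.
  apply: eq_integral => c _; rewrite [RHS]muleCA; congr (_ * _).
  under eq_integral do rewrite HD.
  have mI : measurable_fun setT (fun e : 'rV[R]_k => (\1_D e)%:E : \bar R).
    apply/measurable_EFinP; apply: measurable_indic; exact: measurable_punctured_ball.
  rewrite (ge0_integralZr _ measurableT mI)//.
  by rewrite integral_indic// ?setIT//; exact: measurable_punctured_ball.
- by move=> p; apply: mule_ge0; [rewrite lee_fin|exact: Psi0].
- by move=> c; rewrite /H'/= indicE memNset ?mul0e//= in_itv/= ltxx.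
- move=> a t c a0; rewrite /H'/=; congr (_ * _).
  by apply: eq_integral => e _; rewrite HZ.
Qed.

End polar_coordinates.

(** * Dual volumes in frame coordinates *)

Section frame_coordinates.
Context {R : realType} {n : nat}.
Variable E : {vspace 'rV[R]_n}.
Local Notation B := (frame E).

Lemma frame_orthonormal : B *m B^T = 1%:M.
Proof. by have [] := frameP E. Qed.

Lemma frame_mem (c : 'rV[R]_(\dim E)) : c *m B \in E.
Proof.
rewrite mulmx_sum_row; apply: memv_suml => j _; apply: memvZ.
by have [_] := frameP E.
Qed.

Lemma frame_inj : injective (fun c : 'rV[R]_(\dim E) => c *m B).
Proof.
move=> c d /(congr1 (mulmx^~ B^T)).
by rewrite -!mulmxA frame_orthonormal !mulmx1.
Qed.

Lemma frame_onto u : (u \in E) = (u *m B^T *m B == u).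
Proof.
apply/idP/eqP => [uE|<-]; last exact: frame_mem.
have key (c : 'rV[R]_(\dim E)) : c *m B *m B^T *m B = c *m B.
  by rewrite -(mulmxA c) frame_orthonormal mulmx1.
pose f := linfun (mulmxr B : 'rV[R]_(\dim E) -> 'rV[R]_n).
have fE w : f w = w *m B by rewrite lfunE.
have : (limg f == E)%VS.
  rewrite eqEdim; apply/andP; split.
    by apply/subvP => _ /memv_imgP[c _ ->]; rewrite fE frame_mem.
  rewrite limg_dim_eq ?dimvf /dim/= ?mul1n//.
  apply/eqP; rewrite -subv0; apply/subvP => c.
  rewrite memv_cap => /andP[_]; rewrite memv_ker fE memv0 => /eqP c0.
  by apply/eqP/frame_inj; rewrite c0 mul0mx.
move=> /eqP fEq; move: uE; rewrite -{1}fEq => /memv_imgP[c _ ->]; rewrite fE.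
exact: key.
Qed.

Lemma enorm_frame (c : 'rV[R]_(\dim E)) : enorm (c *m B) = enorm c.
Proof.
by rewrite !enormE trmx_mul mulmxA -[c *m B *m _]mulmxA frame_orthonormal mulmx1.
Qed.

Lemma normalize_frame (c : 'rV[R]_(\dim E)) :
  normalize (c *m B) = normalize c *m B.
Proof. by rewrite /normalize enorm_frame scalemxAl. Qed.

Lemma measurable_unit_sphere : measurable (unit_sphere E).
Proof.
have -> : unit_sphere E = [set u | enorm u \in `[1, 1]] `&`
    (fun u => \sum_j (u *m B^T *m B - u) 0 j ^+ 2) @^-1` [set 0].
  apply/seteqP; split=> u /=; rewrite in_itv/= -eq_le.
    move=> [uE ->]; split; first exact: eqxx.
    move: uE; rewrite frame_onto => /eqP ->.
    by rewrite big1// => j _; rewrite subrr mxE expr0n.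
  move=> [/eqP u1 u0]; split=> //; rewrite frame_onto -subr_eq0 -enorm_eq0.
  by rewrite /enorm u0 sqrtr0.
apply: measurableI; first exact: measurable_enorm_itv.
rewrite -[X in measurable X]setTI.
have mf : measurable_fun setT (fun u : 'rV[R]_n => \sum_j (u *m B^T *m B - u) 0 j ^+ 2).
  apply: measurable_sum => j; apply: measurable_funX.
  under eq_fun do rewrite mxE [X in _ + X]mxE.
  apply: measurable_funB; last exact: measurable_coord.
  under eq_fun do rewrite -mulmxA.
  exact: (measurableT_comp (measurable_coord j) (measurable_mulmxr _)).
exact: mf.
Qed.

Local Open Scope ereal_scope.

Lemma integral_surface_measure (f : 'rV[R]_n -> \bar R) :
  measurable_fun setT f -> (forall u, 0 <= f u) ->
  \int[surface_measure E]_(u in unit_sphere E) f u =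
  (\dim E)%:R%:E * \int[lebesgue_rV (\dim E)]_(c in @punctured_ball R (\dim E))
     f (normalize c *m B)%R.
Proof.
move=> mf f0; have mS := measurable_unit_sphere; have mN := @measurable_normalize R n.
have mD := measurable_punctured_ball (R := R) (n := n).
pose m1 := [the {measure set 'rV[R]_n -> \bar R} of mrestr (lebesgue_sub E) mD].
pose m2 : {measure set 'rV[R]_n -> \bar R} :=
   measure_function_pushforward__canonical__measure_function_Measure m1 mN.
transitivity (\int[mscale (((\dim E)%:R : R)%:nng)%R m2]_(u in unit_sphere E) f u).
  by apply: eq_measure_integral => A mA _.
have mfS : measurable_fun (unit_sphere E) f by exact: measurable_funTS.
rewrite ge0_integral_mscale//; congr (_ * _).
rewrite [LHS](ge0_integral_pushforward mN)//.
set A := (@normalize R n) @^-1` _.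
have mA : measurable A by rewrite -[X in measurable X]setTI; exact: (@measurable_normalize R n).
have mfN : measurable_fun setT (f \o (@normalize R n)) by exact: measurableT_comp.
have mAD := measurableI _ _ mA mD.
rewrite (@ge0_negligible_integral _ _ _ m1 A (~` punctured_ball) _ (measurableC mD) mA (measurable_funTS mfN))//; last 2 first.
- by move=> x _; exact: f0.
- by rewrite /m1/= /mrestr setICl measure0.
rewrite setDE setCK.
transitivity (\int[lebesgue_sub E]_(x in A `&` punctured_ball) (f \o (@normalize R n)) x).
  apply: eq_measure_integral => X mX XAD; rewrite /m1/= /mrestr setIidl//.
  by apply: subset_trans XAD _ => x [].
rewrite [LHS](ge0_integral_pushforward (measurable_mulmxr (R := R) B))//; last 2 first.
- exact: measurable_funTS.
- by move=> x _; exact: f0.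
rewrite (_ : _ @^-1` _ = @punctured_ball R (\dim E)); last first.
  apply/seteqP; split=> c; rewrite /A /punctured_ball/= enorm_frame; first by case.
  move=> c01; split=> //; have /andP[c0 _] := c01.
  rewrite normalize_frame /unit_sphere/= frame_mem enorm_frame enorm_normalize//.
  by rewrite -enorm_gt0.
by apply: eq_integral => c _; rewrite /= normalize_frame.
Qed.

End frame_coordinates.

Section dual_volume_coordinates.
Context {R : realType} {n : nat}.
Variables (E : {vspace 'rV[R]_n}) (i : nat) (L : set 'rV[R]_n).
Let L' := [set c : 'rV[R]_(\dim E) | L (c *m frame E)].
Hypotheses (cL : compact L') (L0 : L' 0).
Hypothesis starL : forall x t, L' x -> 0 <= t -> t <= 1 -> L' (t *: x).
Hypothesis dE : (0 < \dim E)%N.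

(** The factor [\dim E] in the cone definition of the surface measure cancels the [1/k] of the dual
    volume, and the frame is an isometry. *)
Lemma dual_volumeE : (dual_volume E i L =
  \int[lebesgue_rV (\dim E)]_(c in @punctured_ball R (\dim E))
    (direction_radius L' c ^+ i)%:E)%E.
Proof.
pose f (u : 'rV[R]_n) := ((direction_radius L' (u *m (frame E)^T)) ^+ i)%:E.
have mf : measurable_fun setT f.
  apply/measurable_EFinP; apply: measurable_funX.
  exact: (measurableT_comp (measurable_direction_radius cL L0 starL) (measurable_mulmxr _)).
have f0 u : (0 <= f u)%E.
  by rewrite lee_fin exprn_ge0// direction_radius_ge0.
have KB (c : 'rV[R]_(\dim E)) : c *m frame E *m (frame E)^T = c.
  by rewrite -mulmxA frame_orthonormal mulmx1.
rewrite /dual_volume.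
transitivity ((((\dim E)%:R^-1)%:E *
   \int[surface_measure E]_(u in unit_sphere E) f u)%E).
  congr (_ * _)%E; apply: eq_integral => u; rewrite inE => -[]; rewrite frame_onto => /eqP uE u1.
  rewrite /f; congr ((_ ^+ i)%:E); rewrite /direction_radius /normalize.
  have -> : enorm (u *m (frame E)^T) = 1 by rewrite -enorm_frame uE.
  rewrite invr1 scale1r /radial; congr sup; apply/seteqP.
  by split=> a [a0 La]; split=> //; move: La; rewrite /L'/= -scalemxAl uE.
rewrite integral_surface_measure// muleA -EFinM mulVf ?mul1e; last first.
  by rewrite pnatr_eq0 -lt0n.
apply: eq_integral => c _; rewrite /f KB; congr ((_ ^+ i)%:E).
have [->|c0] := eqVneq c 0; first by rewrite /normalize scaler0.
by rewrite /normalize direction_radiusZ// invr_gt0 enorm_gt0.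
Qed.

End dual_volume_coordinates.

(** * Negative moments of the norm *)

Section negative_moments.
Context {R : realType} {k : nat}.
Hypothesis k0 : (0 < k)%N.
Local Open Scope ereal_scope.
Local Notation D := (@punctured_ball R k).
Local Notation lam := (lebesgue_rV k).

Lemma lebesgue_enorm_le (r : R) : (0 <= r)%R ->
  lam [set c | (enorm c <= r)%R] = (r ^+ k)%:E * lam D.
Proof.
move=> r0; have e0 : enorm (0%R : 'rV[R]_k) = 0%R by apply/eqP; rewrite enorm_eq0.
have -> : [set c : 'rV[R]_k | (enorm c <= r)%R] =
    [set c | enorm c \in `]0%R, r]] `|` [set 0%R].
  apply/seteqP; split=> c /=; rewrite in_itv/=.
    by have [->|c0] := eqVneq c 0%R; [right|rewrite enorm_gt0 c0; left].
  by move=> [/andP[]//|->]; rewrite e0.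
have m0 : measurable [set (0%R : 'rV[R]_k)].
  exact: measurable_rV_set1.
rewrite measureU//; last 2 first.
- exact: measurable_enorm_itv.
- by apply/seteqP; split=> // c []/=; rewrite in_itv/= => /andP[+ _] c0; rewrite c0 e0 ltxx.
rewrite [X in _ + X]lebesgue_rV_set1_0// adde0.
have [->|rn] := eqVneq r 0%R.
  rewrite expr0n gtn_eqF// mul0e (_ : [set _ | _] = set0) ?measure0//.
  by apply/seteqP; split=> // c /=; rewrite in_itv/= => /andP[/lt_le_trans/[apply]]; rewrite ltxx.
by apply: lebesgue_ball_scale; rewrite lt_neqAle eq_sym rn.
Qed.

Variable m : nat.
Hypothesis mk : (m < k)%N.

Lemma measurable_enormXV : measurable_fun setT (fun c : 'rV[R]_k => ((enorm c ^+ m)^-1)%R).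
Proof.
apply: measurable_funV_ge0; first by apply: measurable_funX; exact: measurable_enorm.
by move=> c; rewrite exprn_ge0// enorm_ge0.
Qed.

(** A self-similarity bound: the half ball, rescaled, contributes at most [2^(m-k) <= 1/2] of the
    whole integral, and the outer shell at most [2^m lam D]. Truncating at [a] makes the integral
    finite, so that the half can be absorbed. *)
Lemma negative_moment_truncated (a : R) : (0 <= a)%R ->
  \int[lam]_(c in D) (Num.min ((enorm c ^+ m)^-1) a)%:E <= (2 ^+ m.+1)%:E * lam D.
Proof.
move=> a0; set f := fun c : 'rV[R]_k => (Num.min ((enorm c ^+ m)^-1) a)%:E.
have f0 c : 0 <= f c by rewrite lee_fin le_min a0 andbT invr_ge0 exprn_ge0// enorm_ge0.
have mf : measurable_fun setT f.
  by apply/measurable_EFinP; apply: measurable_minr => //; exact: measurable_enormXV.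
have mf2 : measurable_fun setT (fun c : 'rV[R]_k => f (2^-1 *: c)%R).
  exact: (measurableT_comp mf (@measurable_fun_scalerV R k (2^-1)%R)).
have mD := measurable_punctured_ball (R := R) (n := k).
pose S (I : interval R) := [set c : 'rV[R]_k | enorm c \in I].
have mS I : measurable (S I) by exact: measurable_enorm_itv.
have DE : D = S `]0%R, 2^-1%R] `|` S `]2^-1%R, 1%R].
  apply/seteqP; split=> c; rewrite punctured_ballE /S/= !in_itv/=.
    by move=> /andP[-> ->]; case: leP; [left|right].
  by move=> [|] /andP[c0 c1]; apply/andP; split; lra.
have Ifin : \int[lam]_(c in D) f c \is a fin_num.
  rewrite ge0_fin_numE; last exact: integral_ge0.
  apply: (@le_lt_trans _ _ (\int[lam]_(c in D) (cst a%:E) c)).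
    apply: ge0_le_integral => //; first exact: measurable_funTS.
    by move=> c _; rewrite lee_fin ge_min lexx orbT.
  rewrite integral_cst//.
  by rewrite lte_mul_pinfty// lebesgue_punctured_ball_lty.
have H1 : \int[lam]_(c in S `]2^-1%R, 1%R]) f c <= (2 ^+ m)%:E * lam D.
  rewrite -integral_cst//; apply: (@le_trans _ _ (\int[lam]_(c in S `]2^-1%R, 1%R]) (cst (2 ^+ m)%:E) c)).
    apply: ge0_le_integral => //; first exact: measurable_funTS.
    move=> c; rewrite /S/= in_itv/= => /andP[c0 c1].
    rewrite lee_fin ge_min; apply/orP; left.
    by rewrite -exprVn; apply: lerXn2r; rewrite ?nnegrE ?invr_ge0 ?enorm_ge0//
      -[leRHS]invrK lef_pV2 ?posrE ?(ltW c0)// (lt_trans _ c0).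
  apply: ge0_subset_integral => //.
    by move=> c _; rewrite lee_fin exprn_ge0.
  by rewrite DE => c ?; right.
have H2 : \int[lam]_(c in S `]0%R, 2^-1%R]) f c <= 2^-1%:E * \int[lam]_(c in D) f c.
  rewrite (@ge0_integral_enorm_scale _ _ 2^-1 `]0%R, 1%R])//; last first.
    by move=> b; rewrite !in_itv/= pmulr_rgt0// ler_pdivrMl// mulfV.
  rewrite -punctured_ballE.
  apply: (@le_trans _ _ (((2^-1) ^+ k)%:E * \int[lam]_(c in D) ((2 ^+ m)%:E * f c))).
    apply: lee_wpmul2l; first by rewrite lee_fin exprn_ge0.
    apply: ge0_le_integral => //.
    - exact: measurable_funTS.
    - by apply: measurable_funTS; apply: emeasurable_funM.
    move=> c _; rewrite -EFinM lee_fin enormZ// minr_pMr ?exprn_ge0//.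
    rewrite exprMn invfM exprVn invrK le_min !ge_min lexx/=.
    by apply/orP; right; rewrite -[leLHS]mul1r ler_wpM2r// exprn_ege1// ler1n.
  rewrite ge0_integralZl//; [|exact: measurable_funTS].
  rewrite muleA -EFinM; apply: lee_wpmul2r; first exact: integral_ge0.
  rewrite lee_fin exprVn ler_pdivrMl ?exprn_gt0// ler_pdivlMr// -exprSr.
  by rewrite ler_weXn2l// ler1n.
have LD : lam D \is a fin_num.
  by rewrite ge0_fin_numE ?measure_ge0// lebesgue_punctured_ball_lty.
have := leeD H2 H1.
rewrite -ge0_integral_setU//; last 2 first.
- exact: measurable_funTS.
- rewrite disj_set2E; apply/eqP/seteqP; split=> // c [].
  by rewrite /S/= !in_itv/= => /andP[_ c1] /andP[/(le_lt_trans c1)]; rewrite ltxx.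
rewrite -DE -(fineK Ifin) -(fineK LD) -!EFinM -EFinD !lee_fin exprS.
move=> H; rewrite -mulrA; move: H; set y := (2 ^+ m * _)%R; set x := fine (integral _ _ _); lra.
Qed.

Lemma negative_moment_lty :
  \int[lam]_(c in D) ((enorm c ^+ m)^-1)%:E < +oo.
Proof.
apply: (@le_lt_trans _ _ ((2 ^+ m.+1)%:E * lam D)); last first.
  by rewrite lte_mul_pinfty// lebesgue_punctured_ball_lty.
pose f (a : nat) := fun c : 'rV[R]_k => (Num.min ((enorm c ^+ m)^-1) a%:R)%:E.
have f0 a c : 0 <= f a c.
  by rewrite lee_fin le_min ler0n andbT invr_ge0 exprn_ge0// enorm_ge0.
have mf a : measurable_fun setT (f a).
  by apply/measurable_EFinP; apply: measurable_minr => //; exact: measurable_enormXV.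
have mD := measurable_punctured_ball (R := R) (n := k).
have -> : \int[lam]_(c in D) ((enorm c ^+ m)^-1)%:E =
    \int[lam]_(c in D) limn (f ^~ c).
  apply: eq_integral => c _; apply/esym/cvg_lim => //.
  apply: cvg_near_cst; near=> a; congr (_%:E); apply/min_idPl.
  near: a; exact: nbhs_infty_ger.
rewrite monotone_convergence//; last 2 first.
- by move=> a; exact: measurable_funTS.
- move=> c _ a b ab; rewrite lee_fin le_min ge_min lexx/= ge_min.
  by rewrite ler_nat ab orbT.
apply: lime_le.
  apply: ereal_nondecreasing_is_cvgn => a b ab; apply: ge0_le_integral => //.
  - exact: measurable_funTS.
  - exact: measurable_funTS.
  - move=> c _; rewrite lee_fin le_min ge_min lexx/= ge_min.
    by rewrite ler_nat ab orbT.
by apply: nearW => a; exact: negative_moment_truncated.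
Unshelve. all: end_near. Qed.

End negative_moments.

Section star_integrals.
Context {R : realType} {k : nat}.
Hypothesis k0 : (0 < k)%N.
Variable L : set 'rV[R]_k.
Hypotheses (cL : compact L) (L0 : L 0).
Hypothesis starL : forall x t, L x -> 0 <= t -> t <= 1 -> L (t *: x).
Variables i m : nat.
Local Notation D := (@punctured_ball R k).
Local Notation lam := (lebesgue_rV k).
Local Notation rho := (direction_radius L).

Lemma starP c : c != 0 -> L c <-> enorm c <= rho c.
Proof.
by move=> c0; have := direction_radiusP cL L0 starL c0 ler01; rewrite scale1r mul1r.
Qed.

Local Open Scope ereal_scope.

Lemma measurable_direction_radiusX :
  measurable_fun setT (fun c : 'rV[R]_k => (rho c ^+ i)%:E).
Proof.
apply/measurable_EFinP; apply: measurable_funX.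
exact: measurable_direction_radius.
Qed.

Lemma negative_moment_ball (r : R) : (0 < i)%N -> (i + m = k)%N -> (0 <= r)%R ->
  \int[lam]_(c in [set c : 'rV[R]_k | enorm c \in `]0%R, r]]) ((enorm c ^+ m)^-1)%:E =
  (r ^+ i)%:E * \int[lam]_(c in D) ((enorm c ^+ m)^-1)%:E.
Proof.
move=> i0 imk; rewrite le_eqVlt => /predU1P[<-|r0].
  rewrite (_ : [set _ | _] = set0); last first.
    by apply/seteqP; split=> // c /=; rewrite in_itv/= => /andP[/lt_le_trans/[apply]]; rewrite ltxx.
  by rewrite integral_set0 expr0n gtn_eqF// mul0e.
have mW : measurable_fun setT (fun c : 'rV[R]_k => ((enorm c ^+ m)^-1)%:E).
  by apply/measurable_EFinP; exact: measurable_enormXV.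
have W0 (c : 'rV[R]_k) : 0 <= ((enorm c ^+ m)^-1)%:E.
  by rewrite lee_fin invr_ge0 exprn_ge0// enorm_ge0.
rewrite (@ge0_integral_enorm_scale R k r `]0%R, 1%R])//; last first.
  move=> a; rewrite !in_itv/= pmulr_rgt0//; congr (_ && _).
  by rewrite -[X in (_ <= X)%R]mulr1 ler_pM2l.
rewrite punctured_ballE.
have mD : measurable [set c : 'rV[R]_k | enorm c \in `]0%R, 1%R]].
  exact: measurable_enorm_itv.
rewrite (eq_integral (fun c => ((r ^+ m)^-1)%:E * ((enorm c ^+ m)^-1)%:E)); last first.
  by move=> c _; rewrite enormZ ?(ltW r0)// exprMn invfM EFinM.
rewrite ge0_integralZl//; last 2 first.
- exact: measurable_funTS.
- by rewrite lee_fin invr_ge0 exprn_ge0// ltW.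
rewrite muleA -EFinM -imk exprD -mulrA mulfV ?mulr1//.
by rewrite gt_eqF// exprn_gt0.
Qed.

(** Polar coordinates for [t^(-m)] restricted to [0 < t <= rho c]. This is the formula for the dual
    volume as an integral of [|y|^(-k+i)]; the factor [i/k] appears as the quotient of [lam D] by
    the moment of the ball. *)
Lemma star_moment : (0 < i)%N -> (i + m = k)%N ->
  lam D * \int[lam]_(c in L) ((enorm c ^+ m)^-1)%:E =
  (\int[lam]_(c in D) ((enorm c ^+ m)^-1)%:E) * \int[lam]_(c in D) (rho c ^+ i)%:E.
Proof.
move=> i0 imk.
have mrho := measurable_direction_radius cL L0 starL.
pose S := [set p : measurableTypeR R * 'rV[R]_k | (0 < p.1)%R] `&` [set p | (p.1 <= rho p.2)%R].
have mS : measurable S.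
  apply: measurableI; rewrite -[X in measurable X]setTI.
    exact: measurable_fun_ltr.
  apply: measurable_fun_ler => //.
  exact: (measurableT_comp mrho measurable_snd).
pose H (p : measurableTypeR R * 'rV[R]_k) := ((p.1 ^+ m)^-1 * \1_S p)%:E.
(* The absolute value makes the base nonnegative, as the measurability of its inverse requires, and
   changes nothing on [S], where [t > 0]. *)
have HE t c : H (t, c) = ((`|t| ^+ m)^-1 * \1_S (t, c))%:E.
  rewrite /H/= indicE; have [St|/negbTE nS] := boolP ((t, c) \in S).
    by move: St; rewrite inE => -[/= t0 _]; rewrite gtr0_norm.
  by rewrite !mulr0.
have mH : measurable_fun setT H.
  rewrite (_ : H = fun p => ((`|p.1| ^+ m)^-1 * \1_S p)%:E); last by apply/funext => -[].
  apply/measurable_EFinP; apply: measurable_funM; last exact: measurable_indic.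
  apply: measurable_funV_ge0; last by move=> p; rewrite exprn_ge0.
  apply: measurable_funX; apply: measurableT_comp => //.
have H0 p : 0 <= H p.
  by case: p => t c; rewrite HE lee_fin mulr_ge0// invr_ge0 exprn_ge0.
have Hz c : H (0%R, c) = 0.
  by rewrite /H/= indicE memNset ?mulr0// /S/= ltxx => -[].
have HZ (a t : R) c : (0 < a)%R -> H (t, a *: c)%R = H (t, c).
  move=> a0; rewrite /H/=; congr (_ * _)%:E; apply: indic_congr.
  by rewrite /S/= direction_radiusZ.
have W0 (c : 'rV[R]_k) : 0 <= ((enorm c ^+ m)^-1)%:E.
  by rewrite lee_fin invr_ge0 exprn_ge0// enorm_ge0.
have mW : measurable_fun setT (fun c : 'rV[R]_k => ((enorm c ^+ m)^-1)%:E).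
  by apply/measurable_EFinP; exact: measurable_enormXV.
have m0 : measurable [set (0%R : 'rV[R]_k)].
  exact: measurable_rV_set1.
have mL := compact_rV_measurable cL.
have mD := measurable_punctured_ball (R := R) (n := k).
have := polar_coordinates k0 mH H0 Hz HZ.
have -> : \int[lam]_c H (enorm c, c) = \int[lam]_(c in L) ((enorm c ^+ m)^-1)%:E.
  rewrite (@ge0_negligible_integral _ _ _ lam L [set 0%R] _ m0 mL (measurable_funTS mW))//; last first.
    exact: lebesgue_rV_set1_0.
  rewrite [RHS]integral_mkcond; apply: eq_integral => c _; rewrite patchE /H/= indicE.
  rewrite (_ : ((enorm c, c) \in S) = (c \in L `\` [set 0%R])).
    by case: (c \in _); rewrite ?mulr1 ?mulr0.
  apply/idP/idP; rewrite !inE /S/= enorm_gt0.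
    by move=> [c0 ?]; split; [exact/(starP c0)|exact/eqP].
  by move=> [Lc /eqP c0]; split=> //; exact/(starP c0).
move=> ->; rewrite -ge0_integralZl//; last 3 first.
- by apply: measurable_funTS; exact: measurable_direction_radiusX.
- by move=> c _; rewrite lee_fin exprn_ge0// direction_radius_ge0.
- by apply: integral_ge0.
apply: eq_integral => c _; rewrite muleC -negative_moment_ball ?direction_radius_ge0//.
rewrite [RHS]integral_mkcond; apply: eq_integral => e _; rewrite patchE /H/= indicE.
rewrite (_ : ((enorm e, c) \in S) = (e \in [set c0 : 'rV[R]_k | enorm c0 \in `]0%R, rho c]])).
  by case: (e \in _); rewrite ?mulr1 ?mulr0.
by apply/idP/idP; rewrite !inE /S/= in_itv/=; [move=> [-> ->]|move/andP].
Qed.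

Lemma gauss_rV_enorm (c : 'rV[R]_k) :
  gauss_rV c = (gauss_fun (enorm c) / Num.sqrt pi ^+ k)%R.
Proof.
rewrite /gauss_rV /gauss_density prodf_div prodr_const card_ord; congr (_ / _)%R.
rewrite /gauss_fun -expR_sum; congr expR.
by rewrite sqr_sqrtr ?sumrN// sumr_ge0// => j _; exact: sqr_ge0.
Qed.

Definition gauss_moment : \bar R :=
  \int[lam]_c ((gauss_rV c)%:E * ((enorm c ^+ i)^-1)%:E).

(** For [c] nonzero, the [e] with [|e| c] in [L] form a ball of R^i of radius [rho c / |c|]. Its
    volume splits into a power of [|c|], which polar coordinates send to the constant, and
    [rho c ^+ i]. *)
Lemma star_gauss : (0 < i)%N ->
  lam D * \int[lam]_c ((gauss_rV c)%:E *
     lebesgue_rV i [set e : 'rV[R]_i | L (enorm e *: c)%R]) =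
  (lebesgue_rV i (@punctured_ball R i) * gauss_moment) *
  \int[lam]_(c in D) (rho c ^+ i)%:E.
Proof.
move=> i0; have mrho := measurable_direction_radius cL L0 starL.
set b := lebesgue_rV i _.
have b0 : 0 <= b by exact: measure_ge0.
pose H (p : measurableTypeR R * 'rV[R]_k) :=
  ((gauss_fun p.1 / Num.sqrt pi ^+ k) * ((`|p.1| ^+ i)^-1 * rho p.2 ^+ i))%R%:E * b.
have pi0 : (0 <= Num.sqrt (pi : R) ^+ k)%R by rewrite exprn_ge0// sqrtr_ge0.
have mH : measurable_fun setT H.
  apply: emeasurable_funM => //; apply/measurable_EFinP; apply: measurable_funM.
    apply: measurable_funM => //.
    exact: (measurableT_comp (@measurable_gauss_fun R) measurable_fst).
  apply: measurable_funM.
    apply: measurable_funV_ge0; last by move=> p; rewrite exprn_ge0.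
    by apply: measurable_funX; exact: measurableT_comp.
  apply: measurable_funX; exact: (measurableT_comp mrho measurable_snd).
have H0 p : 0 <= H p.
  rewrite mule_ge0// lee_fin mulr_ge0//.
    by rewrite divr_ge0// gauss_fun_ge0.
  by rewrite mulr_ge0// ?invr_ge0 exprn_ge0// direction_radius_ge0.
have Hz c : H (0%R, c) = 0.
  by rewrite /H/= normr0 expr0n gtn_eqF// invr0 mul0r mulr0 mul0e.
have HZ (a t : R) c : (0 < a)%R -> H (t, a *: c)%R = H (t, c).
  by move=> a0; rewrite /H/= direction_radiusZ.
have m0 : measurable [set (0%R : 'rV[R]_k)].
  exact: measurable_rV_set1.
have mD := measurable_punctured_ball (R := R) (n := k).
have HE (c e : 'rV[R]_k) : H (enorm e, c) =
    ((gauss_rV e)%:E * ((enorm e ^+ i)^-1)%:E) * (b * (rho c ^+ i)%:E).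
  rewrite /H/= ger0_norm ?enorm_ge0// -gauss_rV_enorm !EFinM.
  by rewrite -!muleA; congr (_ * (_ * _)); rewrite muleC.
have mG := @measurable_gauss_rV_EFin R k.
have := polar_coordinates k0 mH H0 Hz HZ.
have -> : \int[lam]_c H (enorm c, c) = \int[lam]_c ((gauss_rV c)%:E *
     lebesgue_rV i [set e : 'rV[R]_i | L (enorm e *: c)%R]).
  have mV : measurable_fun setT (fun c : 'rV[R]_k => (gauss_rV c)%:E *
      lebesgue_rV i [set e : 'rV[R]_i | L (enorm e *: c)%R]).
    apply: emeasurable_funM => //.
    pose S := [set p : 'rV[R]_k * 'rV[R]_i | L (enorm p.2 *: p.1)%R].
    have mS : measurable S.
      rewrite -[X in measurable X]setTI; apply: (_ : measurable_fun setT
        (fun p : 'rV[R]_k * 'rV[R]_i => (enorm p.2 *: p.1)%R)) => //; last exact: compact_rV_measurable.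
      apply: measurable_fun_rV => j; under eq_fun do rewrite mxE.
      apply: measurable_funM.
        exact: (measurableT_comp (@measurable_enorm R i) measurable_snd).
      exact: (measurableT_comp (measurable_coord j) measurable_fst).
    have := measurable_fun_xsection (lebesgue_rV i) mS.
    by apply: eq_measurable_fun => c _; rewrite /xsection; congr (lebesgue_rV i _);
      apply/seteqP; split=> e; rewrite /= inE.
  have V0 (c : 'rV[R]_k) : 0 <= (gauss_rV c)%:E *
      lebesgue_rV i [set e : 'rV[R]_i | L (enorm e *: c)%R].
    by rewrite mule_ge0// lee_fin gauss_rV_ge0.
  have mH' : measurable_fun setT (fun c : 'rV[R]_k => H (enorm c, c)).
    by apply: (measurableT_comp mH); apply: measurable_fun_pair => //; exact: measurable_enorm.
  have l0 := @lebesgue_rV_set1_0 R k k0.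
  rewrite (@ge0_negligible_integral _ _ _ lam setT [set 0%R] _ m0 measurableT mH')//.
  rewrite [RHS](@ge0_negligible_integral _ _ _ lam setT [set 0%R] _ m0 measurableT mV)//.
  apply: eq_integral => c; rewrite inE => -[_ /eqP c0].
  rewrite HE -muleA; congr (_ * _).
  have ec : (0 < enorm c)%R by rewrite enorm_gt0.
  rewrite muleCA -EFinM -exprVn -exprMn muleC mulrC -lebesgue_enorm_le//; last first.
    by rewrite divr_ge0 ?direction_radius_ge0// ltW.
  congr (lebesgue_rV i _); apply/seteqP; split=> e /=; rewrite ler_pdivlMr//.
    by move=> ?; apply/(direction_radiusP cL L0 starL c0) => //; exact: enorm_ge0.
  by move/(direction_radiusP cL L0 starL c0 (enorm_ge0 e)).
move=> ->.
have mA : measurable_fun setT (fun e : 'rV[R]_k => (gauss_rV e)%:E * ((enorm e ^+ i)^-1)%:E).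
  by apply: emeasurable_funM => //; apply/measurable_EFinP; exact: measurable_enormXV.
have A0 (e : 'rV[R]_k) : 0 <= (gauss_rV e)%:E * ((enorm e ^+ i)^-1)%:E.
  by rewrite mule_ge0// lee_fin ?gauss_rV_ge0// invr_ge0 exprn_ge0// enorm_ge0.
have r0 c : (0 <= (rho c ^+ i)%:E) by rewrite lee_fin exprn_ge0// direction_radius_ge0.
have gm0 : 0 <= gauss_moment by exact: integral_ge0.
rewrite -ge0_integralZl//; last 2 first.
- by apply: measurable_funTS; exact: measurable_direction_radiusX.
- exact: mule_ge0.
apply: eq_integral => c _; under eq_integral do rewrite HE.
rewrite (ge0_integralZr _ measurableT mA)//; last exact: mule_ge0.
by rewrite muleA; congr (_ * _); rewrite muleC.
Qed.

Lemma gauss_moment_gt0 : 0 < gauss_moment.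
Proof.
have mA : measurable_fun setT (fun e : 'rV[R]_k => (gauss_rV e)%:E * ((enorm e ^+ i)^-1)%:E).
  apply: emeasurable_funM; first exact: measurable_gauss_rV_EFin.
  by apply/measurable_EFinP; exact: measurable_enormXV.
have A0 (e : 'rV[R]_k) : 0 <= (gauss_rV e)%:E * ((enorm e ^+ i)^-1)%:E.
  by rewrite mule_ge0// lee_fin ?gauss_rV_ge0// invr_ge0 exprn_ge0// enorm_ge0.
have mD := measurable_punctured_ball (R := R) (n := k).
have p0 : (0 < Num.sqrt (pi : R) ^+ k)%R by rewrite exprn_gt0// sqrt_pi_gt0.
have g0 : (0 < expR (-1) / Num.sqrt (pi : R) ^+ k)%R by rewrite divr_gt0// expR_gt0.
apply: (@lt_le_trans _ _ (\int[lam]_(c in D) (cst (expR (-1) / Num.sqrt (pi : R) ^+ k)%:E) c)).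
  rewrite integral_cst// mule_gt0//.
  exact: lebesgue_punctured_ball_gt0.
apply: (@le_trans _ _ (\int[lam]_(c in D) ((gauss_rV c)%:E * ((enorm c ^+ i)^-1)%:E))).
  apply: ge0_le_integral => //.
  - by move=> c _; rewrite lee_fin ltW.
  - exact: measurable_funTS.
  move=> c /andP[c0 c1]; rewrite gauss_rV_enorm -EFinM lee_fin -[leLHS]mulr1.
  apply: ler_pM => //.
    rewrite ler_pM2r ?invr_gt0// ler_expR lerN2.
    by rewrite expr_le1 ?enorm_ge0.
  by rewrite invf_ge1 ?exprn_gt0// exprn_ile1 ?enorm_ge0.
exact: ge0_subset_integral.
Qed.

(** Near the origin [|c|^(-i)] is integrable because [i < k]; away from it the gaussian weight
    suffices. At [i = k] the integral diverges, hence the separate treatment of that case. *)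
Lemma gauss_moment_lty : (i < k)%N -> gauss_moment < +oo.
Proof.
move=> ik.
have mA : measurable_fun setT (fun e : 'rV[R]_k => (gauss_rV e)%:E * ((enorm e ^+ i)^-1)%:E).
  apply: emeasurable_funM; first exact: measurable_gauss_rV_EFin.
  by apply/measurable_EFinP; exact: measurable_enormXV.
have A0 (e : 'rV[R]_k) : 0 <= (gauss_rV e)%:E * ((enorm e ^+ i)^-1)%:E.
  by rewrite mule_ge0// lee_fin ?gauss_rV_ge0// invr_ge0 exprn_ge0// enorm_ge0.
have mD := measurable_punctured_ball (R := R) (n := k).
have mG := @measurable_gauss_rV_EFin R k.
have mDC := measurableC mD.
rewrite /gauss_moment -(setUv D) (ge0_integral_setU _ mD mDC)//; last 2 first.
- exact: measurable_funTS.
- by rewrite disj_set2E setICr.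
apply: lte_add_pinfty.
  apply: (le_lt_trans _ (negative_moment_lty ik)).
  apply: ge0_le_integral => //.
  - exact: measurable_funTS.
  - by apply: measurable_funTS; apply/measurable_EFinP; exact: measurable_enormXV.
  move=> c _; rewrite -[leRHS]mul1e; apply: lee_wpmul2r.
    by rewrite lee_fin invr_ge0 exprn_ge0// enorm_ge0.
  rewrite lee_fin gauss_rV_enorm ler_pdivrMr ?exprn_gt0 ?sqrt_pi_gt0// mul1r.
  rewrite (le_trans (gauss_fun_le1 _))// exprn_ege1// -sqrtr1 ler_wsqrtr//.
  by rewrite (le_trans _ (pi_ge2 R))// ler1n.
apply: (@le_lt_trans _ _ (\int[lam]_c (gauss_rV c)%:E)).
  apply: (@le_trans _ _ (\int[lam]_(c in ~` D) (gauss_rV c)%:E)).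
    apply: ge0_le_integral => //.
    - exact: measurable_funTS.
    - exact: measurable_funTS.
    move=> c nD; rewrite -[leRHS]mule1; apply: lee_wpmul2l.
      by rewrite lee_fin gauss_rV_ge0.
    rewrite lee_fin; have [->|c0] := eqVneq c 0%R.
      have -> : enorm (0%R : 'rV[R]_k) = 0%R by apply/eqP; rewrite enorm_eq0.
      by rewrite expr0n; case: (i == 0)%N; rewrite ?invr1// invr0.
    have c1 : (1 < enorm c)%R.
      by rewrite ltNge; apply/negP => c1; apply: nD; rewrite /punctured_ball/= c1 enorm_gt0 c0.
    by rewrite invf_le1 ?exprn_gt0 ?enorm_gt0// exprn_ege1// ltW.
  apply: ge0_subset_integral => //.
  - by move=> c _; rewrite lee_fin gauss_rV_ge0.
(* The constant function 1 in this formula gives the total mass of the gaussian weight. *)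
have := @gauss_rV_dot R k 0%R (cst 1) (measurable_cst _) (fun=> lee01).
under eq_integral do rewrite mule1.
by move=> ->; under eq_integral do rewrite mule1; rewrite integral_gauss_density ltry.
Qed.

End star_integrals.

(** * Dual volumes of the sections of a convex body *)

Lemma closed_affine_preimage (R : realType) m p (v : 'rV[R]_p) (M : 'M[R]_(m, p))
    (A : set 'rV[R]_p) : closed A -> closed [set x : 'rV[R]_m | A (v + x *m M)].
Proof.
move=> cA; rewrite -openC openE => x /= nA.
have := closed_openC cA; rewrite openE => /(_ _ nA)/nbhs_ballP[e /= e0 He].
pose C := \sum_j \sum_k `|M k j| + 1.
have C0 : 0 < C by rewrite ltr_wpDl// sumr_ge0// => j _; rewrite sumr_ge0.
apply/nbhs_ballP; exists (e / C); first by rewrite /= divr_gt0.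
move=> y; rewrite -ball_normE/= ltr_pdivlMr// => xy; apply: He.
rewrite -ball_normE/= opprD addrACA subrr add0r -mulmxBl (le_lt_trans (mulmx_norm_le _ _))//.
by apply: le_lt_trans xy; rewrite ler_wpM2l// lerDl.
Qed.

Section chords.
Context {R : realType} {n : nat}.
Variables (K : set 'rV[R]_n) (E : {vspace 'rV[R]_n}).
Hypothesis cK : compact K.
Hypothesis sK : segment_closed K.
Local Notation B := (frame E).
Local Notation k := (\dim E).

Definition chord_set (x : 'rV[R]_n) := [set c : 'rV[R]_k | K (x + c *m B)].

Lemma chord_setE x :
  [set c : 'rV[R]_k | ([set y - x | y in K] `&` [set` E]) (c *m B)] = chord_set x.
Proof.
apply/seteqP; split=> c; rewrite /chord_set/=.
  by move=> [[y Ky <-] _]; rewrite addrC subrK.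
move=> Kc; split; last exact: frame_mem.
by exists (x + c *m B) => //; rewrite addrC addKr.
Qed.

Lemma chord_set_bounded : exists2 M : R, 0 <= M &
  forall x c, K x -> chord_set x c -> enorm c <= M.
Proof.
have [b b0 Kb] := compact_norm_bound cK.
exists (n%:R * (2 * b)) => [|x c Kx Kc]; first by rewrite !mulr_ge0.
rewrite -enorm_frame (le_trans (enorm_le_sum _))//.
rewrite (@le_trans _ _ (\sum_(j < n) 2 * b))//; last first.
  by rewrite sumr_const card_ord -[leLHS]mulr_natl.
apply: ler_sum => j _; rewrite (le_trans (rV_coord_le _ j))//.
have -> : c *m B = (x + c *m B) - x by rewrite addrC addKr.
by rewrite (le_trans (ler_normB _ _))// mulr2n mulrDl mul1r lerD// Kb.
Qed.

Lemma chord_set_compact x : K x -> compact (chord_set x).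
Proof.
move=> Kx; apply: bounded_closed_compact; last first.
  have clK : closed K by apply: (compact_closed _ cK); exact: (@norm_hausdorff R 'rV[R]_n).
  exact: closed_affine_preimage.
have [M M0 HM] := chord_set_bounded.
exists M; split; [exact: num_real|move=> b Mb c Kc].
apply/rV_norm_leP; first by rewrite (le_trans M0)// ltW.
by move=> j; rewrite (le_trans (enorm_coord_le _ _))// (le_trans (HM x c Kx Kc))// ltW.
Qed.

Lemma chord_set0 x : K x -> chord_set x 0.
Proof. by rewrite /chord_set/= mul0mx addr0. Qed.

Lemma chord_set_star x : K x ->
  forall c t, chord_set x c -> 0 <= t -> t <= 1 -> chord_set x (t *: c).
Proof.
move=> Kx c t Kc t0 t1; rewrite /chord_set/= -scalemxAl.
have := sK Kx Kc t0 t1; congr K.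
by rewrite scalerDr addrA -scalerDl subrK scale1r.
Qed.

Hypothesis dE : (0 < k)%N.
Variable i : nat.

Definition chord_volume x : \bar R :=
  (\int[lebesgue_rV k]_(c in @punctured_ball R k)
    (direction_radius (chord_set x) c ^+ i)%:E)%E.

Lemma dual_volume_chord x : K x ->
  dual_volume E i ([set y - x | y in K] `&` [set` E]) = chord_volume x.
Proof.
move=> Kx; rewrite dual_volumeE ?chord_setE//.
- exact: chord_set_compact.
- exact: chord_set0.
- exact: chord_set_star.
Qed.

Local Open Scope ereal_scope.
Hypothesis i0 : (0 < i)%N.

Let L0 := chord_set0.
Let cL := chord_set_compact.
Let starL := chord_set_star.

(** The case [m = 0] of [star_moment]: both weights are 1, and [lam D] cancels. *)
Lemma section_volume_frame x : K x -> i = k -> section_volume B K x = chord_volume x.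
Proof.
move=> Kx ik.
have mD := measurable_punctured_ball (R := R) (n := k).
have mL := compact_rV_measurable (cL Kx).
have LD : lebesgue_rV k (@punctured_ball R k) \is a fin_num.
  by rewrite ge0_fin_numE ?measure_ge0// lebesgue_punctured_ball_lty.
have LD0 : fine (lebesgue_rV k (@punctured_ball R k)) != 0%R.
  by rewrite gt_eqF// fine_gt0// lebesgue_punctured_ball_lty lebesgue_punctured_ball_gt0.
have := @star_moment _ _ dE _ (cL Kx) (L0 Kx) (starL Kx) i 0 i0 (etrans (addn0 i) ik).
under eq_integral do rewrite expr0 invr1.
under [X in _ = X * _ -> _]eq_integral do rewrite expr0 invr1.
rewrite -/(chord_volume x) !integral_cst// !mul1e -(fineK LD) => H.
rewrite -[LHS]mul1e -[RHS]mul1e -(mulVf LD0) EFinM -!muleA.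
by congr (_ * _); rewrite [X in _ = X * _](fineK LD); exact: H.
Qed.

(** Tonelli exchanges the random matrix with [e], the law of [e G] replaces the matrix by a gaussian
    vector, and [star_gauss] evaluates the result. The constant [A] is the same for all [x], so it
    cancels when two points are compared. *)
Lemma section_volume_average : (i < k)%N -> exists N (G : 'rV[R]_N -> 'M[R]_(i, n))
    (om : 'rV[R]_N -> R) (A : R),
  [/\ (0 < A)%R, forall z, (0 <= om z)%R, measurable_fun setT om,
    forall x, K x -> measurable_fun setT (fun z => section_volume (G z) K x) &
    forall x, K x -> \int[lebesgue_rV N]_z ((om z)%:E * section_volume (G z) K x) =
      A%:E * chord_volume x].
Proof.
move=> ik; have [N [G [om [om0 mom mG HG]]]] := @gaussian_matrix R i k.
set bk := lebesgue_rV k (@punctured_ball R k).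
set bi := lebesgue_rV i (@punctured_ball R i).
have bk_fin : bk \is a fin_num.
  by rewrite ge0_fin_numE ?measure_ge0// lebesgue_punctured_ball_lty.
have bk0 : (0 < fine bk)%R.
  by rewrite fine_gt0// lebesgue_punctured_ball_lty lebesgue_punctured_ball_gt0.
have bi_fin : bi \is a fin_num.
  by rewrite ge0_fin_numE ?measure_ge0// lebesgue_punctured_ball_lty.
have bi0 : (0 < fine bi)%R.
  by rewrite fine_gt0// lebesgue_punctured_ball_lty lebesgue_punctured_ball_gt0.
have g0 := @gauss_moment_gt0 R k dE i.
have g_fin : @gauss_moment R k i \is a fin_num.
  by rewrite ge0_fin_numE ?ltW// gauss_moment_lty.
have mP x : K x -> measurable [set p : 'rV[R]_N * 'rV[R]_i | chord_set x (p.2 *m G p.1)%R].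
  move=> Kx; rewrite -[X in measurable X]setTI.
  apply: (_ : measurable_fun setT (fun p : 'rV[R]_N * 'rV[R]_i => (p.2 *m G p.1)%R)) => //.
    apply: measurable_fun_rV => j; under eq_fun do rewrite mxE.
    apply: measurable_sum => a; apply: measurable_funM.
      exact: (measurableT_comp (measurable_coord a) measurable_snd).
    exact: (measurableT_comp (mG a j) measurable_fst).
  exact: compact_rV_measurable (cL Kx).
have svE x z : section_volume (G z *m B)%R K x =
    lebesgue_rV i [set e | chord_set x (e *m G z)%R].
  rewrite /section_volume; congr (lebesgue_rV i _).
  by apply/seteqP; split=> e; rewrite /chord_set/= mulmxA.
exists N, (fun z => G z *m B)%R, om, ((fine bk)^-1 * (fine bi * fine (@gauss_moment R k i)))%R.
split=> //.
- by rewrite mulr_gt0 ?invr_gt0// mulr_gt0// fine_gt0// g0 gauss_moment_lty.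
- move=> x Kx; apply: eq_measurable_fun (measurable_fun_xsection (lebesgue_rV i) (mP x Kx)) => z _.
  rewrite svE; congr (lebesgue_rV i _).
  by apply/seteqP; split=> e; rewrite /xsection/= inE.
move=> x Kx; have mL := compact_rV_measurable (cL Kx).
have mI : measurable_fun setT (fun p : 'rV[R]_N * 'rV[R]_i =>
   (om p.1)%:E * (\1_(chord_set x) (p.2 *m G p.1)%R)%:E).
  apply: emeasurable_funM.
    by apply/measurable_EFinP; exact: (measurableT_comp mom measurable_fst).
  exact: (measurable_EFin_indic (mP x Kx)).
transitivity (\int[lebesgue_rV N]_z \int[lebesgue_rV i]_e
    ((om z)%:E * (\1_(chord_set x) (e *m G z)%R)%:E)).
  apply: eq_integral => z _.
  have mS : measurable [set e | chord_set x (e *m G z)%R].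
    rewrite -[X in measurable X]setTI; exact: (@measurable_mulmxr R i k (G z)).
  have mz : measurable_fun setT (fun e => (\1_(chord_set x) (e *m G z)%R)%:E : \bar R).
    exact: (measurable_EFin_indic mS).
  rewrite (ge0_integralZl _ measurableT mz)//; last by rewrite lee_fin.
  by congr (_ * _); rewrite svE integral_indic_comp.
rewrite (fubini_tonelli (m1 := lebesgue_rV N) (m2 := lebesgue_rV i)
  (fun p : 'rV[R]_N * 'rV[R]_i => (om p.1)%:E * (\1_(chord_set x) (p.2 *m G p.1)%R)%:E))//; last first.
  by move=> p; rewrite mule_ge0// lee_fin.
have mL1 : measurable_fun setT (fun c : 'rV[R]_k => (\1_(chord_set x) c : R)%:E).
  exact: measurable_EFin_indic.
transitivity (\int[lebesgue_rV i]_e \int[lebesgue_rV k]_c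
    ((gauss_rV c)%:E * (\1_(chord_set x) (enorm e *: c)%R)%:E)).
  apply: eq_integral => e _ /=; have I0 (c : 'rV[R]_k) : 0 <= (\1_(chord_set x) c : R)%:E by rewrite lee_fin.
  exact: (HG e _ mL1 I0).
have mS : measurable [set p : 'rV[R]_i * 'rV[R]_k | chord_set x (enorm p.1 *: p.2)%R].
  rewrite -[X in measurable X]setTI; apply: (_ : measurable_fun setT
    (fun p : 'rV[R]_i * 'rV[R]_k => (enorm p.1 *: p.2)%R)) => //.
  apply: measurable_fun_rV => j; under eq_fun do rewrite mxE.
  apply: measurable_funM.
    exact: (measurableT_comp (@measurable_enorm R i) measurable_fst).
  exact: (measurableT_comp (measurable_coord j) measurable_snd).
have mH : measurable_fun setT (fun p : 'rV[R]_i * 'rV[R]_k =>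
    (gauss_rV p.2)%:E * (\1_(chord_set x) (enorm p.1 *: p.2)%R)%:E).
  apply: emeasurable_funM.
    exact: (measurableT_comp (@measurable_gauss_rV_EFin R k) measurable_snd).
  exact: (measurable_EFin_indic mS).
rewrite (fubini_tonelli (m1 := lebesgue_rV i) (m2 := lebesgue_rV k)
  (fun p : 'rV[R]_i * 'rV[R]_k =>
    (gauss_rV p.2)%:E * (\1_(chord_set x) (enorm p.1 *: p.2)%R)%:E))//; last first.
  by move=> p; rewrite mule_ge0// lee_fin ?gauss_rV_ge0.
transitivity (\int[lebesgue_rV k]_c ((gauss_rV c)%:E *
    lebesgue_rV i [set e : 'rV[R]_i | chord_set x (enorm e *: c)%R])).
  apply: eq_integral => c _ /=.
  have mc : measurable [set e : 'rV[R]_i | chord_set x (enorm e *: c)%R].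
    have := measurable_ysection c mS; congr measurable.
    by apply/seteqP; split=> e; rewrite /ysection/= inE.
  have mI1 : measurable_fun setT (fun e : 'rV[R]_i => (\1_(chord_set x) (enorm e *: c)%R)%:E : \bar R).
    exact: (measurable_EFin_indic mc).
  rewrite (ge0_integralZl _ measurableT mI1)//; last by rewrite lee_fin gauss_rV_ge0.
  by congr (_ * _); rewrite integral_indic_comp.
have := @star_gauss _ _ dE _ (cL Kx) (L0 Kx) (starL Kx) i i0.
rewrite -/bk -/bi -/(chord_volume x) -(fineK bk_fin) -(fineK bi_fin) -(fineK g_fin).
set X := integral _ _ _ => H.
rewrite EFinM -muleA EFinM -H muleA -EFinM mulVf ?mul1e//.
by rewrite gt_eqF.
Qed.

Lemma chord_volume_ge x : (i <= k)%N -> K° !=set0 -> centroid K = 0%R -> K x ->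
  ((i.+1%:R / n.+1%:R) ^+ i)%:E * chord_volume x <= chord_volume 0%R.
Proof.
move=> ik iK gK Kx.
have K0 : K 0%R by exact: nbhs_singleton (centroid_interior cK sK iK gK).
have c0 : (0 <= (i.+1%:R / n.+1%:R : R) ^+ i)%R by rewrite exprn_ge0// divr_ge0.
have [ik'|ik'] := eqVneq i k.
  move: (section_volume_frame Kx ik') (section_volume_frame K0 ik') => <- <-.
  by rewrite ik'; exact: section_volume_ge.
have [|N [G [om [A [A0 om0 mom mG HG]]]]] := section_volume_average.
  by rewrite ltn_neqAle ik' ik.
have A0' : (0 < A%:E) by rewrite lte_fin.
rewrite -(lee_pmul2l _ A0')//.
rewrite muleCA -!HG// -ge0_integralZl//; last 2 first.
- by apply: emeasurable_funM; [exact/measurable_EFinP|exact: mG].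
- by move=> z _; rewrite mule_ge0// ?lee_fin.
apply: ge0_le_integral => //.
- by move=> z _; rewrite !mule_ge0// ?lee_fin.
- apply: emeasurable_funM => //; apply: emeasurable_funM; [exact/measurable_EFinP|exact: mG].
- by apply: emeasurable_funM; [exact/measurable_EFinP|exact: mG].
move=> z _; rewrite muleCA; apply: lee_wpmul2l; first by rewrite lee_fin.
exact: section_volume_ge.
Qed.

End chords.

Section liminf_bounds.
Context {R : realType}.
Local Open Scope ereal_scope.

Lemma limn_einf_ge_near (u : (\bar R)^nat) (a : \bar R) N :
  (forall j, (N <= j)%N -> a <= u j) -> a <= limn_einf u.
Proof.
move=> H; rewrite limn_einf_lim; apply: lime_ge; first exact: is_cvg_einfs.
exists N => // n /= Nn; apply: le_ereal_inf_tmp => _ [j /= nj <-].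
by apply: H; exact: leq_trans nj.
Qed.

Lemma limn_einf_le_cofinal (u : (\bar R)^nat) (b : \bar R) :
  (forall n, exists2 j, (n <= j)%N & u j <= b) -> limn_einf u <= b.
Proof.
move=> H; rewrite limn_einf_lim; apply: lime_le; first exact: is_cvg_einfs.
apply: nearW => n; have [j nj ujb] := H n.
by apply: le_trans ujb; apply: ereal_inf_lbound; exists j.
Qed.

End liminf_bounds.

(** * Existence of the maximum *)

Section maximal_chord_volume.
Context {R : realType} {n : nat}.
Variables (K : set 'rV[R]_n) (E : {vspace 'rV[R]_n}).
Hypothesis cK : compact K.
Hypothesis sK : segment_closed K.
Hypothesis K0 : K !=set0.
Local Notation k := (\dim E).
Variable i : nat.
Hypothesis i0 : (0 < i)%N.
Local Notation D := (@punctured_ball R k).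
Local Notation lam := (lebesgue_rV k).
Local Notation rho x := (direction_radius (@chord_set R n K E x)).
Local Notation V x := (@chord_volume R n K E i x).

Let radius_bound : exists2 M : R, 0 <= M & forall x c, K x -> c != 0 -> rho x c <= M.
Proof.
have [M M0 HM] := chord_set_bounded E cK; exists M => // x c Kx c0.
have cL := chord_set_compact (E := E) cK Kx; have L0 : @chord_set R n K E x 0 by exact: chord_set0.
have sL := chord_set_star (E := E) sK Kx.
have r0 : 0 <= rho x c by exact: direction_radius_ge0.
have := HM x (rho x c *: normalize c) Kx; rewrite enormZ// enorm_normalize// mulr1; apply.
apply/(direction_radiusP cL L0 sL (normalize_neq0 c0)) => //.
by rewrite enorm_normalize// mulr1 /normalize direction_radiusZ// invr_gt0 enorm_gt0.
Qed.

(** The point at distance [s] from [p] in the direction of [c] is outside the closed set [K], and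
    remains so when [p] moves slightly. *)
Lemma direction_radius_usc p c s : K p -> c != 0 -> rho p c < s ->
  exists2 e : R, 0 < e & forall x, K x -> `|x - p| < e -> rho x c < s.
Proof.
move=> Kp c0 ps.
have s0 : 0 <= s by rewrite (le_trans _ (ltW ps))// direction_radius_ge0//;
  [exact: chord_set_compact|exact: chord_set0|exact: chord_set_star].
have n1 := enorm_normalize c0.
have rhoN x : rho x (normalize c) = rho x c.
  by rewrite /normalize direction_radiusZ// invr_gt0 enorm_gt0.
have P x : K x -> @chord_set R n K E x (s *: normalize c) <-> s <= rho x c.
  move=> Kx; rewrite -rhoN -[X in X <= _]mulr1 -[X in _ * X]n1.
  by apply: direction_radiusP; rewrite ?normalize_neq0//;
    [exact: chord_set_compact|exact: chord_set0|exact: chord_set_star].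
have clK : closed K by apply: (compact_closed _ cK); exact: (@norm_hausdorff R 'rV[R]_n).
have nK : ~ K (p + s *: normalize c *m frame E) by move/(P p Kp); rewrite leNgt ps.
have := closed_openC clK; rewrite openE => /(_ _ nK)/nbhs_ballP[e /= e0 He].
exists e => // x Kx xp; rewrite ltNge; apply/negP => /(P x Kx); apply: He.
by rewrite -ball_normE/= opprD addrACA subrr addr0 distrC.
Qed.

Local Open Scope ereal_scope.

(** Fatou bounds lower limits of nonnegative functions, whereas the radii are upper semicontinuous;
    it is therefore applied to [M ^+ i - rho ^+ i], whose integral complements the chord volume to
    the finite [T]. *)
Lemma chord_volume_max : exists2 p, K p & forall x, K x -> V x <= V p.
Proof.
have [M M0 HM] := radius_bound.
have mD := measurable_punctured_ball (R := R) (n := k).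
have r0 x c : K x -> (0 <= rho x c)%R.
  by move=> Kx; apply: direction_radius_ge0; [exact: chord_set_compact|exact: chord_set0|exact: chord_set_star].
have mr x : K x -> measurable_fun D (fun c => (rho x c ^+ i)%:E).
  move=> Kx; apply: measurable_funTS; apply: measurable_direction_radiusX.
  - exact: chord_set_compact.
  - exact: chord_set0.
  - exact: chord_set_star.
have D0 (c : 'rV[R]_k) : D c -> c != 0%R by move=> /andP[+ _]; rewrite enorm_gt0.
have rM x c : K x -> D c -> (rho x c ^+ i <= M ^+ i)%R.
  by move=> Kx Dc; apply: lerXn2r; rewrite ?nnegrE ?r0// HM// D0.
pose T := (M ^+ i)%:E * lam D.
have Tfin : T \is a fin_num.
  by rewrite fin_numM// ge0_fin_numE ?measure_ge0// lebesgue_punctured_ball_lty.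
pose f x (c : 'rV[R]_k) := (M ^+ i - rho x c ^+ i)%R%:E.
have f0 x c : K x -> D c -> 0 <= f x c by move=> Kx Dc; rewrite lee_fin subr_ge0 rM.
have mf x : K x -> measurable_fun D (f x).
  move=> Kx; apply/measurable_EFinP; apply: measurable_funB => //.
  by apply/measurable_EFinP; exact: mr.
have fV x : K x -> \int[lam]_(c in D) f x c + V x = T.
  move=> Kx; rewrite -ge0_integralD//=; last 4 first.
  - by move=> c Dc; exact: f0.
  - exact: mf.
  - by move=> c Dc; rewrite lee_fin exprn_ge0// r0.
  - exact: mr.
  rewrite /T -integral_cst//; apply: eq_integral => c _.
  by rewrite /f -EFinD subrK.
have If0 x : K x -> 0 <= \int[lam]_(c in D) f x c.
  by move=> Kx; apply: integral_ge0 => c Dc; exact: f0.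
have V0 x : K x -> 0 <= V x.
  by move=> Kx; apply: integral_ge0 => c _; rewrite lee_fin exprn_ge0// r0.
have VT x : K x -> V x <= T.
  by move=> Kx; rewrite -(fV x Kx) leeDr// If0.
have Vfin x : K x -> V x \is a fin_num.
  by move=> Kx; rewrite ge0_fin_numE ?V0// (le_lt_trans (VT x Kx))// ltey_eq Tfin.
have [z Kz] := K0.
pose S := ereal_sup ((fun x => V x) @` K).
have Sfin : S \is a fin_num.
  rewrite ge0_fin_numE.
    by rewrite (@le_lt_trans _ _ T) ?ltey_eq ?Tfin//; apply: ge_ereal_sup => _ [x Kx <-]; exact: VT.
  by rewrite (le_trans (V0 z Kz))//; apply: ereal_sup_ubound; exists z.
have /choice[y Hy] : forall j : nat, exists x, K x /\ S - (j.+1%:R^-1)%:E <= V x.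
  move=> j; have j0 : (0 < j.+1%:R^-1 :> R)%R by rewrite invr_gt0.
  have [_ [x Kx <-] Sx] := ub_ereal_sup_adherent j0 Sfin.
  by exists x; split=> //; exact: ltW.
have [p [Kp clp]] : (K `&` cluster (y @ \oo)) !=set0.
  by apply: cK; exists 0%N => // j _; have [] := Hy j.
exists p => // x Kx; apply: (@le_trans _ _ S); first by apply: ereal_sup_ubound; exists x.
(* From the maximizing sequence [y] with cluster point [p], a sequence that converges to [p] and is
   still maximizing. *)
have /choice[w Hw] : forall j : nat, exists x,
    [/\ K x, S - (j.+1%:R^-1)%:E <= V x & (`|x - p| < j.+1%:R^-1)%R].
  move=> j; have j0 : (0 < j.+1%:R^-1 :> R)%R by rewrite invr_gt0.
  have [_ [[m jm <-] ball_m]] : ([set y m | m in [set m | (j <= m)%N]] `&` ball p (j.+1%:R^-1)) !=set0.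
    apply: clp; last exact: nbhsx_ballx.
    by exists j => // m /= jm; exists m.
  exists (y m); have [Km Sm] := Hy m; split=> //; last first.
    by move: ball_m; rewrite -ball_normE/= distrC.
  apply: le_trans Sm; rewrite leeD2l// leeN2 lee_fin lef_pV2 ?posrE ?ltr0n//.
  by rewrite ler_nat.
have Kw j : K (w j) by have [] := Hw j.
have Fat : \int[lam]_(c in D) f p c <= T - S.
  apply: (@le_trans _ _ (\int[lam]_(c in D) limn_einf (fun j => f (w j) c))).
    apply: ge0_le_integral => //.
    - by move=> c Dc; exact: f0.
    - exact: mf.
    - rewrite (_ : (fun _ => _) = (fun c => - limn_esup (fun j => - f (w j) c)))//.
      apply: measurableT_comp => //; apply: measurable_fun_limn_esup => j.
      by apply: measurableT_comp => //; exact: mf.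
    move=> c Dc; apply/lee_addgt0Pr => e e0; rewrite -leeBlDr//.
    (* The i-th root of [t] exceeds [rho p c], so by semicontinuity [rho (w j) c ^+ i <= t] for all
       large [j]. *)
    pose t := (rho p c ^+ i + e)%R.
    have t0 : (0 <= t)%R by rewrite addr_ge0 ?(ltW e0)// exprn_ge0// r0.
    have si : ((t `^ i%:R^-1) ^+ i = t)%R by rewrite powR_invnK.
    have ps : (rho p c < t `^ i%:R^-1)%R.
      rewrite ltNge; apply/negP => H.
      have : (t <= rho p c ^+ i)%R.
        by rewrite -si; apply: lerXn2r; rewrite ?nnegrE ?powR_ge0 ?r0.
      by rewrite /t gerDl leNgt e0.
    have [d d0 Hd] := direction_radius_usc Kp (D0 c Dc) ps.
    have [N HN] : exists N : nat, (N.+1%:R^-1 < d)%R.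
      have [N _ HN] := near_infty_natSinv_lt (PosNum d0); exists N; exact: (HN N (leqnn N)).
    apply: (@limn_einf_ge_near _ _ _ N) => j Nj.
    rewrite /f -EFinB lee_fin -addrA -opprD lerD2l lerN2 -/t -si.
    apply: lerXn2r; rewrite ?nnegrE ?powR_ge0 ?r0//; apply/ltW/Hd => //.
    have [_ _ wp] := Hw j; apply: (lt_trans wp); apply: le_lt_trans HN.
    by rewrite lef_pV2 ?posrE ?ltr0n// ler_nat.
  apply: (le_trans (@fatou _ _ _ lam D mD (fun j => f (w j)) _ _)).
  - by move=> j; exact: mf.
  - by move=> j c Dc; exact: f0.
  apply/lee_addgt0Pr => e e0; apply: limn_einf_le_cofinal => N.
  have [m _ Hm] := near_infty_natSinv_lt (PosNum e0).
  exists (maxn N m); first exact: leq_maxl.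
  have [_ Sw _] := Hw (maxn N m).
  have em : ((maxn N m).+1%:R^-1 < e)%R by apply: Hm; exact: leq_maxr.
  move: Sw (fV _ (Kw (maxn N m))) (Vfin _ (Kw (maxn N m))).
  set I := integral _ _ _; set v := V _ => Sv IvT vfin.
  have -> : I = T - v by rewrite -IvT addeK.
  move: Sv em; rewrite -(fineK Sfin) -(fineK vfin) -(fineK Tfin).
  move: (fine S) (fine v) (fine T) (_.+1%:R^-1)%R => a b t q.
  by rewrite -!EFinN -!EFinD !lee_fin; lra.
have := fV p Kp; move: Fat (If0 p Kp) (Vfin p Kp).
set I := integral _ _ _; set v := V p => IS I0 vfin IvT.
have Ifin : I \is a fin_num.
  by rewrite ge0_fin_numE// (le_lt_trans IS)// ltey_eq fin_numB Tfin Sfin.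
move: IS; have -> : T = I + v by [].
rewrite -(fineK Ifin) -(fineK vfin) -(fineK Sfin) -!EFinN -!EFinD !lee_fin; lra.
Qed.

End maximal_chord_volume.

(** * Sharpness *)

Section anisotropic_dilation.
Context {R : realType} {k : nat}.
Variables i m : nat.
Hypothesis imk : (i + m = k)%N.
Local Notation lam := (lebesgue_rV k).

Definition dilation (e g : R) : 'M[R]_k := diag_mx (\row_j if (j < i)%N then e else g).

Lemma dilationE (e g : R) (c : 'rV[R]_k) j :
  (c *m dilation e g) 0 j = (if (j < i)%N then e else g) * c 0 j.
Proof. by rewrite mul_mx_diag !mxE mulrC. Qed.

Lemma dilation_scalar (t : R) (c : 'rV[R]_k) : c *m dilation t t = t *: c.
Proof. by apply/rowP => j; rewrite dilationE mxE if_same. Qed.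

Lemma dilationM (e g e' g' : R) (c : 'rV[R]_k) :
  c *m dilation e g *m dilation e' g' = c *m dilation (e' * e) (g' * g).
Proof. by apply/rowP => j; rewrite !dilationE mulrA; case: ifP. Qed.

Lemma prod_dilation (e g : R) :
  \prod_(j < k) (if (j < i)%N then e else g) = e ^+ i * g ^+ m.
Proof.
rewrite -imk big_split_ord/=; congr (_ * _).
  under eq_bigr => j _ do rewrite ltn_ord.
  by rewrite prodr_const card_ord.
under eq_bigr => j _ do rewrite ltnNge leq_addr/=.
by rewrite prodr_const card_ord.
Qed.

(** The factor is read off a box with sides [e] and [g], whose preimage is the unit cube. *)
Lemma ge0_integral_dilation (e g : R) (f : 'rV[R]_k -> \bar R) : 0 < e -> 0 < g ->
  measurable_fun setT f -> (forall c, 0 <= f c)%E ->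
  (\int[lam]_c f c = (e ^+ i * g ^+ m)%:E * \int[lam]_c f (c *m dilation e g))%E.
Proof.
move=> e0 g0 mf f0.
have U : dilation e g \in unitmx.
  rewrite unitmxE det_diag unitfE; apply/prodf_neq0 => j _.
  by rewrite mxE; case: ifP; rewrite gt_eqF.
have [a a0 Ha] := ge0_integral_rV_linear U.
rewrite Ha// muleA -EFinM.
pose d (j : 'I_k) : R := if (j < i)%N then e else g.
have d0 j : 0 < d j by rewrite /d; case: ifP.
pose box := [set c : 'rV[R]_k | forall j, `[0, d j]%classic (c 0 j)].
pose box1 := [set c : 'rV[R]_k | forall j, `[0, 1]%classic (c 0 j)].
have mbox (A : 'I_k -> set R) : (forall j, measurable (A j)) ->
    measurable [set c : 'rV[R]_k | forall j, A j (c 0 j)].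
  move=> mA; rewrite (_ : [set _ | _] = \bigcap_(j in [set: 'I_k])
      ((fun c : 'rV[R]_k => c 0 j) @^-1` A j)).
    apply: fin_bigcap_measurable => // j _.
    by rewrite -[X in measurable X]setTI; exact: measurable_coord.
  by apply/seteqP; split=> c /=; [move=> H j _; exact: H|move=> H j; exact: H].
have mb : measurable box.
  by apply: (mbox (fun j => `[0, d j]%classic)) => j; exact: measurable_itv.
have I0 (c : 'rV[R]_k) : (0 <= (\1_box c : R)%:E)%E by rewrite lee_fin.
have := Ha _ (measurable_EFin_indic mb) I0.
rewrite [X in (_ * X)%E]integral_indic// setIT integral_indic_comp; last first.
  by rewrite -[X in measurable X]setTI; exact: (measurable_mulmxr _ measurableT).
have E3 j x : (d j * x <= d j) = (x <= 1) by rewrite -[leRHS]mulr1 ler_pM2l.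
rewrite (_ : [set c | box (c *m dilation e g)] = box1); last first.
  apply/seteqP; split=> c /= H j; have := H j;
    by rewrite /= !in_itv/= dilationE -/(d j) pmulr_rge0// E3.
have B1 : lam box1 = 1%E.
  apply: (etrans (@lebesgue_rV_box R k (fun=> `[0, 1]%classic) (fun=> measurable_itv _))).
  by apply: big1 => j _; rewrite lebesgue_measure_itv/= lte_fin ltr01 oppr0 adde0.
have B2 : lam box = (e ^+ i * g ^+ m)%:E.
  apply: (etrans (@lebesgue_rV_box R k (fun j => `[0, d j]%classic) (fun=> measurable_itv _))).
  rewrite -prod_dilation -prodEFin; apply: eq_bigr => j _.
  by rewrite lebesgue_measure_itv/= lte_fin d0 oppr0 adde0.
move=> E1.
have [E4] : 1%:E = (a * (e ^+ i * g ^+ m))%:E.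
  by rewrite EFinM -B2; apply: etrans E1; rewrite -B1.
by rewrite mulrC -E4 mul1e.
Qed.

Local Open Scope ereal_scope.

(** The product of an i-dimensional simplex of size [q] and an m-dimensional one of size [d]. At the
    origin all the slacks of a factor are equal, so each simplex has its centroid there. *)
Definition wedge (q d : R) := [set c : 'rV[R]_k |
  [/\ forall j : 'I_k, (0 <= (if (j < i)%N then q else d) + c 0%R j)%R,
      (\sum_(j < k | (j < i)%N) c 0 j <= q)%R & (\sum_(j < k | ~~ (j < i)%N) c 0 j <= d)%R]].
Arguments wedge (q d)%_R.
Arguments dilation (e g)%_R.
Arguments enorm {R n} x%_R.

Lemma measurable_wedge q d : measurable (wedge q d).
Proof.
have -> : wedge q d = (\bigcap_(j in [set: 'I_k])
      [set c : 'rV[R]_k | (0 <= (if (j < i)%N then q else d) + c 0%R j)%R]) `&`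
    ([set c : 'rV[R]_k | (\sum_(j < k | (j < i)%N) c 0%R j <= q)%R] `&`
     [set c : 'rV[R]_k | (\sum_(j < k | ~~ (j < i)%N) c 0%R j <= d)%R]).
  apply/seteqP; split=> c /=.
    by move=> [H ? ?]; split; [move=> j _; exact: H|split].
  by move=> [H [? ?]]; split=> // j; exact: H.
have msum (P : pred 'I_k) : measurable_fun setT (fun c : 'rV[R]_k => (\sum_(j | P j) c 0%R j)%R).
  under eq_fun do rewrite big_mkcond; apply: measurable_sum => j.
  by case: (P j); [exact: measurable_coord|exact: measurable_cst].
apply: measurableI; last first.
  by apply: measurableI; rewrite -[X in measurable X]setTI; exact: measurable_fun_ler.
apply: fin_bigcap_measurable => // j _; rewrite -[X in measurable X]setTI.
by apply: measurable_fun_ler => //; apply: measurable_funD => //; exact: measurable_coord.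
Qed.

Lemma wedge_dilation (a b q d : R) (c : 'rV[R]_k) : (0 < a)%R -> (0 < b)%R ->
  wedge (a * q) (b * d) (c *m dilation a b)%R <-> wedge q d c.
Proof.
move=> a0 b0.
have s1 : (\sum_(j < k | (j < i)%N) (c *m dilation a b) 0 j = a * \sum_(j < k | (j < i)%N) c 0 j)%R.
  by rewrite mulr_sumr; apply: eq_bigr => j ji; rewrite dilationE ji.
have s2 : (\sum_(j < k | ~~ (j < i)%N) (c *m dilation a b) 0 j = b * \sum_(j < k | ~~ (j < i)%N) c 0 j)%R.
  by rewrite mulr_sumr; apply: eq_bigr => j ji; rewrite dilationE (negbTE ji).
have s3 (j : 'I_k) : (0 <= (if (j < i)%N then a * q else b * d) + (c *m dilation a b) 0 j)%R =
            (0 <= (if (j < i)%N then q else d) + c 0 j)%R.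
  by rewrite dilationE; case: ifP => _; rewrite -mulrDr pmulr_rge0.
rewrite /wedge/= s1 s2 !ler_pM2l//.
by split=> -[H1 H2 H3]; split=> // j; have := H1 j; rewrite s3.
Qed.

Lemma wedge_coord_le q d c j : (0 <= q)%R -> (0 <= d)%R -> wedge q d c ->
  (`|c 0 j| <= k.+1%:R * (q + d))%R.
Proof.
move=> q0 d0 [H1 H2 H3].
have Hl l : (- (q + d) <= c 0 l)%R by have := H1 l; case: ifP => _; lra.
have up (P : pred 'I_k) : P j -> (\sum_(l | P l) c 0 l <= q + d)%R ->
    (c 0 j <= k.+1%:R * (q + d))%R.
  move=> Pj; rewrite (bigD1 j)//= => Hs.
  have : (- (k%:R * (q + d)) <= \sum_(l | P l && (l != j)) c 0 l)%R.
    apply: (@le_trans _ _ (\sum_(l | P l && (l != j)) - (q + d))%R); last first.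
      by apply: ler_sum => l _.
    rewrite sumr_const -[leRHS]mulr_natl mulrN lerN2 ler_wpM2r ?addr_ge0// ler_nat.
    by rewrite (leq_trans (max_card _))// card_ord.
  rewrite -[k.+1%:R%R]natr1 mulrDl mul1r; move: (k%:R * _)%R => x; lra.
rewrite ler_norml; apply/andP; split.
  apply: le_trans (Hl j); rewrite lerN2 ler_peMl ?addr_ge0// ler1n//.
have [ji|ji] := boolP (j < i)%N.
  by apply: (up (fun l => (l < i)%N)) => //; rewrite (le_trans H2)// lerDl.
by apply: (up (fun l => ~~ (l < i)%N)) => //; rewrite (le_trans H3)// lerDr.
Qed.

Lemma wedge_enorm_le q d c : (0 <= q)%R -> (0 <= d)%R -> wedge q d c ->
  (enorm c <= k%:R * (k.+1%:R * (q + d)))%R.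
Proof.
move=> q0 d0 Pc; rewrite (le_trans (enorm_le_sum c))//.
apply: (@le_trans _ _ (\sum_(j < k) k.+1%:R * (q + d))%R).
  by apply: ler_sum => j _; exact: wedge_coord_le Pc.
by rewrite sumr_const card_ord -[leLHS]mulr_natl.
Qed.

Lemma wedge_small q d (c : 'rV[R]_k) : (forall j, `|c 0 j| <= (if (j < i)%N then q else d) / k.+1%:R)%R ->
  (0 <= q)%R -> (0 <= d)%R -> wedge q d c.
Proof.
move=> H q0 d0.
have k1 : (0 < k.+1%:R :> R)%R by rewrite ltr0n.
have dk (x : R) : (0 <= x -> x / k.+1%:R <= x)%R.
  by move=> x0; rewrite ler_pdivrMr// ler_peMr// ler1n.
have S (P : pred 'I_k) x : (0 <= x)%R -> (forall j, P j -> `|c 0 j| <= x / k.+1%:R)%R ->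
    (\sum_(j | P j) c 0 j <= x)%R.
  move=> x0 Hx; apply: (@le_trans _ _ (\sum_(j | P j) x / k.+1%:R)%R).
    by apply: ler_sum => j Pj; rewrite (le_trans (ler_norm _))// Hx.
  rewrite sumr_const -[leLHS]mulr_natl mulrCA ler_piMr// ler_pdivrMr// mul1r ler_nat.
  by rewrite (leq_trans (max_card _))// card_ord.
split.
- move=> j; have := H j; set b := (if _ then _ else _) => Hb.
  have b0 : (0 <= b)%R by rewrite /b; case: ifP.
  move: Hb; rewrite ler_norml => /andP[Hb _].
  by rewrite -lerBlDl sub0r; apply: le_trans Hb; rewrite lerN2; exact: dk.
- by apply: S => // j ji; have := H j; rewrite ji.
- by apply: S => // j ji; have := H j; rewrite (negbTE ji).
Qed.

Lemma lebesgue_wedge_gt0 q d : (0 < q)%R -> (0 < d)%R -> 0 < lam (wedge q d).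
Proof.
move=> q0 d0; apply: (@nbhs_lebesgue_rV_gt0 _ _ _ 0%R); first exact: measurable_wedge.
pose e : R := (Num.min q d / k.+1%:R)%R.
have e0 : (0 < e)%R by rewrite divr_gt0// lt_min q0.
apply/nbhs_ballP; exists e => // c; rewrite -ball_normE/= => /(rV_norm_ltP _ e0) He.
apply: wedge_small; rewrite ?ltW// => j; have := ltW (He j); rewrite !mxE sub0r normrN.
move=> /le_trans; apply; rewrite ler_pM2r ?invr_gt0 ?ltr0n//.
by rewrite ge_min; case: ifP; rewrite lexx ?orbT.
Qed.

Lemma lebesgue_wedge_lty q d : (0 <= q)%R -> (0 <= d)%R -> lam (wedge q d) < +oo.
Proof.
move=> q0 d0; apply: (@lebesgue_rV_bounded_lty _ _ _ (k.+1%:R * (q + d))%R).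
  exact: measurable_wedge.
move=> c Pc; apply/rV_norm_leP; first by rewrite mulr_ge0// addr_ge0.
by move=> j; exact: wedge_coord_le.
Qed.

Lemma lebesgue_wedge_scale (a b q d : R) : (0 < a)%R -> (0 < b)%R ->
  lam (wedge (a * q) (b * d)) = (a ^+ i * b ^+ m)%:E * lam (wedge q d).
Proof.
move=> a0 b0; have mW := measurable_wedge.
have I0 (c : 'rV[R]_k) : 0 <= (\1_(wedge (a * q) (b * d)) c : R)%:E by rewrite lee_fin.
have := ge0_integral_dilation a0 b0 (measurable_EFin_indic (mW _ _)) I0.
rewrite integral_indic// setIT => ->; congr (_ * _).
rewrite integral_indic_comp.
  by congr (lam _); apply/seteqP; split=> c /=; move/(wedge_dilation q d c a0 b0).
by rewrite -[X in measurable X]setTI; exact: (measurable_mulmxr _ measurableT).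
Qed.

(** The integral of [|y|^(-m)] over the wedge whose first factor is shrunk by [e], with the Jacobian
    [e ^+ i] left out. *)
Definition wedge_moment (e q d : R) : \bar R :=
  \int[lam]_(c in wedge q d) ((enorm (c *m dilation e 1) ^+ m)^-1)%:E.
Arguments wedge_moment (e q d)%_R.

Lemma wedge_weight_ge0 e (c : 'rV[R]_k) : 0 <= ((enorm (c *m dilation e 1) ^+ m)^-1)%:E.
Proof. by rewrite lee_fin invr_ge0 exprn_ge0// sqrtr_ge0. Qed.

Lemma measurable_dilation_moment e :
  measurable_fun setT (fun c : 'rV[R]_k => ((enorm (c *m dilation e 1) ^+ m)^-1)%:E).
Proof.
apply/measurable_EFinP.
exact: (measurableT_comp (@measurable_enormXV R k m) (measurable_mulmxr _)).
Qed.

Lemma wedge_moment_dilation (a b e q d : R) : (0 < a)%R -> (0 < b)%R ->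
  wedge_moment e (a * q) (b * d) = (a ^+ i * b ^+ m)%:E *
    \int[lam]_(c in wedge q d) ((enorm (c *m dilation (e * a) b) ^+ m)^-1)%:E.
Proof.
move=> a0 b0; rewrite /wedge_moment integral_mkcond (ge0_integral_dilation a0 b0).
- congr (_ * _); rewrite [RHS]integral_mkcond; apply: eq_integral => c _.
  rewrite !patchE dilationM mul1r; congr (if _ then _ else _).
  by apply/idP/idP; rewrite !inE => /(wedge_dilation q d c a0 b0).
- apply/(measurable_restrictT _ (measurable_wedge _ _)); apply: measurable_funTS.
  exact: measurable_dilation_moment.
- by move=> c; apply: erestrict_ge0 => x _; exact: wedge_weight_ge0.
Qed.

(** Homogeneity of degree [k - m], which is [i]. *)
Lemma wedge_moment_scale (t e q d : R) : (0 < t)%R ->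
  wedge_moment e (t * q) (t * d) = (t ^+ i)%:E * wedge_moment e q d.
Proof.
move=> t0.
have E : (t ^+ m)%:E * \int[lam]_(c in wedge q d)
    ((enorm (c *m dilation (e * t) t) ^+ m)^-1)%:E = wedge_moment e q d.
  rewrite -ge0_integralZl//.
  - apply: eq_integral => c _; have -> : (c *m dilation (e * t) t = t *: (c *m dilation e 1))%R.
      by rewrite -dilation_scalar dilationM mulr1 mulrC.
    rewrite enormZ ?(ltW t0)// exprMn invfM EFinM muleA -EFinM mulfV ?mul1e ?mul1r//.
    by rewrite gt_eqF// exprn_gt0.
  - exact: measurable_wedge.
  - apply: measurable_funTS; apply/measurable_EFinP.
    exact: (measurableT_comp (@measurable_enormXV R k m) (measurable_mulmxr _)).
  - by move=> c _; rewrite lee_fin invr_ge0 exprn_ge0// sqrtr_ge0.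
  - by rewrite lee_fin exprn_ge0// ltW.
by rewrite (wedge_moment_dilation e q d t0 t0) EFinM -muleA E.
Qed.

(** Up to a global factor 2, shrinking the thin directions by half amounts to doubling the thick
    ones. *)
Lemma wedge_moment_half e q d : wedge_moment (e / 2) q d = wedge_moment e q (2 * d).
Proof.
rewrite -[in RHS](mul1r q) wedge_moment_dilation// expr1n mul1r mulr1.
rewrite -ge0_integralZl//.
- apply: eq_integral => c _; have -> : (c *m dilation e 2 = 2 *: (c *m dilation (e / 2) 1))%R.
    by rewrite -dilation_scalar dilationM mulr1 mulrC divfK.
  by rewrite enormZ// exprMn invfM EFinM muleA -EFinM mulfV ?mul1e ?mul1r// expf_neq0// pnatr_eq0.
- exact: measurable_wedge.
- apply: measurable_funTS; apply/measurable_EFinP.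
  exact: (measurableT_comp (@measurable_enormXV R k m) (measurable_mulmxr _)).
- by move=> c _; rewrite lee_fin invr_ge0 exprn_ge0// sqrtr_ge0.
Qed.

Lemma wedge_subset q d d' : (d <= d')%R -> wedge q d `<=` wedge q d'.
Proof.
move=> dd' c [H1 H2 H3]; split=> //; last exact: le_trans dd'.
by move=> j; have := H1 j; case: ifP => // _ /le_trans; apply; rewrite lerD2r.
Qed.

Lemma wedge_moment_split e q d d' : (d <= d')%R ->
  wedge_moment e q d' = wedge_moment e q d +
    \int[lam]_(c in wedge q d' `\` wedge q d) ((enorm (c *m dilation e 1) ^+ m)^-1)%:E.
Proof.
move=> dd'; have mD := measurableD (measurable_wedge q d') (measurable_wedge q d).
rewrite /wedge_moment -ge0_integral_setU//.
- by rewrite setDUK//; exact: wedge_subset.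
- exact: measurable_wedge.
- by apply: measurable_funTS; exact: measurable_dilation_moment.
- by move=> c _; exact: wedge_weight_ge0.
- by rewrite disj_set2E; apply/eqP/seteqP; split=> // c [? []].
Qed.

(** Outside [wedge q d] some thick coordinate exceeds [d / (k+1)], which bounds the integrand:
    enlarging [d] costs an amount independent of [e]. *)
Lemma wedge_moment_le e q d d' : (0 <= q)%R -> (0 < d)%R -> (d <= d')%R ->
  wedge_moment e q d' <= wedge_moment e q d +
    (((d / k.+1%:R) ^+ m)^-1)%:E * lam (wedge q d').
Proof.
move=> q0 d0 dd'; rewrite (wedge_moment_split e q dd'); apply: leeD2l.
have mD := measurableD (measurable_wedge q d') (measurable_wedge q d).
have dk : (0 < d / k.+1%:R)%R by rewrite divr_gt0// ltr0n.
have C0 : (0 <= ((d / k.+1%:R) ^+ m)^-1)%R by rewrite invr_ge0 exprn_ge0// ltW.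
apply: (@le_trans _ _ (\int[lam]_(c in wedge q d' `\` wedge q d)
    (cst (((d / k.+1%:R) ^+ m)^-1)%:E) c)).
  apply: ge0_le_integral => //.
  - by move=> c _; exact: wedge_weight_ge0.
  - by apply: measurable_funTS; exact: measurable_dilation_moment.
  move=> c [[H1 H2 H3] nW]; rewrite lee_fin.
  have [j [ji cj]] : exists j : 'I_k, ~~ (j < i)%N /\ (d / k.+1%:R < `|c 0 j|)%R.
    apply: contrapT => H; apply: nW.
    have Hj (j : 'I_k) : ~~ (j < i)%N -> (`|c 0%R j| <= d / k.+1%:R)%R.
      by move=> ji; rewrite leNgt; apply/negP => cj; apply: H; exists j.
    (* Setting the thin coordinates to 0 isolates the thick ones, so that [wedge_small] can be
       applied with the single size [d]. *)
    have W : wedge d d (c *m dilation 0 1)%R.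
      apply: wedge_small => [j||]; [|exact: ltW d0|exact: ltW d0].
      rewrite if_same dilationE; case: ifPn => [_|/Hj]; rewrite ?mul0r ?normr0 ?mul1r//.
      exact: ltW dk.
    have [W1 W2 W3] := W; split=> //.
      move=> j; have := H1 j; case: ifPn => // ji _.
      by have := W1 j; rewrite if_same dilationE (negbTE ji) mul1r.
    rewrite (le_trans _ W3)//; apply: ler_sum => j ji.
    by rewrite dilationE (negbTE ji) mul1r.
  rewrite lef_pV2 ?posrE ?exprn_gt0//; last first.
    apply: lt_le_trans (enorm_coord_le _ j); rewrite dilationE (negbTE ji) mul1r.
    exact: lt_trans cj.
  apply: lerXn2r; rewrite ?nnegrE ?sqrtr_ge0 ?(ltW dk)//.
  apply: le_trans (enorm_coord_le _ j); rewrite dilationE (negbTE ji) mul1r.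
  exact: ltW.
rewrite integral_cst//; apply: lee_wpmul2l; first by rewrite lee_fin.
apply: le_measure; rewrite ?inE//; first exact: measurable_wedge.
Qed.

(** Doubling [d] multiplies the volume by [2^m >= 2], so the added region is at least as large as
    the old one, and the integrand has a lower bound on it that does not depend on [e]. Each halving
    of [e] thus adds a fixed amount. *)
Lemma wedge_moment_grow e q d : (0 < m)%N -> (0 < e)%R -> (e <= 1)%R -> (0 < q)%R -> (0 < d)%R ->
  wedge_moment e q d + (((k%:R * (k.+1%:R * (q + 2 * d))) ^+ m)^-1)%:E * lam (wedge q d) <=
  wedge_moment (e / 2) q d.
Proof.
move=> m0 e0 e1 q0 d0; rewrite wedge_moment_half.
have dd : (d <= 2 * d)%R by lra.
rewrite (wedge_moment_split e q dd); apply: leeD2l.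
have mD := measurableD (measurable_wedge q (2 * d)) (measurable_wedge q d).
have Rge0 : (0 <= k%:R * (k.+1%:R * (q + 2 * d)))%R.
  by rewrite !mulr_ge0// addr_ge0 ?mulr_ge0// ltW.
have C0 : (0 <= ((k%:R * (k.+1%:R * (q + 2 * d))) ^+ m)^-1)%R by rewrite invr_ge0 exprn_ge0.
have Wfin : lam (wedge q d) \is a fin_num.
  by rewrite ge0_fin_numE ?measure_ge0// lebesgue_wedge_lty// ltW.
have diff : lam (wedge q d) <= lam (wedge q (2 * d) `\` wedge q d).
  have E2 : lam (wedge q (2 * d)) = lam (wedge q d) + lam (wedge q (2 * d) `\` wedge q d).
    rewrite -measureU//; [|exact: measurable_wedge|].
      by rewrite setDUK//; exact: wedge_subset.
    by apply/seteqP; split=> // c [? []].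
  have := @lebesgue_wedge_scale 1 2 q d ltr01 (ltr0Sn _ 1).
  rewrite mul1r expr1n mul1r E2 => E3.
  have Dfin : lam (wedge q (2 * d) `\` wedge q d) \is a fin_num.
    rewrite ge0_fin_numE ?measure_ge0//; apply: (@le_lt_trans _ _ (lam (wedge q (2 * d)))).
      by rewrite E2 leeDr// measure_ge0.
    by rewrite lebesgue_wedge_lty ?mulr_ge0// ltW.
  have : (2 <= 2 ^+ m :> R)%R by rewrite -[leLHS]expr1 ler_weXn2l// ler1n.
  have : (0 <= fine (lam (wedge q d)))%R by rewrite fine_ge0.
  move: E3; rewrite -(fineK Wfin) -(fineK Dfin) -EFinD -EFinM lee_fin/=.
  move: (fine _) (fine _) (2 ^+ m)%R => x z y -[E3] x0 y2; nra.
apply: (le_trans (lee_wpmul2l _ diff)); first by rewrite lee_fin.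
rewrite -integral_cst//; apply: ge0_le_integral => //.
- by apply: measurable_funTS; exact: measurable_dilation_moment.
- move=> c [Wc nW]; rewrite lee_fin.
  have cn : (enorm (c *m dilation e 1) <= enorm c)%R.
    rewrite ler_wsqrtr//; apply: ler_sum => j _; rewrite dilationE exprMn ler_piMl ?sqr_ge0//.
    by case: ifP => _; rewrite ?expr1n// exprn_ile1// ltW.
  have c0 : c != 0%R.
    apply/eqP => c0; apply: nW; apply: wedge_small; rewrite ?ltW// => j.
    by rewrite c0 mxE normr0; case: ifP => _; rewrite divr_ge0// ltW.
  have cd0 : (c *m dilation e 1 != 0)%R.
    apply/eqP => cd; have : (c *m dilation e 1 *m dilation e^-1 1 = 0)%R by rewrite cd mul0mx.
    by rewrite dilationM mulVf ?gt_eqF// mulr1 dilation_scalar scale1r; exact/eqP.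
  rewrite lef_pV2 ?posrE ?exprn_gt0 ?enorm_gt0//; last first.
    rewrite -enorm_gt0 in c0; apply: lt_le_trans c0 _.
    by apply: wedge_enorm_le Wc; rewrite ?mulr_ge0 ?(ltW q0)// ltW.
  apply: lerXn2r; rewrite ?nnegrE ?sqrtr_ge0//; apply: (le_trans cn).
  by apply: wedge_enorm_le Wc; rewrite ?mulr_ge0 ?(ltW q0)// ltW.
Qed.

Lemma wedge_moment_unbounded q d (A : R) : (0 < m)%N -> (0 < q)%R -> (0 < d)%R ->
  exists2 e, (0 < e)%R & A%:E <= wedge_moment e q d.
Proof.
move=> m0 q0 d0.
set c := (((k%:R * (k.+1%:R * (q + 2 * d))) ^+ m)^-1)%:E * lam (wedge q d).
have k0 : (0 < k)%N by rewrite -imk addn_gt0 m0 orbT.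
have Wfin : lam (wedge q d) \is a fin_num.
  by rewrite ge0_fin_numE ?measure_ge0// lebesgue_wedge_lty// ltW.
have cfin : c \is a fin_num by rewrite fin_numM.
have c0 : (0 < fine c)%R.
  rewrite fine_gt0// ltey_eq cfin andbT mule_gt0 ?lebesgue_wedge_gt0//.
  by rewrite lte_fin invr_gt0 exprn_gt0// !mulr_gt0 ?ltr0n// addr_gt0// mulr_gt0.
have H N : (N%:R * fine c)%:E <= wedge_moment (2^-1 ^+ N) q d.
  elim: N => [|N IH].
    by rewrite mul0r; apply: integral_ge0 => x _; exact: wedge_weight_ge0.
  have e0 : (0 < 2^-1 ^+ N :> R)%R by rewrite exprn_gt0.
  have e1 : (2^-1 ^+ N <= 1 :> R)%R by rewrite exprn_ile1// invf_le1// ler1n.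
  have := wedge_moment_grow m0 e0 e1 q0 d0; rewrite -/c exprSr; apply: le_trans.
  by rewrite -natr1 mulrDl mul1r EFinD (fineK cfin) leeD2r.
have [N AN] : exists N : nat, (A <= N%:R * fine c)%R.
  exists (Num.truncn `|A / fine c|%R).+1.
  rewrite -ler_pdivrMr// (le_trans (ler_norm _))// ltW//.
  exact: truncnS_gt.
exists (2^-1 ^+ N)%R; first by rewrite exprn_gt0.
by apply: le_trans (H N); rewrite lee_fin.
Qed.

(* Up to an error that stays bounded as e tends to 0, the moment only depends on
   the size q of the thin directions, through the factor q^i. *)
Lemma wedge_moment_ratio (q q' d d' C : R) : (0 < q)%R -> (0 < q')%R -> (0 < d)%R ->
  (q' <= q)%R -> (d <= d')%R -> ((q' / q) ^+ i < C)%R ->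
  (forall e, (0 < e)%R -> wedge_moment e q d < +oo) ->
  exists2 e, (0 < e)%R & wedge_moment e q' d' < C%:E * wedge_moment e q d.
Proof.
move=> q0 q'0 d0 qq' dd' rC Wlty.
(* Homogeneity brings [(q', d')] to [(q, d' / t)] at the cost of [t ^+ i], after which only the
   thick sizes differ. *)
set t := (q' / q)%R in rC *.
have t0 : (0 < t)%R by rewrite divr_gt0.
have t1 : (t <= 1)%R by rewrite ler_pdivrMr// mul1r.
have d'0 : (0 < d')%R by exact: lt_le_trans dd'.
have dt : (d <= d' / t)%R by rewrite ler_pdivlMr// (le_trans _ dd')// ler_piMr// ltW.
have dt0 : (0 < d' / t)%R by rewrite divr_gt0.
have tq : (t * q = q')%R by rewrite /t divfK// gt_eqF.
have td : (t * (d' / t) = d')%R by rewrite mulrC divfK// gt_eqF.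
have Eq e : wedge_moment e q' d' = (t ^+ i)%:E * wedge_moment e q (d' / t).
  by rewrite -(wedge_moment_scale e q _ t0) tq td.
have Wge0 e (p r : R) : 0 <= wedge_moment e p r.
  by apply: integral_ge0 => x _; exact: wedge_weight_ge0.
have Wfin e : (0 < e)%R -> wedge_moment e q d \is a fin_num.
  by move=> e0; rewrite ge0_fin_numE// Wlty.
have ti0 : (0 <= t ^+ i)%R by rewrite exprn_ge0// ltW.
(* For [m > 0] the moment tends to infinity and swamps the bounded error. For [m = 0] there is no
   thick direction: the moment is a volume that does not depend on [d]. *)
have [m0|m0] := posnP m; last first.
  set r := (((d / k.+1%:R) ^+ m)^-1)%:E * lam (wedge q (d' / t)).
  have rfin : r \is a fin_num.
    by rewrite fin_numM// ge0_fin_numE ?measure_ge0// lebesgue_wedge_lty// ltW.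
  have [e e0 He] := wedge_moment_unbounded ((t ^+ i * fine r + 1) / (C - t ^+ i))%R m0 q0 d0.
  exists e => //; rewrite Eq.
  have := wedge_moment_le e (ltW q0) d0 dt; rewrite -/r => Hle.
  apply: (@le_lt_trans _ _ ((t ^+ i)%:E * (wedge_moment e q d + r))).
    by apply: lee_wpmul2l => //; rewrite lee_fin.
  move: He; rewrite -(fineK rfin) -(fineK (Wfin e e0)) -EFinD -!EFinM lee_fin lte_fin.
  rewrite ler_pdivrMr ?subr_gt0//=; move: (fine _) (fine _) (t ^+ i)%R => x y z; lra.
exists 1%R => //; rewrite Eq.
have E1 p : wedge_moment 1 q p = lam (wedge q p).
  rewrite /wedge_moment m0; under eq_integral do rewrite expr0 invr1.
  by rewrite integral_cst ?mul1e//; exact: measurable_wedge.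
have -> : wedge_moment 1 q (d' / t) = wedge_moment 1 q d.
  have dt' : (0 < d' / t / d)%R by rewrite divr_gt0.
  rewrite !E1 -[in LHS](mul1r q) -[X in wedge _ X](divfK (_ : d != 0%R)) ?gt_eqF//.
  by rewrite lebesgue_wedge_scale// m0 expr0 expr1n mul1r mul1e.
have W0 : 0 < wedge_moment 1 q d by rewrite E1 lebesgue_wedge_gt0.
by rewrite lte_pmul2r ?Wfin// lte_fin.
Qed.

End anisotropic_dilation.

(** * Symmetries and the centroid of a simplex *)

Section centroid_symmetry.
Context {R : realType} {n : nat}.
Local Notation lam := (@lebesgue_rV R n).
Variable K : set 'rV[R]_n.
Hypothesis cK : compact K.

Let mK : measurable K. Proof. exact: compact_rV_measurable. Qed.

Hypothesis K0 : (0 < lam K)%E.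

(** A linear bijection that preserves a set of finite positive volume has factor 1; it can then be
    substituted in the coordinate integrals, split into positive and negative parts. *)
Lemma centroid_symmetric (S : 'M[R]_n) : S \in unitmx ->
  (forall x, K (x *m S) <-> K x) -> centroid K *m S = centroid K.
Proof.
move=> uS KS; have [c c0 Hc] := ge0_integral_rV_linear uS.
have c1 : c = 1.
  have I0 (x : 'rV[R]_n) : (0 <= (\1_K x : R)%:E)%E by rewrite lee_fin.
  have := Hc _ (measurable_EFin_indic mK) I0.
  rewrite [X in (_ * X)%E]integral_indic// setIT integral_indic_comp; last first.
    by rewrite -[X in measurable X]setTI; exact: (measurable_mulmxr _ measurableT).
  rewrite (_ : [set x | K (x *m S)] = K); last by apply/seteqP; split=> x /KS.
  have Kfin : lam K \is a fin_num.
    by rewrite ge0_fin_numE ?measure_ge0// compact_rV_lty.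
  have f0 : fine (lam K) != 0 by rewrite gt_eqF// fine_gt0// K0 compact_rV_lty.
  move=> H; have : lam K = (c%:E * lam K)%E by exact: H.
  rewrite -(fineK Kfin) -EFinM => -[/(congr1 (fun r => r / fine (lam K)))].
  by rewrite mulfK// divff.
have inv (f : 'rV[R]_n -> \bar R) : measurable_fun setT f ->
    (\int[lam]_x f (x *m S) = \int[lam]_x f x)%E.
  move=> mf; rewrite integralE [RHS]integralE; congr (_ - _)%E.
    have := Hc _ (measurable_funepos mf) (funepos_ge0 f); rewrite c1 mul1e => <-.
    by apply: eq_integral => x _; rewrite !funeposE.
  have := Hc _ (measurable_funeneg mf) (funeneg_ge0 f); rewrite c1 mul1e => <-.
  by apply: eq_integral => x _; rewrite !funenegE.
rewrite /centroid -scalemxAl; congr (_ *: _); apply/rowP => j.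
rewrite [LHS]mxE [RHS]mxE.
under eq_bigr do rewrite mxE.
have := Rintegral_mulmx cK (col j S).
under [X in _ = X -> _]eq_bigr do rewrite mxE.
move=> <-; rewrite /Rintegral; congr fine.
rewrite integral_mkcond [RHS]integral_mkcond.
rewrite -[RHS]inv; last first.
  apply/(measurable_restrictT _ mK); apply: measurable_funTS.
  by apply/measurable_EFinP; exact: measurable_coord.
apply: eq_integral => x _; rewrite !patchE.
have -> : (x *m S \in K) = (x \in K) by apply/idP/idP; rewrite !inE => /KS.
case: ifP => // _; congr (_%:E); rewrite !mxE; apply: eq_bigr => a _.
by rewrite !mxE.
Qed.

End centroid_symmetry.

Section barycentric.
Context {R : realType} {n : nat}.

(* The rows are e_a - e_n, so that y *m bary runs through the vectors of R^(n+1)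
   with zero sum: the displacements in barycentric coordinates. *)
Definition bary : 'M[R]_(n, n.+1) :=
  \matrix_(a, j) ((j == a :> nat)%:R - (j == n :> nat)%:R).

Definition unbary : 'M[R]_(n.+1, n) := \matrix_(j, a) (j == a :> nat)%:R.

Lemma mul_unbary p (A : 'M[R]_(p, n.+1)) l a :
  (A *m unbary) l a = A l (widen_ord (leqnSn n) a).
Proof.
rewrite mxE (bigD1 (widen_ord (leqnSn n) a))//= big1 => [|j ja].
  by rewrite mxE/= eqxx mulr1 addr0.
rewrite mxE; case: eqP => [ja'|]; last by rewrite mulr0.
by case/eqP: ja; apply/val_inj.
Qed.

Lemma mul_bary_widen p (A : 'M[R]_(p, n)) l a :
  (A *m bary) l (widen_ord (leqnSn n) a) = A l a.
Proof.
rewrite mxE (bigD1 a)//= big1 => [|b ba].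
  by rewrite mxE/= eqxx (ltn_eqF (ltn_ord a)) subr0 mulr1 addr0.
rewrite mxE/= (ltn_eqF (ltn_ord a)) subr0; case: eqP => [ab|]; last by rewrite mulr0.
by case/eqP: ba; apply/val_inj.
Qed.

Lemma mul_bary_max p (A : 'M[R]_(p, n)) l : (A *m bary) l ord_max = - \sum_a A l a.
Proof.
rewrite mxE -sumrN; apply: eq_bigr => a _; rewrite mxE/= eqxx.
by rewrite (gtn_eqF (ltn_ord a)) sub0r mulrN1.
Qed.

Lemma bary_sum p (A : 'M[R]_(p, n)) l : \sum_j (A *m bary) l j = 0.
Proof.
rewrite big_ord_recr/= mul_bary_max; under eq_bigr do rewrite mul_bary_widen.
by rewrite subrr.
Qed.

Lemma baryK : bary *m unbary = 1%:M.
Proof.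
apply/matrixP => a b; rewrite mul_unbary mxE/= (ltn_eqF (ltn_ord b)) subr0 mxE.
by rewrite eq_sym.
Qed.

Lemma unbaryK p (A : 'M[R]_(p, n.+1)) : (forall l, \sum_j A l j = 0) ->
  A *m unbary *m bary = A.
Proof.
move=> A0; apply/matrixP => l j.
have W b : (A *m unbary *m bary) l (widen_ord (leqnSn n) b) = A l (widen_ord (leqnSn n) b).
  by rewrite mul_bary_widen mul_unbary.
have [jn|jn] := ltnP j n.
  by rewrite (_ : j = widen_ord (leqnSn n) (Ordinal jn)) ?W//; exact/val_inj.
have -> : j = ord_max by apply/val_inj/eqP; rewrite /= eqn_leq jn -ltnS ltn_ord.
apply: (addrI (\sum_(b < n) A l (widen_ord (leqnSn n) b))).
have H1 := A0 l; have H2 := bary_sum (A *m unbary) l.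
rewrite big_ord_recr/= in H1; rewrite big_ord_recr/= (eq_bigr _ (fun b _ => W b)) in H2.
by rewrite H2 H1.
Qed.

Variable M : 'M[R]_n.
Hypothesis uM : M \in unitmx.

(** All barycentric coordinates, [1/(n+1)] at the origin, are required to be nonnegative. The matrix
    [M] leaves the position of the simplex free, so that prescribed directions can be placed in
    [E]. *)
Definition bary_simplex : set 'rV[R]_n :=
  [set x | forall j, 0 <= n.+1%:R^-1 + (x *m (M *m bary)) 0 j].

Lemma bary_simplex_le1 x j : bary_simplex x -> n.+1%:R^-1 + (x *m (M *m bary)) 0 j <= 1.
Proof.
move=> Kx; have s1 : \sum_j (n.+1%:R^-1 + (x *m (M *m bary)) 0 j) = 1 :> R.
  rewrite big_split/= sumr_const card_ord mulmxA bary_sum addr0 -[LHS]mulr_natr mulVf//.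
by rewrite -[leRHS]s1 (bigD1 j)//= lerDl sumr_ge0.
Qed.

Lemma bary_simplex_compact : compact bary_simplex.
Proof.
have n1 : (n.+1%:R^-1 <= 1 :> R) by rewrite invf_le1 ?ltr0n// ler1n.
have n0 : (0 <= n.+1%:R^-1 :> R) by rewrite invr_ge0.
apply: bounded_closed_compact.
  pose P := unbary *m invmx M.
  exists (\sum_j \sum_k `|P k j|); split; first exact: num_real.
  move=> b Pb x Kx; apply: le_trans (ltW Pb).
  have -> : x = x *m (M *m bary) *m P.
    by rewrite /P !mulmxA -(mulmxA _ bary) baryK mulmx1 mulmxK.
  rewrite (le_trans (mulmx_norm_le _ _))// ler_piMl//.
    by apply: sumr_ge0 => j _; exact: sumr_ge0.
  apply/rV_norm_leP => // j; have := Kx j; have := bary_simplex_le1 j Kx.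
  move: ((x *m (M *m bary)) 0 j) (n.+1%:R^-1) n1 n0 => y w w1 w0 H1 H2.
  by rewrite ler_norml; apply/andP; split; lra.
rewrite (_ : bary_simplex = \bigcap_(j in [set: 'I_n.+1])
    [set x | [set y : 'rV[R]_n.+1 | 0 <= y 0 j] (const_mx n.+1%:R^-1 + x *m (M *m bary))]).
  apply: closed_bigI => j _; apply: closed_affine_preimage.
  rewrite -openC openE => y /= /negP; rewrite -ltNge => yj.
  have e0 : 0 < - y 0 j by rewrite oppr_gt0.
  apply/nbhs_ballP; exists (- y 0 j) => // z; rewrite -ball_normE/= => /(rV_norm_ltP _ e0)/(_ j).
  by rewrite !mxE ltr_norml => /andP[+ _] /=; rewrite opprK => h1; apply/negP; rewrite -ltNge; lra.
apply/seteqP; split=> x /= H j.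
  by move=> _; have := H j; rewrite /= !mxE.
by have := H j Logic.I; rewrite /= !mxE.
Qed.

Lemma bary_simplex_nbhs : nbhs (0 : 'rV[R]_n) bary_simplex.
Proof.
pose C := \sum_j \sum_k `|(M *m bary) k j| + 1.
have C0 : 0 < C by rewrite ltr_wpDl// sumr_ge0// => j _; rewrite sumr_ge0.
have n0 : (0 < n.+1%:R^-1 :> R) by rewrite invr_gt0.
apply/nbhs_ballP; exists (n.+1%:R^-1 / C); first by rewrite /= divr_gt0.
move=> x; rewrite -ball_normE/= sub0r normrN ltr_pdivlMr// => xC j.
have : `|(x *m (M *m bary)) 0 j| <= `|x| * C.
  rewrite (le_trans (rV_coord_le _ j))// (le_trans (mulmx_norm_le _ _))//.
  by rewrite ler_wpM2l// lerDl.
move=> /le_lt_trans/(_ xC); rewrite ltr_norml => /andP[h _].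
by rewrite -lerBlDl sub0r ltW.
Qed.

Lemma bary_simplex_convex_body : convex_body bary_simplex.
Proof.
split; [|exact: bary_simplex_compact|by exists 0; exact: bary_simplex_nbhs].
move=> x y t; rewrite !inE => Kx Ky.
change (bary_simplex (t%:num *: x + (1 - t%:num) *: y)) => j.
have t0 : 0 <= t%:num by [].
have t1 : t%:num <= 1 by [].
have := Kx j; have := Ky j; rewrite mulmxDl -!scalemxAl !mxE.
set u := \sum_j0 _; set v := \sum_j0 _; set w := n.+1%:R^-1.
by move=> h1 h2; nra.
Qed.

(** Every permutation of the vertices is a linear symmetry, so the displacement of the centroid has
    equal barycentric components; their sum being 0, they vanish. *)
Lemma bary_simplex_centroid : centroid bary_simplex = 0.
Proof.
set g := centroid _; pose W := M *m bary.
have WU : W *m unbary = M by rewrite -mulmxA baryK mulmx1.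
have K0 : (0 < lebesgue_rV n bary_simplex)%E.
  apply: (@nbhs_lebesgue_rV_gt0 _ _ _ 0); last exact: bary_simplex_nbhs.
  by apply: compact_rV_measurable; exact: bary_simplex_compact.
have mul_perm_mxE p (A : 'M[R]_(p, n.+1)) (t : {perm 'I_n.+1}) l j :
    (A *m perm_mx t) l j = A l (t^-1%g j).
  by rewrite -[t in LHS]invgK -col_permE mxE.
have sym (s : {perm 'I_n.+1}) : g *m W *m perm_mx s = g *m W.
  have P0 (t : {perm 'I_n.+1}) l : \sum_j (bary *m perm_mx t) l j = 0.
    under eq_bigr do rewrite mul_perm_mxE.
    rewrite -(_ : \sum_j bary l j = \sum_j bary l (t^-1%g j)); last first.
      by rewrite (reindex_inj (@perm_inj _ t^-1%g)).
    by have := bary_sum (1%:M : 'M[R]_n) l; rewrite mul1mx.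
  (* The permutation read in R^n, which is possible because permuting coordinates preserves a zero
     sum; [S] is its conjugate by [M]. *)
  pose T t := bary *m perm_mx t *m unbary.
  have TT t : T t *m bary = bary *m perm_mx t by rewrite unbaryK.
  have Tinv t : T t *m T (t^-1%g) = 1%:M.
    rewrite {2}/T !mulmxA TT -!mulmxA (mulmxA (perm_mx t)) -perm_mxM mulgV perm_mx1.
    by rewrite mul1mx baryK.
  have uT t : T t \in unitmx by have /mulmx1_unit[] := Tinv t.
  pose S := M *m T s *m invmx M.
  have uS : S \in unitmx by rewrite !unitmx_mul uM uT unitmx_inv uM.
  have SW : S *m W = W *m perm_mx s.
    rewrite /S /W -(mulmxA _ (invmx M)) (mulmxA (invmx M)) mulVmx// mul1mx.
    by rewrite -(mulmxA M (T s)) TT mulmxA.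
  have KS x : bary_simplex (x *m S) <-> bary_simplex x.
    have E j : (x *m S *m W) 0 j = (x *m W) 0 (s^-1%g j).
      by rewrite -mulmxA SW mulmxA mul_perm_mxE.
    split=> H j; last by rewrite -/W E; exact: H.
    by have := H (s j); rewrite -/W E permK.
  have := centroid_symmetric bary_simplex_compact K0 uS KS; rewrite -/g => gS.
  by rewrite -{2}gS -(mulmxA _ S) SW mulmxA.
have gW j : (g *m W) 0 j = (g *m W) 0 ord_max.
  have := congr1 (fun A : 'rV[R]_n.+1 => A 0 j) (sym (tperm j ord_max)).
  by rewrite mul_perm_mxE tpermV tpermL.
have gW0 : g *m W = 0.
  apply/rowP => j; rewrite [RHS]mxE; have := bary_sum (g *m M) 0; rewrite -mulmxA -/W.
  under eq_bigr do rewrite gW; rewrite sumr_const card_ord => /eqP.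
  by rewrite mulrn_eq0/= -(gW j) => /eqP.
have : g *m M = 0 by rewrite -WU mulmxA gW0 mul0mx.
by move=> /(congr1 (mulmx^~ (invmx M))); rewrite mulmxK// mul0mx.
Qed.

End barycentric.

(** * The thin simplex and its sections *)

Section thin_simplex.
Context {R : realType} {n k : nat}.
Variables i m : nat.
Hypothesis imk : (i + m = k)%N.
Hypothesis kn : (k < n)%N.

(* The first i rows only move the barycentric coordinates 0, .., i (a face of
   dimension i), the others only the coordinates i+1, .., n: the sections of the
   simplex along these rows are products of two simplices. *)
Definition thin_frame : 'M[R]_(k, n) :=
  \matrix_(l, a) if (l < i)%N then (a == l :> nat)%:R - (a == i :> nat)%:R
                 else (a == l.+1 :> nat)%:R.

Lemma thin_frame_lt (t : 'rV[R]_k) (a : 'I_n) (l : 'I_k) : (l < i)%N -> a = l :> nat ->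
  (t *m thin_frame) 0 a = t 0 l.
Proof.
move=> li al; rewrite mxE (bigD1 l)//= big1 => [|b bl].
  rewrite mxE li al eqxx (_ : (_ == i) = false) ?subr0 ?mulr1 ?addr0//; lia.
have {}bl : (l : nat) != b by rewrite eq_sym.
rewrite mxE al; case: ifP => bi.
  rewrite (negbTE bl) (_ : (_ == i) = false) ?subr0 ?mulr0//; lia.
rewrite (_ : (_ == b.+1) = false) ?mulr0//; lia.
Qed.

Lemma thin_frame_eq (t : 'rV[R]_k) (a : 'I_n) : a = i :> nat ->
  (t *m thin_frame) 0 a = - \sum_(l < k | (l < i)%N) t 0 l.
Proof.
move=> ai; rewrite mxE [X in _ = - X]big_mkcond -sumrN; apply: eq_bigr => l _.
rewrite mxE ai eqxx; case: ifP => li.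
  by rewrite (_ : (i == l) = false) ?sub0r ?mulrN1//; lia.
by rewrite (_ : (i == l.+1) = false) ?mulr0 ?oppr0//; lia.
Qed.

Lemma thin_frame_gt (t : 'rV[R]_k) (a : 'I_n) (l : 'I_k) : ~~ (l < i)%N -> a = l.+1 :> nat ->
  (t *m thin_frame) 0 a = t 0 l.
Proof.
move=> li al; rewrite mxE (bigD1 l)//= big1 => [|b bl].
  by rewrite mxE (negbTE li) al eqxx mulr1 addr0.
have {}bl : (l : nat) != b by rewrite eq_sym.
have [h1 h2] : ((l.+1 == i) = false) * ((l.+1 == b.+1) = false) by split; lia.
rewrite mxE al h1 h2; case: ifP => bi; last by rewrite mulr0.
have h3 : (l.+1 == b) = false by lia.
by rewrite h3 subr0 mulr0.
Qed.

Lemma thin_frame_big (t : 'rV[R]_k) (a : 'I_n) : (k < a)%N -> (t *m thin_frame) 0 a = 0.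
Proof.
move=> ka; rewrite mxE big1// => b _; have bk := ltn_ord b.
have h1 : (a == i :> nat) = false by lia.
have h2 : (a == b :> nat) = false by lia.
have h3 : (a == b.+1 :> nat) = false by lia.
by rewrite mxE h1 h2 h3 subr0 if_same mulr0.
Qed.

Lemma thin_frame_sum (t : 'rV[R]_k) :
  \sum_a (t *m thin_frame) 0 a = \sum_(l < k | ~~ (l < i)%N) t 0 l.
Proof.
have delta c : (c < n)%N -> \sum_(a < n) (a == c :> nat)%:R = 1 :> R.
  move=> cn; rewrite (bigD1 (Ordinal cn))//= eqxx big1 ?addr0// => a ac.
  by rewrite (_ : (_ == c) = false)//; apply/negbTE; move: ac; rewrite -val_eqE.
under eq_bigr do rewrite mxE.
rewrite exchange_big/= [RHS]big_mkcond; apply: eq_bigr => l _.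
have lk := ltn_ord l.
rewrite -mulr_sumr; under eq_bigr do rewrite mxE.
case: (boolP (l < i)%N) => li /=.
  by rewrite sumrB !delta ?subrr ?mulr0//; lia.
by rewrite delta ?mulr1//; lia.
Qed.

Lemma thin_frame_free : row_free thin_frame.
Proof.
apply: inj_row_free => t t0; apply/rowP => l; rewrite [RHS]mxE.
have lk := ltn_ord l.
have [li|li] := boolP (l < i)%N.
  have ln : (l < n)%N by lia.
  by rewrite -(@thin_frame_lt t (Ordinal ln) l li)// t0 mxE.
have ln : (l.+1 < n)%N by lia.
by rewrite -(@thin_frame_gt t (Ordinal ln) l li)// t0 mxE.
Qed.

(** Coordinates below [i] and from [i+1] to [k] give the lower bounds of the two factors,
    coordinates [i] and [n] their sum conditions. Those strictly between [k] and [n] do not move and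
    only ask for [0 <= d]. *)
Lemma wedge_thin_frame (q d : R) (t : 'rV[R]_k) : 0 <= d ->
  (forall j : 'I_n.+1, 0 <= (if (j <= i)%N then q else d) + (t *m (thin_frame *m bary)) 0 j) <->
  wedge i q d t.
Proof.
move=> d0; rewrite mulmxA; split=> H.
  have Hw (a : 'I_n) := H (widen_ord (leqnSn n) a).
  have {}Hw (a : 'I_n) : 0 <= (if (a <= i)%N then q else d) + (t *m thin_frame) 0 a.
    by have := Hw a; rewrite mul_bary_widen.
  split.
  - move=> l; have lk := ltn_ord l; have [li|li] := boolP (l < i)%N.
      have ln : (l < n)%N by lia.
      have := Hw (Ordinal ln); rewrite (@thin_frame_lt t _ l li)//=.
      by rewrite (ltnW li).
    have ln : (l.+1 < n)%N by lia.
    have := Hw (Ordinal ln); rewrite (@thin_frame_gt t _ l li)//=.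
    by rewrite (negbTE (_ : ~~ (l < i)%N)).
  - have ln : (i < n)%N by lia.
    by have := Hw (Ordinal ln); rewrite thin_frame_eq//= leqnn subr_ge0.
  - have := H ord_max; rewrite mul_bary_max thin_frame_sum/= subr_ge0.
    by rewrite (_ : (n <= i)%N = false)//; lia.
have [H1 H2 H3] := H => j.
have [jn|jn] := ltnP j n; last first.
  have -> : j = ord_max by apply/val_inj/eqP; rewrite /= eqn_leq jn -ltnS ltn_ord.
  rewrite mul_bary_max thin_frame_sum/= subr_ge0.
  by rewrite (_ : (n <= i)%N = false)//; lia.
rewrite (_ : j = widen_ord (leqnSn n) (Ordinal jn)); last exact/val_inj.
rewrite mul_bary_widen /=.
have [ji|ji|ji] := ltngtP j i.
- have jk : (j < k)%N by lia.
  by rewrite (@thin_frame_lt t _ (Ordinal jk))//; have := H1 (Ordinal jk); rewrite /= ji.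
- have [jk|jk] := leqP j k; last by rewrite thin_frame_big// addr0.
  have jk' : (j.-1 < k)%N by lia.
  have ji' : ~~ (j.-1 < i)%N by lia.
  rewrite (@thin_frame_gt t _ (Ordinal jk'))//=; last by lia.
  by have := H1 (Ordinal jk'); rewrite /= (negbTE ji').
- by rewrite thin_frame_eq// subr_ge0.
Qed.

End thin_simplex.

Lemma sum_if_leq (R : realType) n i p (q d : R) : (i.+1 + p = n)%N ->
  \sum_(a < n) (if (a <= i)%N then q else d) = i.+1%:R * q + p%:R * d.
Proof.
move=> <-; rewrite big_split_ord/=; congr (_ + _).
  rewrite (eq_bigr (fun=> q)) ?sumr_const ?card_ord ?mulr_natl// => a _.
  by rewrite -ltnS ltn_ord.
rewrite (eq_bigr (fun=> d)) ?sumr_const ?card_ord ?mulr_natl// => a _.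
by rewrite (_ : (_ <= i)%N = false)//; lia.
Qed.

Section thin_body.
Context {R : realType} {n : nat}.
Variable E : {vspace 'rV[R]_n}.
Local Notation k := (\dim E).
Variables i m : nat.
Hypothesis imk : (i + m = k)%N.
Hypothesis kn : (k < n)%N.

(** The relation on [q] and [d] says that [i+1] barycentric coordinates [q] and [n-i] coordinates
    [d] sum to 1; one and the same simplex thus shows wedges of all these sizes, the case [q = d] at
    its centroid. *)
Lemma thin_body_exists (e : R) : 0 < e -> exists K : set 'rV[R]_n,
  [/\ convex_body K, centroid K = 0 &
    forall q d, 0 <= q -> 0 <= d -> i.+1%:R * q + (n - i)%:R * d = 1 ->
    exists x, [/\ K x, (q = d -> x = 0) &
      @chord_set R n K E x = [set c | wedge i q d (c *m dilation i e^-1 1)]]].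
Proof.
move=> e0; pose N := dilation i e^-1 1 *m thin_frame i : 'M[R]_(k, n).
have BB := frame_orthonormal E.
have rB : row_free (frame E).
  by apply: inj_row_free => v vB; rewrite -[v]mulmx1 -BB mulmxA vB mul0mx.
have rN : row_free N.
  apply: inj_row_free => v; rewrite /N mulmxA => vN.
  have : v *m dilation i e^-1 1 = 0.
    by apply: (row_free_inj (@thin_frame_free R n k i m imk kn)); rewrite vN mul0mx.
  move=> /(congr1 (mulmx^~ (dilation i e 1))).
  by rewrite mul0mx dilationM mulfV ?gt_eqF// mulr1 dilation_scalar scale1r.
(* [M] sends the frame of [E] to the thin frame stretched by [e^-1] in its first [i] rows, so that
   in frame coordinates the sections are thin by [e]. *)
have [|M uM HM] := @complete_unitmx _ _ _ (frame E) ((frame E)^T *m N).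
  by rewrite mulmxA BB mul1mx; move: rN rB; rewrite /row_free => /eqP -> /eqP ->.
have {}HM : frame E *m M = N by rewrite -HM mulmxA BB mul1mx.
exists (bary_simplex M); split.
- exact: bary_simplex_convex_body.
- exact: bary_simplex_centroid.
move=> q d q0 d0 qd.
pose y : 'rV[R]_n := \row_a ((if (a <= i)%N then q else d) - n.+1%:R^-1).
pose x := y *m invmx M.
have ni : (i < n)%N by lia.
have sy : \sum_a y 0 a = n.+1%:R^-1 - d.
  under eq_bigr do rewrite mxE.
  rewrite sumrB sumr_const card_ord -[_ *+ n]mulr_natl.
  have -> : \sum_(a < n) (if (a <= i)%N then q else d) = 1 - d.
    have in' : (i.+1 + (n - i.+1) = n)%N by lia.
    have -> : \sum_(a < n) (if (a <= i)%N then q else d) = i.+1%:R * q + (n - i.+1)%:R * d.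
      exact: sum_if_leq.
    have nE : (n - i = (n - i.+1).+1)%N by lia.
    move: qd; rewrite nE -[(n - i.+1).+1%:R]natr1 mulrDl mul1r.
    by move: (_ * q) (_ * d) => u v; lra.
  have n1 : n.+1%:R != 0 :> R by rewrite pnatr_eq0.
  by rewrite -natr1 in n1 *; field.
have xE j : n.+1%:R^-1 + (x *m (M *m bary)) 0 j = if (j <= i)%N then q else d.
  rewrite mulmxA /x mulmxKV//.
  have [jn|jn] := ltnP j n; last first.
    have -> : j = ord_max by apply/val_inj/eqP; rewrite /= eqn_leq jn -ltnS ltn_ord.
    rewrite mul_bary_max sy (_ : (_ <= i)%N = false) /=; last by lia.
    by rewrite opprB addrC subrK.
  rewrite (_ : j = widen_ord (leqnSn n) (Ordinal jn)); last exact/val_inj.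
  by rewrite mul_bary_widen mxE/= addrC subrK.
exists x; split.
- by move=> j; rewrite xE; case: ifP.
- move=> qde; rewrite /x; suff -> : y = 0 by rewrite mul0mx.
  apply/rowP => a; rewrite !mxE qde if_same; apply/eqP; rewrite subr_eq0; apply/eqP.
  have -> : n.+1 = (i.+1 + (n - i))%N by lia.
  have H : (i.+1 + (n - i))%:R * d = 1 by rewrite natrD mulrDl -{1}qde.
  have n1 : (i.+1 + (n - i))%:R != 0 :> R by rewrite pnatr_eq0.
  by apply: (mulfI n1); rewrite H mulfV.
have E1 (c : 'rV[R]_k) (j : 'I_n.+1) :
    n.+1%:R^-1 + ((x + c *m frame E) *m (M *m bary)) 0 j =
    (if (j <= i)%N then q else d) + (c *m dilation i e^-1 1 *m (thin_frame i *m bary)) 0 j.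
  rewrite mulmxDl [X in _ + X]mxE addrA xE; congr (_ + _).
  by rewrite !mulmxA -(mulmxA c _ M) HM /N !mulmxA.
have W c := @wedge_thin_frame R n k i m imk kn q d (c *m dilation i e^-1 1) d0.
apply/seteqP; split=> c; rewrite /chord_set/=.
  by move=> Kc; apply/W => j; have := Kc j; rewrite E1.
by move=> /W H j; rewrite E1.
Qed.

End thin_body.

Lemma bernoulli_sub (R : realFieldType) (x : R) i : 0 <= x -> x <= 1 ->
  1 - i%:R * x <= (1 - x) ^+ i.
Proof.
move=> x0 x1; elim: i => [|i IH]; first by rewrite mul0r subr0 expr0.
have y0 : 0 <= 1 - x by rewrite subr_ge0.
rewrite exprS; apply: le_trans (ler_wpM2l y0 IH).
rewrite -subr_ge0 -natr1 (_ : _ - _ = i%:R * x ^+ 2); last by ring.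
by rewrite mulr_ge0// sqr_ge0.
Qed.

Section chord_volume_wedges.
Context {R : realType} {n : nat}.
Variables (K : set 'rV[R]_n) (E : {vspace 'rV[R]_n}).
Hypothesis cK : compact K.
Hypothesis sK : segment_closed K.
Local Notation k := (\dim E).
Hypothesis dE : (0 < k)%N.
Variables i m : nat.
Hypothesis i0 : (0 < i)%N.
Hypothesis imk : (i + m = k)%N.
Local Notation lam := (lebesgue_rV k).
Local Notation D := (@punctured_ball R k).
Local Open Scope ereal_scope.

Lemma chord_volume_lty x : K x -> @chord_volume R n K E i x < +oo.
Proof.
move=> Kx; have cL := chord_set_compact (E := E) cK Kx.
have L0 : @chord_set R n K E x 0%R by exact: chord_set0.
have sL := chord_set_star (E := E) sK Kx.
have mD := measurable_punctured_ball (R := R) (n := k).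
have [b b0 Hb] := direction_radius_bounded cL L0 sL.
have r0 c : (0 <= direction_radius (@chord_set R n K E x) c)%R by exact: direction_radius_ge0.
apply: (@le_lt_trans _ _ (\int[lam]_(c in D) (cst (b ^+ i)%:E) c)).
  apply: ge0_le_integral => //.
  - by move=> c _; rewrite lee_fin exprn_ge0.
  - by apply: measurable_funTS; exact: measurable_direction_radiusX.
  - by move=> c _; rewrite lee_fin; apply: lerXn2r; rewrite ?nnegrE.
rewrite integral_cst// lte_mul_pinfty ?lee_fin ?exprn_ge0//.
exact: lebesgue_punctured_ball_lty.
Qed.

(** [star_moment] turns the chord volume into a moment of the chord set; the dilation that
    straightens it to the wedge brings out [e ^+ i]. *)
Lemma chord_volume_wedge x (e q d : R) : K x -> (0 < e)%R ->
  @chord_set R n K E x = [set c | wedge i q d (c *m dilation i e^-1 1)%R] ->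
  (\int[lam]_(c in D) ((enorm c ^+ m)^-1)%:E) * @chord_volume R n K E i x =
  lam D * ((e ^+ i)%:E * @wedge_moment R k i m e q d).
Proof.
move=> Kx e0 Lx.
have cL := chord_set_compact (E := E) cK Kx.
have L0 : @chord_set R n K E x 0%R by exact: chord_set0.
have sL := chord_set_star (E := E) sK Kx.
rewrite -(star_moment dE cL L0 sL i0 imk); congr (_ * _).
have mW : measurable_fun setT (fun c : 'rV[R]_k => ((enorm c ^+ m)^-1)%:E).
  by apply/measurable_EFinP; exact: measurable_enormXV.
rewrite integral_mkcond (ge0_integral_dilation imk e0 ltr01).
- rewrite expr1n mulr1; congr (_ * _); rewrite /wedge_moment [RHS]integral_mkcond.
  apply: eq_integral => c _; rewrite !patchE.
  suff -> : (c *m dilation i e 1 \in @chord_set R n K E x)%R = (c \in wedge i q d) by [].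
  have dK : (c *m dilation i e 1 *m dilation i e^-1 1 = c)%R.
    by rewrite dilationM mulVf ?gt_eqF// mulr1 dilation_scalar scale1r.
  by apply/idP/idP; rewrite !inE Lx/= dK.
- apply/(measurable_restrictT _ (compact_rV_measurable cL)); exact: measurable_funTS.
- by move=> c; apply: erestrict_ge0 => y _; rewrite lee_fin invr_ge0 exprn_ge0// enorm_ge0.
Qed.

End chord_volume_wedges.

Section sharpness.
Context {R : realType} {n : nat}.
Variable E : {vspace 'rV[R]_n}.
Local Notation k := (\dim E).
Variable i : nat.
Hypotheses (i0 : (0 < i)%N) (ik : (i <= k)%N) (kn : (k < n)%N).

Lemma convex_body_segment_closed (K : set 'rV[R]_n) : convex_body K -> segment_closed K.
Proof. by move=> [cvK _ _]; exact: convex_set_segment_closed. Qed.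

(* In a thin simplex the sections through a point close to the thin face are
   larger than the central one by a factor close to ((n+1)/(i+1))^i. *)
Lemma chord_volume_sharp (C : R) : (i.+1%:R / n.+1%:R) ^+ i < C ->
  exists K : set 'rV[R]_n, [/\ convex_body K, centroid K = 0 &
    exists x, [/\ K x, K 0 &
      (@chord_volume R n K E i 0 < C%:E * @chord_volume R n K E i x)%E]].
Proof.
move=> thC; pose m := (k - i)%N; have imk : (i + m = k)%N by rewrite subnKC.
have dE : (0 < k)%N by exact: leq_trans ik.
set th := i.+1%:R / n.+1%:R : R in thC.
have th0 : 0 <= th ^+ i by rewrite exprn_ge0// divr_ge0.
have C0 : 0 < C by exact: le_lt_trans thC.
(* By Bernoulli [C (1 - x)^i >= C - i C x]; for [x <= u] the loss is at most half of the gap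
   [C - th^i]. *)
pose u := (C - th ^+ i) / (2 * i%:R * C).
have iR : 0 < i%:R :> R by rewrite ltr0n.
have u0 : 0 < u by rewrite divr_gt0 ?subr_gt0// !mulr_gt0.
have niN : (0 < n - i)%N by rewrite subn_gt0 (leq_ltn_trans ik).
have niR : 0 < (n - i)%:R :> R by rewrite ltr0n.
pose q' : R := n.+1%:R^-1.
have q'0 : 0 < q' by rewrite invr_gt0.
(* The three bounds serve in turn to obtain [q' <= q], to control the ratio through [u], and to keep
   [q] positive. *)
pose d := Num.min q' (Num.min (u / (n - i)%:R) ((n - i)%:R^-1 / 2)).
have d0 : 0 < d by rewrite /d !lt_min q'0 divr_gt0//= divr_gt0// invr_gt0.
have dq' : d <= q' by rewrite ge_min lexx.
have du : (n - i)%:R * d <= u.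
  by rewrite mulrC -ler_pdivlMr// /d !ge_min lexx !orbT.
have dh : (n - i)%:R * d <= 2^-1.
  by rewrite -ler_pdivlMl// /d !ge_min lexx !orbT.
pose x := (n - i)%:R * d.
have x0 : 0 < x by rewrite mulr_gt0.
have i1R : 0 < i.+1%:R :> R by [].
pose q := (1 - x) / i.+1%:R.
have q0 : 0 < q by rewrite divr_gt0// subr_gt0 (le_lt_trans dh)// invf_lt1// ltr1n.
have qd : i.+1%:R * q + (n - i)%:R * d = 1.
  by rewrite /q mulrC divfK ?gt_eqF// subrK.
have nE : (n.+1 = i.+1 + (n - i))%N by rewrite addSn subnKC// ltnW// (leq_ltn_trans ik).
have qd' : i.+1%:R * q' + (n - i)%:R * q' = 1.
  by rewrite -mulrDl -natrD -nE mulfV.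
have qq' : q' <= q.
  rewrite -(ler_pM2l i1R).
  have : (n - i)%:R * d <= (n - i)%:R * q' by rewrite ler_pM2l.
  by move: qd qd'; lra.
have ratio : (q' / q) ^+ i < C.
  have t0 : 0 < 1 - x by rewrite subr_gt0 (le_lt_trans dh)// invf_lt1// ltr1n.
  have -> : q' / q = th / (1 - x).
    by rewrite /q' /q /th; field; rewrite !gt_eqF.
  rewrite expr_div_n ltr_pdivrMr ?exprn_gt0//.
  have x1 : x <= 1 by rewrite (le_trans dh)// invf_le1// ler1n.
  have B := bernoulli_sub i (ltW x0) x1.
  apply: lt_le_trans (ler_wpM2l (ltW C0) B).
  have Cu : C * (i%:R * u) = (C - th ^+ i) / 2.
    by rewrite /u; field; rewrite !gt_eqF.
  have : C * (i%:R * x) <= (C - th ^+ i) / 2 by rewrite -Cu !ler_pM2l.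
  by rewrite mulrBr mulr1; move: thC; lra.
pose b := (\int[lebesgue_rV k]_(c in @punctured_ball R k) ((enorm c ^+ m)^-1)%:E)%E.
pose be := lebesgue_rV k (@punctured_ball R k).
have mk : (m < k)%N.
  by apply: (@leq_trans (i + m)); [rewrite -addn1 addnC leq_add2r|rewrite imk].
have mD := measurable_punctured_ball (R := R) (n := k).
have be0 : (0 < be)%E by exact: lebesgue_punctured_ball_gt0.
have befin : be \is a fin_num.
  by rewrite ge0_fin_numE ?ltW// lebesgue_punctured_ball_lty.
have b0 : (0 <= b)%E.
  by apply: integral_ge0 => c _; rewrite lee_fin invr_ge0 exprn_ge0// enorm_ge0.
have bfin : b \is a fin_num by rewrite ge0_fin_numE// negative_moment_lty.
have bgt0 : (0 < b)%E.
  apply: (lt_le_trans be0); rewrite /be -[leLHS]mul1e -integral_cst//.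
  apply: ge0_le_integral => //.
  - by apply: measurable_funTS; apply/measurable_EFinP; exact: measurable_enormXV.
  - move=> c /andP[c0 c1]; rewrite lee_fin invf_ge1 ?exprn_gt0//.
    by rewrite exprn_ile1 ?enorm_ge0.
(* Finiteness of the moment is read off the chord volume of an actual thin body, which would
   otherwise be infinite. *)
have Wlty e : 0 < e -> (@wedge_moment R k i m e q d < +oo)%E.
  move=> e0; have [K [bK _ HK]] := thin_body_exists imk kn e0.
  have [y [Ky _ Ly]] := HK q d (ltW q0) (ltW d0) qd.
  have [_ cK _] := bK; have sK := convex_body_segment_closed bK.
  have HV := chord_volume_wedge cK sK dE i0 imk Ky e0 Ly.
  have Vl : (@chord_volume R n K E i y < +oo)%E by exact: chord_volume_lty.
  rewrite ltey; apply/eqP => Woo; move: HV.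
  rewrite Woo -/b -/be gt0_muley ?lte_fin ?exprn_gt0// gt0_muley// => HV.
  suff : (b * @chord_volume R n K E i y < +oo)%E by rewrite HV.
  by rewrite -(fineK bfin) lte_mul_pinfty ?lee_fin ?fine_ge0.
(* The centroid has size [q'] in all coordinates, [y] the sizes [q] and [d]; both are seen in the
   same body, so the factors [be] and [e ^+ i] cancel in the comparison. *)
have [e e0 He] := @wedge_moment_ratio R k i m imk q q' d q' C q0 q'0 d0 qq' dq' ratio Wlty.
have [K [bK gK HK]] := thin_body_exists imk kn e0.
have [y [Ky _ Ly]] := HK q d (ltW q0) (ltW d0) qd.
have [z [Kz z0 Lz]] := HK q' q' (ltW q'0) (ltW q'0) qd'.
move: Kz Lz; rewrite (z0 erefl) => K0 L0.
exists K; split=> //; exists y; split=> //.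
have [_ cK _] := bK; have sK := convex_body_segment_closed bK.
have H0 := chord_volume_wedge cK sK dE i0 imk K0 e0 L0.
have Hy := chord_volume_wedge cK sK dE i0 imk Ky e0 Ly.
rewrite -(lte_pmul2l _ bgt0)//.
rewrite [X in (X < _)%E](_ : _ = be * ((e ^+ i)%:E * @wedge_moment R k i m e q' q'))%E//.
rewrite [X in (_ < X)%E]muleCA.
rewrite [X in (_ < _ * X)%E](_ : _ = be * ((e ^+ i)%:E * @wedge_moment R k i m e q d))%E//.
rewrite [X in (_ < X)%E]muleCA [X in (_ < _ * X)%E]muleCA lte_pmul2l//.
by rewrite lte_pmul2l ?lte_fin ?exprn_gt0.
Qed.

End sharpness.

Lemma vspace_of_dim_exists (R : realType) n k : (k <= n)%N ->
  exists E : {vspace 'rV[R]_n}, \dim E = k.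
Proof.
move=> kn; pose X := vbasis {:'rV[R]_n}.
have fX : free X by exact: basis_free (vbasisP _).
have sX : size X = n by rewrite size_tuple dimvf /dim/= mul1n.
have fT : free (take k X) by apply: (catl_free (Y := drop k X)); rewrite cat_take_drop.
by exists <<take k X>>%VS; rewrite (eqP fT) size_takel// sX.
Qed.

Lemma image_sub0 (V : zmodType) (K : set V) : [set y - 0 | y in K] = K.
Proof. by apply/seteqP; split=> x /=; [move=> [y Ky <-]; rewrite subr0|exists x; rewrite ?subr0]. Qed.

Theorem theorem2 (R : realType) (n k i : nat)
    (hi : (1 <= i)%N) (hik : (i <= k)%N) (hkn : (k < n)%N) :
  (forall (K : set 'rV[R]_n) (E : {vspace 'rV[R]_n}),
    convex_body K -> centroid K = 0 -> \dim E = k ->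
    exists M : \bar R,
      is_max_over K
        (fun x => dual_volume E i ([set y - x | y in K] `&` [set` E])) M /\
      (((i.+1%:R / n.+1%:R) ^+ i)%:E * M <= dual_volume E i (K `&` [set` E]))%E)
  /\
  (forall C : R, (i.+1%:R / n.+1%:R) ^+ i < C ->
    ~ (forall (K : set 'rV[R]_n) (E : {vspace 'rV[R]_n}),
        convex_body K -> centroid K = 0 -> \dim E = k ->
        forall M : \bar R,
          is_max_over K
            (fun x => dual_volume E i ([set y - x | y in K] `&` [set` E])) M ->
          (C%:E * M <= dual_volume E i (K `&` [set` E]))%E)).
Proof.
have dual_max (K : set 'rV[R]_n) (E : {vspace 'rV[R]_n}) : convex_body K -> \dim E = k ->
    exists2 p, K p & is_max_over K
      (fun x => dual_volume E i ([set y - x | y in K] `&` [set` E]))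
      (@chord_volume R n K E i p).
  move=> bK dEk; have sK := convex_body_segment_closed bK; have [_ cK iK] := bK.
  have dE : (0 < \dim E)%N by rewrite dEk (leq_trans hi).
  have [|p Kp Hp] := @chord_volume_max R n K E cK sK _ i hi.
    by have [w /interior_subset Kw] := iK; exists w.
  exists p => //; split; first by exists p => //; exact: dual_volume_chord.
  by move=> x Kx; rewrite dual_volume_chord//; exact: Hp.
have dual0 (K : set 'rV[R]_n) (E : {vspace 'rV[R]_n}) : convex_body K -> \dim E = k -> K 0 ->
    dual_volume E i (K `&` [set` E]) = @chord_volume R n K E i 0.
  move=> bK dEk K0; have sK := convex_body_segment_closed bK; have [_ cK _] := bK.
  have dE : (0 < \dim E)%N by rewrite dEk (leq_trans hi).
  by rewrite -dual_volume_chord// image_sub0.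
split.
  move=> K E bK gK dEk; have [p Kp maxp] := dual_max K E bK dEk.
  exists (@chord_volume R n K E i p); split=> //.
  have sK := convex_body_segment_closed bK; have [_ cK iK] := bK.
  have K0 : K 0 by exact: nbhs_singleton (centroid_interior cK sK iK gK).
  rewrite dual0//; apply: chord_volume_ge => //; rewrite dEk //.
  exact: leq_trans hik.
(* Any subspace of dimension [k] serves, the thin simplex being built around it. The strict
   inequality found at [x] passes to the maximum, since [C] is nonnegative. *)
move=> C hC H; have [E dEk] := @vspace_of_dim_exists R n k (ltnW hkn).
have [|||K [bK gK [x [Kx K0 lt0x]]]] := @chord_volume_sharp R n E i _ _ _ C hC => //.
- by rewrite dEk.
- by rewrite dEk.
have [p Kp maxp] := dual_max K E bK dEk.
have := H K E bK gK dEk _ maxp; rewrite dual0//.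
apply/negP; rewrite -ltNge; apply: (lt_le_trans lt0x); apply: lee_wpmul2l.
  by rewrite lee_fin (le_trans _ (ltW hC))// exprn_ge0// divr_ge0.
have sK := convex_body_segment_closed bK; have [_ cK _] := bK.
have dE : (0 < \dim E)%N by rewrite dEk (leq_trans hi).
by have [_ /(_ x Kx)] := maxp; rewrite dual_volume_chord.
Qed.
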